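(* Let $\mathbb{K}$ be a semiring, $(\Sigma,M)$ an OP alphabet, and $S:(\Sigma,M)^+\to K$ a series. 1. The following are equivalent: (i) $S=[\![\mathcal{A}]\!]$ for some restricted wOPA $\mathcal{A}$ (over $(\Sigma,M)$ and $\mathbb{K}$). (ii) $S=[\![\varphi]\!]$ for some restricted sentence $\varphi$ of $\mathrm{MSO}(\mathbb{K})$. 2. Let $\mathbb{K}$ be commutative. Then the following are equivalent: (i) $S=[\![\mathcal{A}]\!]$ for some wOPA $\mathcal{A}$ (over $(\Sigma,M)$ and $\mathbb{K}$). (ii) $S=[\![\varphi]\!]$ for some restricted sentence $\varphi$ of $\mathrm{MSO}(\mathbb{K})$.
   Context: A semiring $\mathbb{K}=(K,+,\cdot,0,1)$ has $(K,+,0)$ a commutative monoid, $(K,\cdot,1)$ a monoid, both distributive laws, and $0\cdot x=x\cdot 0=0$; it is commutative if $(K,\cdot,1)$ is. OP alphabets. An OP alphabet is a pair $(\Sigma,M)$ where $\Sigma$ is a finite alphabet, $\#\notin\Sigma$, and $M$ (the operator precedence matrix, OPM) assigns to each ordered pair of symbols of $\Sigma\cup\{\#\}$ at most one of the relations $\lessdot,\doteq,\gtrdot$ (an entry may be empty); we write $a\lessdot b$, $a\doteq b$, $a\gtrdot b$. Always $\#\lessdot a$ and $a\gtrdot\#$ for all $a\in\Sigma$. For $w=a_1\cdots a_n\in\Sigma^+$ put $a_0=a_{n+1}=\#$. The chain relation $\curvearrowright$ on $\{0,\dots,n+1\}$ is defined inductively: for $i<j$, $i\curvearrowright j$ if there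 are positions $i=k_1<\dots<k_m=j$ with $a_{k_1}\lessdot a_{k_2}\doteq\dots\doteq a_{k_{m-1}}\gtrdot a_{k_m}$ and, for each $s\in\{1,\dots,m-1\}$, either $k_s+1=k_{s+1}$ or $k_s\curvearrowright k_{s+1}$. The word $w$ is compatible with $M$ if $0\curvearrowright n+1$; $(\Sigma,M)^+$ is the set of all non-empty words over $\Sigma$ compatible with $M$. Automata. A (nondeterministic) OPA over $(\Sigma,M)$ is $(Q,I,F,\delta)$ with $Q$ a finite set of states, $I,F\subseteq Q$ (initial, final), and $\delta=(\delta_{\mathrm{shift}},\delta_{\mathrm{push}},\delta_{\mathrm{pop}})$, $\delta_{\mathrm{shift}},\delta_{\mathrm{push}}\subseteq Q\times\Sigma\times Q$, $\delta_{\mathrm{pop}}\subseteq Q\times Q\times Q$. A weighted OPA (wOPA) over $(\Sigma,M)$ and $\mathbb{K}$ is $\mathcal{A}=(Q,I,F,\delta,\mathrm{wt})$ with $(Q,I,F,\delta)$ an OPA and $\mathrm{wt}=(\mathrm{wt}_{\mathrm{shift}},\mathrm{wt}_{\mathrm{push}},\mathrm{wt}_{\mathrm{pop}})$, $\mathrm{wt}_{op}:\delta_{op}\to K$. It is restricted (an rwOPA) if $\mathrm{wt}_{\mathrm{pop}}\equiv 1$. A configuration is $\langle\Pi,q,u\#,k\rangle$ with stack $\Pi\in\bot(\Sigma\times Q)^*$, state $q$, remaining input $u\#$, and $k\in K$. With $a$ the topmost alphabet symbol of the stack ($a=\#$ if the stack is $\bot$) and $b$ the next input symbol, moves are: push: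 $\langle\Pi,q,bx,k\rangle\vdash\langle\Pi[b,q],r,x,k\cdot\mathrm{wt}_{\mathrm{push}}(q,b,r)\rangle$ if $a\lessdot b$, $(q,b,r)\in\delta_{\mathrm{push}}$; shift: $\langle\Pi[a,p],q,bx,k\rangle\vdash\langle\Pi[b,p],r,x,k\cdot\mathrm{wt}_{\mathrm{shift}}(q,b,r)\rangle$ if $a\doteq b$, $(q,b,r)\in\delta_{\mathrm{shift}}$; pop: $\langle\Pi[a,p],q,bx,k\rangle\vdash\langle\Pi,r,bx,k\cdot\mathrm{wt}_{\mathrm{pop}}(q,p,r)\rangle$ if $a\gtrdot b$, $(q,p,r)\in\delta_{\mathrm{pop}}$. An accepting run on $w$ is a finite sequence of moves from $\langle\bot,q_I,w\#,1\rangle$ to $\langle\bot,q_F,\#,k\rangle$ with $q_I\in I$, $q_F\in F$; its weight is $\mathrm{wt}(\rho)=k$. The behavior is $[\![\mathcal{A}]\!]:(\Sigma,M)^+\to K$, $[\![\mathcal{A}]\!](w)=\sum_{\rho}\mathrm{wt}(\rho)$, summed over all accepting runs $\rho$ of $\mathcal{A}$ on $w$. A series is a function $S:(\Sigma,M)^+\to K$. Weighted logic. $\mathrm{MSO}(\mathbb{K})=\mathrm{MSO}(\mathbb{K},(\Sigma,M))$ consists of the boolean formulas $\beta::=\mathrm{Lab}_a(x)\mid x\le y\mid x\curvearrowright y\mid x\in X\mid\neg\beta\mid\beta\vee\beta\mid\exists x.\beta\mid\exists X.\beta$ and the weighted formulas $\varphi::=\beta\mid k\mid\varphi\oplus\varphi\mid\varphi\otimes\varphi\mid\bigoplus_x\varphi\mid\bigoplus_X\varphi\mid\prod_x\varphi$,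 where $a\in\Sigma\cup\{\#\}$, $k\in K$, $x,y$ are first-order and $X$ second-order variables. For $w\in(\Sigma,M)^+$ let $[w]=\{1,\dots,|w|\}$. For a finite set $\mathcal{V}\supseteq\mathrm{free}(\varphi)$ of variables, a $(\mathcal{V},w)$-assignment $\sigma$ maps first-order variables of $\mathcal{V}$ to elements of $[w]$ and second-order ones to subsets of $[w]$; $\sigma[x\to i]$, $\sigma[X\to I]$ are the updates. Let $\Sigma_{\mathcal{V}}=\Sigma\times\{0,1\}^{\mathcal{V}}$ with OPM $M_{\mathcal{V}}$ given by the first components: $(a,s)\odot(b,t)$ iff $a\odot b$ for $\odot\in\{\lessdot,\doteq,\gtrdot\}$. A pair $(w,\sigma)$ is encoded as a word over $(\Sigma_{\mathcal{V}},M_{\mathcal{V}})$ via characteristic functions; a word over $\Sigma_{\mathcal{V}}$ is valid if every first-order variable is assigned exactly one position. $(w,\sigma)\models\beta$ is the natural MSO semantics, where boolean quantifiers range over positions (resp. sets of positions) $\{0,\dots,|w|+1\}$ of $\#w\#$, $\mathrm{Lab}_a(x)$ says position $x$ of $\#w\#$ carries $a$, $\le$ is the order on positions and $\curvearrowright$ the chain relation. The semantics $[\![\varphi]\!]_{\mathcal{V}}:(\Sigma_{\mathcal{V}},M_{\mathcal{V}})^+\to K$ is $0$ on non-valid words, and for valid $(w,\sigma)$: $[\![\beta]\!]_{\mathcal{V}}(w,\sigma)=1$ if $(w,\sigma)\models\beta$, else $0$; $[\![k]\!]_{\mathcal{V}}(w,\sigma)=k$; $\oplus$ and $\otimes$ are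 interpreted by $+$ and $\cdot$ pointwise; $[\![\bigoplus_x\varphi]\!]_{\mathcal{V}}(w,\sigma)=\sum_{i\in[w]}[\![\varphi]\!]_{\mathcal{V}\cup\{x\}}(w,\sigma[x\to i])$; $[\![\bigoplus_X\varphi]\!]_{\mathcal{V}}(w,\sigma)=\sum_{I\subseteq[w]}[\![\varphi]\!]_{\mathcal{V}\cup\{X\}}(w,\sigma[X\to I])$; $[\![\prod_x\varphi]\!]_{\mathcal{V}}(w,\sigma)=\prod_{i\in[w]}[\![\varphi]\!]_{\mathcal{V}\cup\{x\}}(w,\sigma[x\to i])$ (product in increasing order of $i$). $[\![\varphi]\!]=[\![\varphi]\!]_{\mathrm{free}(\varphi)}$. A sentence is a formula without free variables; then $[\![\varphi]\!]:(\Sigma,M)^+\to K$. Restricted formulas. The almost boolean formulas are the smallest set containing all constants $k\in K$ and all boolean formulas and closed under $\oplus$ and $\otimes$. Let $\mathrm{const}(\varphi)$ be the set of all elements of $K$ occurring in $\varphi$. $\varphi$ is $\otimes$-restricted if for all subformulas $\psi\otimes\theta$ of $\varphi$ either $\psi$ is almost boolean or $\mathrm{const}(\psi)$ and $\mathrm{const}(\theta)$ commute elementwise; $\prod$-restricted if for all subformulas $\prod_x\psi$ of $\varphi$, $\psi$ is almost boolean; restricted if it is both. *)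

(* Defs.v *)
From mathcomp Require Import all_boot all_algebra.
From mathcomp Require Import boolp classical_sets cardinality fsbigop.

Set Implicit Arguments.
Unset Strict Implicit.
Unset Printing Implicit Defensive.

Import GRing.Theory.

(** * Operator precedence alphabets and compatible words *)

Variant prec := Lessdot | Doteq | Gtrdot.

(* A symbol of Sigma + {#} is an [option Sigma], with [None] for #. *)
Record opm (Sigma : finType) := Opm {
  opm_rel :> option Sigma -> option Sigma -> option prec;
  opm_hashl : forall a : Sigma, opm_rel None (Some a) = Some Lessdot;
  opm_hashr : forall a : Sigma, opm_rel (Some a) None = Some Gtrdot
}.

Section Words.
Variables (Sigma : finType) (M : opm Sigma).

(* Symbol at position k of #w#; the positions are 0, ..., |w|+1. *)
Definition letter (w : seq Sigma) (k : nat) : option Sigma :=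
  nth None (None :: rcons (map Some w) None) k.

(* [ks] is the list k_1 < ... < k_m.  As a_{k_1} is related to a_{k_2} by
   Lessdot and a_{k_(m-1)} to a_{k_m} by Gtrdot, and M relates two symbols by at
   most one relation, one has m >= 3.  [nth 0 ks s] is k_(s+1). *)
Inductive chain (w : seq Sigma) : nat -> nat -> Prop :=
| Chain (ks : seq nat) of
    2 < size ks
  & sorted ltn ks
  & last 0 ks <= (size w).+1
  & M (letter w (nth 0 ks 0)) (letter w (nth 0 ks 1)) = Some Lessdot
  & (forall s, 0 < s -> s.+2 < size ks ->
       M (letter w (nth 0 ks s)) (letter w (nth 0 ks s.+1)) = Some Doteq)
  & M (letter w (nth 0 ks (size ks).-2)) (letter w (nth 0 ks (size ks).-1))
      = Some Gtrdot
  & (forall s, s.+1 < size ks ->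
       (nth 0 ks s).+1 = nth 0 ks s.+1 \/
       chain w (nth 0 ks s) (nth 0 ks s.+1)) :
    chain w (head 0 ks) (last 0 ks).

Definition compatible (w : seq Sigma) : Prop := chain w 0 (size w).+1.

Definition op_word := {w : seq Sigma | w <> [::] /\ compatible w}.

End Words.

(** * Weighted operator precedence automata *)

Local Open Scope ring_scope.

(* The weights are total functions; their values off the transition relations
   are never used. *)
Record wopa (Sigma : finType) (K : pzSemiRingType) := Wopa {
  wopa_state : finType;
  wopa_init : {set wopa_state};
  wopa_final : {set wopa_state};
  wopa_shift : {set wopa_state * Sigma * wopa_state};
  wopa_push : {set wopa_state * Sigma * wopa_state};
  wopa_pop : {set wopa_state * wopa_state * wopa_state};
  wt_shift : wopa_state * Sigma * wopa_state -> K;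
  wt_push : wopa_state * Sigma * wopa_state -> K;
  wt_pop : wopa_state * wopa_state * wopa_state -> K
}.

Definition restricted_wopa (Sigma : finType) (K : pzSemiRingType)
    (A : wopa Sigma K) : Prop :=
  forall t, t \in wopa_pop A -> wt_pop t = 1.

Section Behavior.
Local Open Scope classical_set_scope.
Variables (Sigma : finType) (M : opm Sigma) (K : pzSemiRingType).
Variable A : wopa Sigma K.
Local Notation Q := (wopa_state A).

(* Stack (topmost entry first, the bottom symbol being implicit), state,
   remaining input (the final # being implicit), weight. *)
Definition config : choiceType := (seq (Sigma * Q) * Q * seq Sigma * K)%type.

Definition top (P : seq (Sigma * Q)) : option Sigma := omap fst (ohead P).

Inductive move : config -> config -> Prop :=
| MovePush P q b x k r of
    M (top P) (Some b) = Some Lessdot & (q, b, r) \in wopa_push A :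
    move (P, q, b :: x, k) ((b, q) :: P, r, x, k * wt_push (q, b, r))
| MoveShift P a p q b x k r of
    M (Some a) (Some b) = Some Doteq & (q, b, r) \in wopa_shift A :
    move ((a, p) :: P, q, b :: x, k) ((b, p) :: P, r, x, k * wt_shift (q, b, r))
| MovePop P a p q x k r of
    M (Some a) (ohead x) = Some Gtrdot & (q, p, r) \in wopa_pop A :
    move ((a, p) :: P, q, x, k) (P, r, x, k * wt_pop (q, p, r)).

(* A run is given by the nonempty list of its configurations, which determines
   its moves: M selects the kind of a move, and the two configurations of a move
   determine its transition. *)
Definition accepting_run (w : seq Sigma) (rho : seq config) : Prop :=
  exists c s, [/\ rho = c :: s,
    exists2 qI, qI \in wopa_init A & c = ([::], qI, w, 1),
    path (fun c1 c2 => `[< move c1 c2 >]) c s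
  & exists2 qF, qF \in wopa_final A & exists k, last c s = ([::], qF, [::], k)].

Definition run_weight (rho : seq config) : K :=
  if rho is c :: s then (last c s).2 else 0.

Lemma finite_move (c : config) : finite_set [set c' | move c c'].
Proof.
case: c => [[[P q] x] k].
pose f (r : Q) : config := if x is b :: x'
  then ((b, q) :: P, r, x', k * wt_push (q, b, r)) else (P, q, x, k).
pose g (r : Q) : config := if x is b :: x'
  then if P is (_, p) :: P' then ((b, p) :: P', r, x', k * wt_shift (q, b, r))
       else (P, q, x, k)
  else (P, q, x, k).
pose h (r : Q) : config := if P is (_, p) :: P'
  then (P', r, x, k * wt_pop (q, p, r)) else (P, q, x, k).
have fin (u : Q -> config) : finite_set [set u r | r in [set: Q]].
  by apply: finite_image; apply: finite_finset.
apply: (@sub_finite_set _ _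
  ([set f r | r in setT] `|` ([set g r | r in setT] `|` [set h r | r in setT]))).
  move=> c' /= mv; inversion mv; subst.
  - by left; exists r.
  - by right; left; exists r.
  - by right; right; exists r.
by rewrite !finite_setU; do ![split]; exact: fin.
Qed.

(* Each move decreases 2 * |remaining input| + |stack|. *)
Lemma finite_path_move (c : config) :
  finite_set [set s | path (fun c1 c2 => `[< move c1 c2 >]) c s].
Proof.
pose pot (d : config) := ((size d.1.2).*2 + size d.1.1.1)%N.
have [n] := ubnP (pot c); elim: n c => // n IHn c ltn.
apply: (@sub_finite_set _ _ ([set [::]] `|` \bigcup_(d in [set d | move c d])
    (cons d @` [set s | path (fun c1 c2 => `[< move c1 c2 >]) d s]))).
  case=> [|d s] /=; first by left.
  by case/andP=> /asboolP mv ps; right; exists d => //; exists s.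
rewrite finite_setU; split; first exact: finite_set1.
apply: bigcup_finite; first exact: finite_move.
move=> d /= mv; apply: finite_image; apply: IHn.
rewrite ltnS in ltn; apply: leq_trans ltn.
by case: mv => * /=; rewrite /pot /= ?doubleS ?addSn ?addnS ?ltnS.
Qed.

(* Hence the sum defining [behavior] ranges over a finite set. *)
Lemma finite_accepting_run (w : seq Sigma) :
  finite_set [set rho | accepting_run w rho].
Proof.
pose ini (q : Q) : config := ([::], q, w, 1).
apply: (@sub_finite_set _ _ (\bigcup_(q in [set: Q])
    (cons (ini q) @` [set s | path (fun c1 c2 => `[< move c1 c2 >]) (ini q) s]))).
  move=> rho [c [s [-> [q _ ->] ps _]]].
  by exists q => //; exists s.
apply: bigcup_finite; first exact: finite_finset.
by move=> q _; apply: finite_image; exact: finite_path_move.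
Qed.

Definition behavior (w : op_word M) : K :=
  \sum_(rho \in [set rho | accepting_run (sval w) rho]) run_weight rho.

End Behavior.

(** * Weighted MSO logic *)

Section Formulas.
Variables (Sigma : finType) (K : pzSemiRingType).

(* First- and second-order variables are named by [nat], independently. *)
Inductive bformula :=
| BLab of option Sigma & nat
| BLe of nat & nat
| BChain of nat & nat
| BIn of nat & nat (* BIn x X *)
| BNot of bformula
| BOr of bformula & bformula
| BEx1 of nat & bformula
| BEx2 of nat & bformula.

Inductive wformula :=
| WBool of bformula
| WConst of K
| WAdd of wformula & wformula
| WMul of wformula & wformula
| WSum1 of nat & wformula
| WSum2 of nat & wformula
| WProd of nat & wformula.

(* Free variables; [inl] is first-order and [inr] second-order. *)
Fixpoint bfree (beta : bformula) : seq (nat + nat) :=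
  match beta with
  | BLab _ x => [:: inl x]
  | BLe x y | BChain x y => [:: inl x; inl y]
  | BIn x X => [:: inl x; inr X]
  | BNot b => bfree b
  | BOr b c => bfree b ++ bfree c
  | BEx1 x b => [seq v <- bfree b | v != inl x]
  | BEx2 X b => [seq v <- bfree b | v != inr X]
  end.

Fixpoint wfree (phi : wformula) : seq (nat + nat) :=
  match phi with
  | WBool b => bfree b
  | WConst _ => [::]
  | WAdd f g | WMul f g => wfree f ++ wfree g
  | WSum1 x f | WProd x f => [seq v <- wfree f | v != inl x]
  | WSum2 X f => [seq v <- wfree f | v != inr X]
  end.

Definition sentence (phi : wformula) : Prop := wfree phi = [::].

Fixpoint subformula (psi phi : wformula) : Prop :=
  psi = phi \/
  match phi with
  | WBool _ | WConst _ => False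
  | WAdd f g | WMul f g => subformula psi f \/ subformula psi g
  | WSum1 _ f | WSum2 _ f | WProd _ f => subformula psi f
  end.

Fixpoint almost_boolean (phi : wformula) : bool :=
  match phi with
  | WBool _ | WConst _ => true
  | WAdd f g | WMul f g => almost_boolean f && almost_boolean g
  | WSum1 _ _ | WSum2 _ _ | WProd _ _ => false
  end.

Fixpoint const (phi : wformula) : seq K :=
  match phi with
  | WBool _ => [::]
  | WConst k => [:: k]
  | WAdd f g | WMul f g => const f ++ const g
  | WSum1 _ f | WSum2 _ f | WProd _ f => const f
  end.

Definition otimes_restricted (phi : wformula) : Prop :=
  forall psi theta, subformula (WMul psi theta) phi ->
    almost_boolean psi \/
    {in const psi & const theta, forall k l, GRing.comm k l}.

Definition prod_restricted (phi : wformula) : Prop :=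
  forall x psi, subformula (WProd x psi) phi -> almost_boolean psi.

Definition restricted (phi : wformula) : Prop :=
  otimes_restricted phi /\ prod_restricted phi.

End Formulas.

Section Semantics.
Variables (Sigma : finType) (M : opm Sigma) (K : pzSemiRingType).
Variable w : seq Sigma.

(* Positions of #w#, among which [w] = {1, ..., |w|}. *)
Local Notation pos := 'I_(size w).+2.
Definition inner_pos : {set pos} := [set i : pos | 0 < i <= size w]%N.

(* An assignment (s1, s2) interprets all variables; only its values on the
   free variables of a formula matter (see [wsem_free] below).  Boolean
   quantifiers range over all positions of #w#, weighted ones over [w]. *)
Fixpoint bsat (s1 : nat -> pos) (s2 : nat -> {set pos})
    (beta : bformula Sigma) : Prop :=
  match beta with
  | BLab a x => letter w (s1 x) = a
  | BLe x y => (s1 x <= s1 y)%N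
  | BChain x y => chain M w (s1 x) (s1 y)
  | BIn x X => s1 x \in s2 X
  | BNot b => ~ bsat s1 s2 b
  | BOr b c => bsat s1 s2 b \/ bsat s1 s2 c
  | BEx1 x b => exists i : pos, bsat [eta s1 with x |-> i] s2 b
  | BEx2 X b => exists I : {set pos}, bsat s1 [eta s2 with X |-> I] b
  end.

(* The product is taken in increasing order of positions, which is the order in
   which \prod enumerates ordinals. *)
Fixpoint wsem (s1 : nat -> pos) (s2 : nat -> {set pos})
    (phi : wformula Sigma K) : K :=
  match phi with
  | WBool b => if `[< bsat s1 s2 b >] then 1 else 0
  | WConst k => k
  | WAdd f g => wsem s1 s2 f + wsem s1 s2 g
  | WMul f g => wsem s1 s2 f * wsem s1 s2 g
  | WSum1 x f => \sum_(i in inner_pos) wsem [eta s1 with x |-> i] s2 f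
  | WSum2 X f =>
      \sum_(I in powerset inner_pos) wsem s1 [eta s2 with X |-> I] f
  | WProd x f => \prod_(i in inner_pos) wsem [eta s1 with x |-> i] s2 f
  end.

Lemma bsat_free beta s1 s2 t1 t2 :
    (forall x, inl x \in bfree beta -> s1 x = t1 x) ->
    (forall X, inr X \in bfree beta -> s2 X = t2 X) ->
  bsat s1 s2 beta <-> bsat t1 t2 beta.
Proof.
elim: beta s1 s2 t1 t2 => [a x|x y|x y|x X|b IHb|b IHb c IHc|x b IHb|X b IHb]
  s1 s2 t1 t2 /= h1 h2.
- by rewrite h1 ?inE.
- by rewrite !h1 ?inE ?eqxx ?orbT.
- by rewrite !h1 ?inE ?eqxx ?orbT.
- by rewrite h1 ?h2 ?inE ?eqxx ?orbT.
- by have := IHb _ _ _ _ h1 h2; tauto.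
- have Hb : bsat s1 s2 b <-> bsat t1 t2 b.
    by apply: IHb => z hz; [apply: h1|apply: h2]; rewrite mem_cat hz.
  have Hc : bsat s1 s2 c <-> bsat t1 t2 c.
    by apply: IHc => z hz; [apply: h1|apply: h2]; rewrite mem_cat hz orbT.
  tauto.
- have H i : bsat [eta s1 with x |-> i] s2 b <-> bsat [eta t1 with x |-> i] t2 b.
    apply: IHb => z hz /=; last by apply: h2; rewrite mem_filter hz.
    case: eqP => // /eqP zx; apply: h1; rewrite mem_filter hz andbT.
    by apply: contra zx => /eqP[->].
  by split=> -[i Hi]; exists i; apply/H.
- have H i : bsat s1 [eta s2 with X |-> i] b <-> bsat t1 [eta t2 with X |-> i] b.
    apply: IHb => z hz /=; first by apply: h1; rewrite mem_filter hz.
    case: eqP => // /eqP zx; apply: h2; rewrite mem_filter hz andbT.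
    by apply: contra zx => /eqP[->].
  by split=> -[i Hi]; exists i; apply/H.
Qed.

Lemma wsem_free phi s1 s2 t1 t2 :
    (forall x, inl x \in wfree phi -> s1 x = t1 x) ->
    (forall X, inr X \in wfree phi -> s2 X = t2 X) ->
  wsem s1 s2 phi = wsem t1 t2 phi.
Proof.
have up1 x f i (r1 r2 : nat -> pos) :
    (forall y, inl y \in [seq v <- wfree (K := K) f | v != inl x] ->
       r1 y = r2 y) ->
    forall y, inl y \in wfree f ->
      [eta r1 with x |-> i] y = [eta r2 with x |-> i] y.
  move=> h z hz /=; case: eqP => // /eqP zx; apply: h.
  by rewrite mem_filter hz andbT; apply: contra zx => /eqP[->].
have up2 X f i (r1 r2 : nat -> {set pos}) :
    (forall y, inr y \in [seq v <- wfree (K := K) f | v != inr X] ->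
       r1 y = r2 y) ->
    forall y, inr y \in wfree f ->
      [eta r1 with X |-> i] y = [eta r2 with X |-> i] y.
  move=> h z hz /=; case: eqP => // /eqP zx; apply: h.
  by rewrite mem_filter hz andbT; apply: contra zx => /eqP[->].
elim: phi s1 s2 t1 t2 => [b|k|f IHf g IHg|f IHf g IHg|x f IHf|X f IHf|x f IHf]
  s1 s2 t1 t2 /= h1 h2 //.
- by rewrite (asbool_equiv_eq (bsat_free h1 h2)).
- congr (_ + _); [apply: IHf|apply: IHg] => z hz; [apply: h1|apply: h2
    |apply: h1|apply: h2]; by rewrite mem_cat hz ?orbT.
- congr (_ * _); [apply: IHf|apply: IHg] => z hz; [apply: h1|apply: h2
    |apply: h1|apply: h2]; by rewrite mem_cat hz ?orbT.
- apply: eq_bigr => i _; apply: IHf; first exact: up1 h1.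
  by move=> z hz; apply: h2; rewrite mem_filter hz.
- apply: eq_bigr => i _; apply: IHf; last exact: up2 h2.
  by move=> z hz; apply: h1; rewrite mem_filter hz.
- apply: eq_bigr => i _; apply: IHf; first exact: up1 h1.
  by move=> z hz; apply: h2; rewrite mem_filter hz.
Qed.

End Semantics.

(* The series defined by a sentence.  The initial assignment is irrelevant by
   [wsem_free]. *)
Definition sem (Sigma : finType) (M : opm Sigma) (K : pzSemiRingType)
    (phi : wformula Sigma K) (w : op_word M) : K :=
  wsem M (fun _ => inord 1%N : 'I_(size (sval w)).+2) (fun _ => finset.set0) phi.

(* Main.v *)
(* For a compatible word w, the matrix M alone decides which move an automaton
   makes next, so all runs on w perform one and the same sequence of pushes, shifts
   and pops; the pops are exactly the chains of w.  Over this fixed sequence,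
   deterministic automata on labelled words are closed under complement, product
   and (subset construction) relabelling, hence recognize every boolean formula.

   Both automata and restricted formulas are brought to the Nivat form
     S(w) = sum over labellings u of w accepted by a deterministic automaton,
            of the product of the f(u_i).
   For formulas this is an induction: an almost boolean formula is a step function,
   and each outer sum adds a bit to the label.  For an automaton whose pop weights
   are central, each push guesses the matching pop transition and pays its weight.
   Conversely, a Nivat form is a restricted automaton guessing the labels, and
   acceptance by a deterministic automaton is expressed in MSO by marking every
   position with four states of the run. *)

(* A formula multiplies at most one block of weights per position, in the order of positions,
   whereas unboundedly many pops may happen at one lookahead. A pop weight therefore cannot be paid
   where it arises; it is paid at the push that created the entry, and moving it there past the
   weights in between requires it to be central. Pop weights equal to 1 and commutativity of K both
   give centrality, so one argument serves both parts, and since a Nivat form always yields a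
   restricted automaton, pop weights add no power in the commutative case. The same count explains
   the run labels in MSO: the state before a pop is stored at the popped position, because every
   position is popped at most once. In a product of two formulas the weights of both must be
   interleaved letter by letter. Either all weights of one commute with those of the other, for
   which each normal form records that its weights commute with whatever commutes with the
   constants, or the left factor is almost boolean and its whole value sits on the first label, so
   that nothing has to move. *)
Require Import Defs.
From HB Require Import structures.
From mathcomp Require Import boolp classical_sets fsbigop.
From mathcomp Require Import all_boot all_algebra zify.

Set Implicit Arguments.
Unset Strict Implicit.
Unset Printing Implicit Defensive.
Import GRing.Theory.

(** * The sequence of moves on a compatible word *)

(* In [Push x i] and [Shift x i], position i is read while position x is on top of
   the stack; [Pop v x y] pops v and exposes x at lookahead y. *)
Variant op := Push of nat & nat | Shift of nat & nat | Pop of nat & nat & nat.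

Definition op_code (o : op) : nat * nat * nat + nat * nat * bool :=
  match o with
  | Push x i => inr (x, i, true)
  | Shift x i => inr (x, i, false)
  | Pop v x y => inl (v, x, y)
  end.

Definition op_decode (c : nat * nat * nat + nat * nat * bool) : op :=
  match c with
  | inr (x, i, true) => Push x i
  | inr (x, i, false) => Shift x i
  | inl (v, x, y) => Pop v x y
  end.

Lemma op_codeK : cancel op_code op_decode. Proof. by case. Qed.

HB.instance Definition _ := Equality.copy op (can_type op_codeK).

Section Skeleton.
Variables (Sigma : finType) (M : opm Sigma) (w : seq Sigma).
Implicit Types (P : seq nat) (o : seq op).
Local Notation n := (size w).
Local Notation "x ~[ r ] y" := (M (letter w x) (letter w y) = Some r) (at level 70).

(* Moves from a stack of positions with k letters read.  The bottom of the stack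
   is position 0, so that the topmost symbol is always the letter of the head. *)
Inductive trace : seq nat -> nat -> seq op -> seq nat -> nat -> Prop :=
| TraceNil P k : trace P k [::] P k
| TracePush t P k o P' k' of
    k < n & t ~[Lessdot] k.+1 & trace (k.+1 :: t :: P) k.+1 o P' k' :
    trace (t :: P) k (Push t k.+1 :: o) P' k'
| TraceShift t P k o P' k' of
    k < n & t ~[Doteq] k.+1 & trace (k.+1 :: P) k.+1 o P' k' :
    trace (t :: P) k (Shift t k.+1 :: o) P' k'
| TracePop v x P k o P' k' of
    v ~[Gtrdot] k.+1 & trace (x :: P) k o P' k' :
    trace (v :: x :: P) k (Pop v x k.+1 :: o) P' k'.

Definition complete o := 0 < n /\ trace [:: 0] 0 o [:: 0] n.

(** For y up to |w|+1 this says that x is on top of the stack at some moment with lookahead y: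
    [link_visited] gives one direction, [trace_inv] the other. *)
Definition link x y := x.+1 = y \/ chain M w x y.

Lemma letter0 : letter w 0 = None. Proof. by []. Qed.

Lemma letter_succ k : letter w k.+1 = nth None (rcons (map Some w) None) k.
Proof. by []. Qed.

Lemma letterS k : k < n -> exists2 a, letter w k.+1 = Some a & drop k w = a :: drop k.+1 w.
Proof.
rewrite letter_succ; case: w => // a0 w' kn; exists (nth a0 (a0 :: w') k).
  by rewrite nth_rcons size_map kn (nth_map a0).
exact: drop_nth.
Qed.

Lemma letter_end k : n <= k -> letter w k.+1 = None.
Proof. by rewrite letter_succ nth_rcons size_map leqNgt => /negPf ->; case: eqP. Qed.

Lemma letter_None k : letter w k = None -> 0 < k -> n < k.
Proof.
case: k => // k; case: (ltnP k n) => // /letterS[a -> _] //.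
Qed.

Lemma trace_cat P k o1 P1 k1 o2 P2 k2 :
  trace P k o1 P1 k1 -> trace P1 k1 o2 P2 k2 -> trace P k (o1 ++ o2) P2 k2.
Proof.
by elim=> // *; [apply: TracePush|apply: TraceShift|apply: TracePop]; auto.
Qed.

(** M allows at most one move in each configuration, and the final one allows none, so every partial
    trace is a prefix of the complete one. *)
Lemma trace_prefix P k o1 P1 k1 o :
    trace P k o1 P1 k1 -> trace P k o [:: 0] n ->
  exists2 o2, o = o1 ++ o2 & trace P1 k1 o2 [:: 0] n.
Proof.
move=> tr; elim: tr o => {P k o1 P1 k1}
  [P k|t P k o1 P1 k1 kn m _ IH|t P k o1 P1 k1 kn m _ IH|v x P k o1 P1 k1 m _ IH] o tr.
- by exists o.
- inversion tr; subst; try congruence; first by rewrite ltnn in kn.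
  by case: (IH _ H7) => o2 -> ?; exists o2.
- inversion tr; subst; try congruence; first by rewrite ltnn in kn.
  by case: (IH _ H7) => o2 -> ?; exists o2.
- inversion tr; subst; try congruence.
  by case: (IH _ H7) => o2 -> ?; exists o2.
Qed.

Lemma chain_lt i j : chain M w i j -> i.+1 < j <= n.+1.
Proof.
case=> ks; case: ks => [|a [|b [|c ks]]] //= _ /and3P[ab bc pc] le _ _ _ _.
rewrite le andbT.
suff: c <= last c ks by lia.
elim: ks c {bc le} pc => //= d ks IH c /andP[cd /IH]; lia.
Qed.

(** Induction on j - i. The support of the chain dictates a push at its second position, a shift at
    each later inner one and a pop at the last. The gap between two neighbours is empty or a shorter
    chain, whose trace restores the stack. Position j is only the lookahead, hence [j.-1] letters
    read. *)
Lemma chain_trace i j : chain M w i j ->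
  forall P, exists o v, trace (i :: P) i (rcons o (Pop v i j)) (i :: P) j.-1.
Proof.
have [d] := ubnP (j - i); elim: d i j => // d IH i j ltd ch P.
have [ij jn] := andP (chain_lt ch).
case: ch ltd ij jn => ks; case: ks => [|k1 [|k2 ks]] //= ks0 /andP[k12 srt] le mpush mshift mpop lk ltd ij jn.
have go x y Q : x < y -> y - x < d -> x.+1 = y \/ chain M w x y ->
    exists o, trace (x :: Q) x o (x :: Q) y.-1.
  move=> xy xyd [<-|ch]; first by exists [::]; apply: TraceNil.
  by case: (IH _ _ xyd ch Q) => o [v tr]; exists (rcons o (Pop v x y)).
have lelast k s : path ltn k s -> k <= last k s.
  by elim: s k => //= a s IHs k /andP[ka /IHs]; lia.
(* The part after the push: k is the support position now on top, s the rest of the support. *)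
have body s k : path ltn k s -> 0 < size s -> last k s <= n.+1 -> k1 < k -> last k s - k1 < d.+1 ->
   (forall t, t.+1 < size s -> nth 0 (k :: s) t ~[Doteq] nth 0 s t) ->
   nth 0 (k :: s) (size s).-1 ~[Gtrdot] last k s ->
   (forall t, t < size s -> link (nth 0 (k :: s) t) (nth 0 s t)) ->
   exists o v, trace (k :: k1 :: P) k (rcons o (Pop v k1 (last k s))) (k1 :: P) (last k s).-1.
  elim: s k => // l [_ k|m s IHs k].
    move=> /= /andP[kl _] _ ln k1k ld _ mg /(_ 0 isT) lkl.
    case: (go k l (k1 :: P)) => //; first lia.
    move=> o tr; exists o, k; rewrite -cats1; apply: trace_cat tr _.
    have El : l = l.-1.+1 by lia.
    by rewrite [X in Pop _ _ X]El; apply: TracePop; rewrite -?El //; apply: TraceNil.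
  move=> p _ ln k1k ld md mg ml.
  have /= /and3P[kl lm pm] := p; have lem := lelast _ _ pm; rewrite /= in ln ld.
  case: (IHs l) => //=; try lia.
  - by move=> t ts; apply: (md t.+1).
  - by move=> t ts; apply: (ml t.+1).
  move=> o [v tr]; case: (go k l (k1 :: P)) => //; [lia|exact: (ml 0)|].
  move=> o' tr'; exists (o' ++ Shift k l :: o), v; rewrite rcons_cat; apply: trace_cat tr' _.
  have El : l = l.-1.+1 by lia.
  rewrite rcons_cons [X in Shift _ X]El; apply: TraceShift; rewrite -?El //; [lia|exact: (md 0)].
have lk1 : last k2 ks = last k1 (k2 :: ks) by [].
have k2l : k2 < last k2 ks by case: (ks) ks0 srt => //= a s _ /andP[ka /lelast]; lia.
case: (body ks k2) => //; try lia.
- by move=> t ts; apply: (mshift t.+1).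
- by move: mpop; case: (ks) ks0 => //= a s _; rewrite (last_nth 0).
- by move=> t ts; apply: (lk t.+1).
move=> o [v tr]; case: (go k1 k2 P) => //; [lia|exact: (lk 0)|].
move=> o' tr'; exists (o' ++ Push k1 k2 :: o), v; rewrite rcons_cat; apply: trace_cat tr' _.
have El : k2 = k2.-1.+1 by lia.
rewrite rcons_cons [X in Push _ X]El; apply: TracePush; rewrite -?El //; lia.
Qed.

Lemma complete_exists : w <> [::] -> compatible M w -> exists o, complete o.
Proof.
move=> w0 /chain_trace /(_ [::])[o [v tr]]; exists (rcons o (Pop v 0 n.+1)); split=> //.
by case: (w) w0.
Qed.

Lemma trace_read P k o P' k' i : trace P k o P' k' -> k < i <= k' ->
  exists o1 o2 S, [/\ o = o1 ++ o2, trace P k o1 (i :: S) i & trace (i :: S) i o2 P' k'].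
Proof.
elim=> {P k o P' k'} [P k|t P k o P1 k1 kn m tr IH|t P k o P1 k1 kn m tr IH|v x P k o P1 k1 m tr IH].
- by lia.
- move=> h; have [->|ki] := eqVneq i k.+1.
    by exists [:: Push t k.+1], o, (t :: P); split=> //; apply: TracePush => //; apply: TraceNil.
  case: IH => [|o1 [o2 [S [-> t1 t2]]]]; first lia.
  by exists (Push t k.+1 :: o1), o2, S; split=> //; apply: TracePush.
- move=> h; have [->|ki] := eqVneq i k.+1.
    by exists [:: Shift t k.+1], o, P; split=> //; apply: TraceShift => //; apply: TraceNil.
  case: IH => [|o1 [o2 [S [-> t1 t2]]]]; first lia.
  by exists (Shift t k.+1 :: o1), o2, S; split=> //; apply: TraceShift.
- move=> /IH [o1 [o2 [S [-> t1 t2]]]].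
  by exists (Pop v x k.+1 :: o1), o2, S; split=> //; apply: TracePop.
Qed.

Variable ops : seq op.
Hypothesis Cops : complete ops.

(** Right after x is read it is on top. If there is a chain from x to y, its trace is forced and
    returns to x with lookahead y, its last move being the required pop; otherwise y is the next
    letter already. *)
Lemma link_visited x y : link x y -> y <= n.+1 ->
  exists o1 o2 S, [/\ ops = o1 ++ o2, trace [:: 0] 0 o1 (x :: S) y.-1,
    trace (x :: S) y.-1 o2 [:: 0] n & chain M w x y -> exists v, Pop v x y \in o1].
Proof.
have [_ tr] := Cops.
move=> lk yn; have xn : x <= n by case: lk yn => [<-|/chain_lt]; lia.
have [o1 [o2 [S [E t1 t2]]]] : exists o1 o2 S,
    [/\ ops = o1 ++ o2, trace [:: 0] 0 o1 (x :: S) x & trace (x :: S) x o2 [:: 0] n].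
  have [->|x0] := eqVneq x 0; first by exists [::], ops, [::]; split=> //; apply: TraceNil.
  by apply: trace_read; first exact: tr; lia.
have [ch|nch] := pselect (chain M w x y).
  have [o [v t3]] := chain_trace ch S; have [o3 E3 t4] := trace_prefix t3 t2.
  exists (o1 ++ rcons o (Pop v x y)), o3, S; split=> //.
  - by rewrite -catA -E3.
  - exact: trace_cat t1 t3.
  - by move=> _; exists v; rewrite mem_cat mem_rcons inE eqxx orbT.
by case: lk => [ey|//]; subst y; exists o1, o2, S; split.
Qed.

Lemma chain_pop x y : chain M w x y -> exists v, Pop v x y \in ops.
Proof.
move=> ch; have [_ yn] := andP (chain_lt ch).
have [o1 [o2 [S [-> _ _ /(_ ch)[v h]]]]] := link_visited (or_intror ch) yn.
by exists v; rewrite mem_cat h.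
Qed.

(* A chain from x still open at its last position t. *)
Definition open_chain x t := exists ks, [/\
    [/\ 1 < size ks, sorted ltn ks, head 0 ks = x & last 0 ks = t],
    nth 0 ks 0 ~[Lessdot] nth 0 ks 1,
    (forall s, 0 < s -> s.+1 < size ks -> nth 0 ks s ~[Doteq] nth 0 ks s.+1)
  & (forall s, s.+1 < size ks -> link (nth 0 ks s) (nth 0 ks s.+1))].

Lemma open_push x y : link x y -> x < y -> x ~[Lessdot] y -> open_chain x y.
Proof.
move=> lk xy m; exists [:: x; y]; split=> //; first by split=> //=; rewrite xy.
  by case=> [|[|s]].
by case=> [|[|s]].
Qed.

Lemma nth_rcons_lt (T : Type) (x0 : T) s a i : i < size s -> nth x0 (rcons s a) i = nth x0 s i.
Proof. by rewrite nth_rcons => ->. Qed.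

Lemma sorted_rcons_lt ks y : sorted ltn ks -> last 0 ks < y -> sorted ltn (rcons ks y).
Proof. by case: ks => //= a s; rewrite rcons_path => ->. Qed.

Lemma open_shift x t y : open_chain x t -> link t y -> t < y -> t ~[Doteq] y -> open_chain x y.
Proof.
move=> [ks [[sz srt hd lst] m1 m2 lk]] lkt ty m; exists (rcons ks y).
have E : nth 0 ks (size ks).-1 = t by rewrite nth_last.
have E2 : nth 0 (rcons ks y) (size ks) = y by rewrite nth_rcons ltnn eqxx.
split; first split.
- by rewrite size_rcons; lia.
- by apply: sorted_rcons_lt; rewrite ?lst.
- by case: ks sz hd {srt lst m1 m2 lk E E2}.
- by rewrite last_rcons.
- by rewrite !nth_rcons_lt //; lia.
- move=> s s0; rewrite size_rcons ltnS => h; rewrite nth_rcons_lt //.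
  case: (ltnP s.+1 (size ks)) => h'; first by rewrite nth_rcons_lt //; apply: m2.
  have Es : s = (size ks).-1 by lia.
  have Es1 : s.+1 = size ks by lia.
  by rewrite Es1 E2 Es E.
- move=> s; rewrite size_rcons ltnS => h; rewrite nth_rcons_lt //.
  case: (ltnP s.+1 (size ks)) => h'; first by rewrite nth_rcons_lt //; apply: lk.
  have Es : s = (size ks).-1 by lia.
  have Es1 : s.+1 = size ks by lia.
  by rewrite Es1 E2 Es E.
Qed.

Lemma open_pop x t y : open_chain x t -> link t y -> t < y <= n.+1 -> t ~[Gtrdot] y ->
  chain M w x y.
Proof.
move=> [ks [[sz srt hd lst] m1 m2 lk]] lkt /andP[ty yn] m.
have E : nth 0 ks (size ks).-1 = t by rewrite nth_last.
have E2 : nth 0 (rcons ks y) (size ks) = y by rewrite nth_rcons ltnn eqxx.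
have -> : x = head 0 (rcons ks y) by case: ks sz hd {srt lst m1 m2 lk E E2}.
have El : y = last 0 (rcons ks y) by rewrite last_rcons.
rewrite {2}El; constructor.
- by rewrite size_rcons; lia.
- by apply: sorted_rcons_lt; rewrite ?lst.
- by rewrite last_rcons.
- by rewrite !nth_rcons_lt //; lia.
- move=> s s0; rewrite size_rcons !ltnS => h; rewrite !nth_rcons_lt //; [exact: m2|lia].
- by rewrite size_rcons /= E2 nth_rcons_lt ?E //; lia.
- move=> s; rewrite size_rcons ltnS => h; rewrite nth_rcons_lt //.
  case: (ltnP s.+1 (size ks)) => h'; first by rewrite nth_rcons_lt //; apply: lk.
  have Es : s = (size ks).-1 by lia.
  have Es1 : s.+1 = size ks by lia.
  by rewrite Es1 E2 Es E.
Qed.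

Fixpoint opens P : Prop :=
  if P is t :: (x :: _) as P' then [/\ x < t, open_chain x t & opens P'] else True.

Definition stack_inv P k := [/\ opens P, link (head 0 P) k.+1, head 0 P <= k & k <= n].

Definition op_ok (e : op) :=
  match e with
  | Push x i => [/\ 0 < i <= n, x < i, link x i & x ~[Lessdot] i]
  | Shift x i => [/\ 0 < i <= n, x < i, link x i & x ~[Doteq] i]
  | Pop v x y => [/\ x < v < y, y <= n.+1, link v y, v ~[Gtrdot] y & chain M w x y]
  end.

(** A push opens a chain from the entry below, a shift extends it, and a pop closes it; the closed
    chain is the new link from the exposed entry to the lookahead. *)
Lemma trace_inv P k o P' k' : trace P k o P' k' -> stack_inv P k ->
  stack_inv P' k' /\ forall e, e \in o -> op_ok e.
Proof.
elim=> {P k o P' k'} [P k|t P k o P1 k1 kn m tr IH|t P k o P1 k1 kn m tr IH|v x P k o P1 k1 m tr IH]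
  [/= op lk hk kn'].
- by split.
- case: IH => [|? IH]; first by split=> //=; [split=> //; exact: open_push|left].
  by split=> // e; rewrite inE => /predU1P[-> /=|/IH].
- case: IH => [|? IH].
    split=> //=; last by left.
    by case: P op {tr} => //= x P [xt oc ops']; split=> //; [lia|apply: open_shift oc _ _ m].
  by split=> // e; rewrite inE => /predU1P[-> /=|/IH].
- case: op => xv oc op.
  have ch : chain M w x k.+1 by apply: open_pop oc lk _ m; lia.
  case: IH => [|? IH]; first by split=> //=; [right|lia].
  by split=> // e; rewrite inE => /predU1P[-> /=|/IH] //; split=> //; lia.
Qed.

Lemma stack_inv0 : stack_inv [:: 0] 0. Proof. by split=> //; left. Qed.

Lemma op_okP e : e \in ops -> op_ok e.
Proof. by have [_ tr] := Cops; have [_] := trace_inv tr stack_inv0; apply. Qed.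

Lemma chainE x y : chain M w x y <-> exists v, Pop v x y \in ops.
Proof. by split=> [/chain_pop //|[v /op_okP[]]]. Qed.

Lemma link_push x i : link x i -> 0 < i <= n -> x ~[Lessdot] i -> Push x i \in ops.
Proof.
case: i => // i lk iN m; have [|o1 [o2 [S [-> _ tr _]]]] := link_visited lk; first lia.
rewrite mem_cat; simpl in tr; inversion tr; subst; try congruence; try lia.
by rewrite inE eqxx orbT.
Qed.

Lemma link_shift x i : link x i -> 0 < i <= n -> x ~[Doteq] i -> Shift x i \in ops.
Proof.
case: i => // i lk iN m; have [|o1 [o2 [S [-> _ tr _]]]] := link_visited lk; first lia.
rewrite mem_cat; simpl in tr; inversion tr; subst; try congruence; try lia.
by rewrite inE eqxx orbT.
Qed.

Lemma pop_late P k o P' k' v x y : trace P k o P' k' -> Pop v x y \in o -> k < y.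
Proof.
elim=> {P k o P' k'} // [t P k o P' k' _ _ _|t P k o P' k' _ _ _|v' x' P k o P' k' _ _].
- by rewrite inE /= => IH /IH; lia.
- by rewrite inE /= => IH /IH; lia.
- by move=> IH; rewrite inE => /predU1P[[_ _ ->]|/IH].
Qed.

Lemma pop_top P k o P' k' v x y : trace P k o P' k' -> opens P ->
  Pop v x y \in o -> y = k.+1 -> v <= head 0 P.
Proof.
elim=> {P k o P' k'} // [t P k o P' k' _ _ tr _|t P k o P' k' _ _ tr _|v' x' P k o P' k' _ _ IH].
- by rewrite inE /= => _ /(pop_late tr); lia.
- by rewrite inE /= => _ /(pop_late tr); lia.
- move=> /= [xv _ op]; rewrite inE => /predU1P[[-> _ _]//|h e].
  by have /= := IH op h e; lia.
Qed.

(** While one lookahead waits, the stack is peeled from the top: each pop removes the position that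
    the previous one exposed, so nothing exposed lies strictly between v and x. *)
Lemma pop_between P k o P' k' v x v' t y : trace P k o P' k' -> stack_inv P k ->
  Pop v x y \in o -> Pop v' t y \in o -> ~~ (x < t < v).
Proof.
elim=> {P k o P' k'} // [t0 P k o P' k' kn m tr IH|t0 P k o P' k' kn m tr IH|v0 x0 P k o P' k' m tr IH] iv.
- rewrite !inE /=; apply: IH.
  by have [] := trace_inv (TracePush kn m (TraceNil _ _)) iv.
- rewrite !inE /=; apply: IH.
  by have [] := trace_inv (TraceShift kn m (TraceNil _ _)) iv.
- have [iv' _] := trace_inv (TracePop m (TraceNil _ _)) iv.
  have op' : opens (x0 :: P) by case: iv'.
  rewrite !inE => /predU1P[[-> -> ->]|h1] /predU1P[h2|h2].
  + by case: h2 => _ ->; lia.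
  + have [vt _ _ _ _] := (trace_inv tr iv').2 _ h2.
    by have /= := pop_top tr op' h2 erefl; lia.
  + case: h2 h1 => _ -> -> h1.
    by have /= := pop_top tr op' h1 erefl; lia.
  + exact: IH.
Qed.

(** The positions linked to y are the successive stack tops while y waits, and a pop joins two
    neighbours among them. This describes pops by letters and chains alone, which MSO can
    express. *)
Lemma popE v x y : Pop v x y \in ops <->
  [/\ x < v, link v y, letter w v <> None, chain M w x y
    & forall t, x < t < v -> ~ link t y].
Proof.
have [_ tr] := Cops; split.
  move=> h; have [/andP[xv vy] yn lk m ch] := op_okP h; split=> //.
    by move=> /letter_None; lia.
  move=> t xtv [ty|/chain_pop[v' h']]; first lia.
  by have := pop_between tr stack_inv0 h h'; rewrite xtv.
(* v' is the entry really popped when x appears at y. If v' < v, it contradicts [nb]; if v' > v,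
   then v would be exposed strictly between x and v'. *)
move=> [xv lk lv /chain_pop[v' h] nb].
have [/andP[xv' v'y] yn lk' m ch] := op_okP h.
have [<-//|nv] := eqVneq v' v.
have [vv|vv] := ltnP v v'; last by case: (nb v'); first lia.
case: lk => [|/chain_pop[v2 h2]]; first lia.
by have := pop_between tr stack_inv0 h h2; rewrite xv vv.
Qed.

Lemma pushE x i : Push x i \in ops <->
  [/\ link x i, letter w i <> None & x ~[Lessdot] i].
Proof.
split=> [/op_okP[]|[lk li m]].
  by move=> /andP[i0 iN] _ lk m; split=> // /letter_None; lia.
apply: link_push => //; have i0 : 0 < i by case: lk => [<-//|/chain_lt]; lia.
by case: i i0 li {lk m} => // i _; case: (ltnP i n) => // /letter_end ->.
Qed.

Lemma shiftE x i : Shift x i \in ops <->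
  [/\ link x i, letter w i <> None & x ~[Doteq] i].
Proof.
split=> [/op_okP[]|[lk li m]].
  by move=> /andP[i0 iN] _ lk m; split=> // /letter_None; lia.
apply: link_shift => //; have i0 : 0 < i by case: lk => [<-//|/chain_lt]; lia.
by case: i i0 li {lk m} => // i _; case: (ltnP i n) => // /letter_end ->.
Qed.

End Skeleton.

(** * Deterministic automata on labelled words *)

(* Positions 0 and |w|+1 are never read: their labels act through [dini] and [dfin]. *)
Record dopa (T : finType) := Dopa {
  dstate : finType;
  dini : T -> dstate;
  dpush : dstate -> T -> dstate;
  dshift : dstate -> T -> dstate;
  dpop : dstate -> dstate -> dstate;
  dfin : dstate -> T -> bool
}.

Section Run.
Variables (T : finType) (D : dopa T).
Local Notation dcfg := (dstate D * seq (dstate D))%type.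

(** The move decides which transition applies; the automaton only computes states. A pop on the
    empty stack, which no complete trace performs, leaves the configuration unchanged. *)
Definition dstep (g : nat -> T) (c : dcfg) (e : op) : dcfg :=
  match e with
  | Push _ i => (dpush c.1 (g i), c.1 :: c.2)
  | Shift _ i => (dshift c.1 (g i), c.2)
  | Pop _ _ _ => if c.2 is p :: s then (dpop c.1 p, s) else c
  end.

Definition accept (g : nat -> T) (n : nat) (o : seq op) : bool :=
  dfin (foldl (dstep g) (dini D (g 0), [::]) o).1 (g n.+1).

End Run.

Definition read_of (e : op) : option nat :=
  match e with Push _ i | Shift _ i => Some i | Pop _ _ _ => None end.

Definition reads (o : seq op) : seq nat := pmap read_of o.

Lemma dstep_ext (T : finType) (D : dopa T) g g' (c : dstate D * seq (dstate D)) o :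
  {in reads o, g =1 g'} -> foldl (dstep g) c o = foldl (dstep g') c o.
Proof.
elim: o c => //= e o IH c h; have -> : dstep g c e = dstep g' c e.
  by case: e h => //= x i h; rewrite h // inE eqxx.
by apply: IH => i hi; apply: h; case: e => //= *; rewrite inE hi orbT.
Qed.

(** Serves both relabelling, with h the identity, and products, with h a projection and f the
    identity. *)
Lemma dstep_hom (T T' : finType) (D : dopa T) (D' : dopa T') (f : T -> T')
    (h : dstate D -> dstate D') g c o :
    (forall q a, h (dpush q a) = dpush (h q) (f a)) ->
    (forall q a, h (dshift q a) = dshift (h q) (f a)) ->
    (forall q p, h (dpop q p) = dpop (h q) (h p)) ->
  foldl (dstep (f \o g)) (h c.1, map h c.2) o =
    (fun c => (h c.1, map h c.2)) (foldl (dstep g) c o).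
Proof.
move=> h1 h2 h3; elim: o c => //= e o IH [q s]; rewrite -IH; congr foldl.
by case: e => /= [x i|x i|v x y]; rewrite ?h1 ?h2 //; case: s => //= p s; rewrite h3.
Qed.

(** * Relabelling by the subset construction *)

Section Projection.
Variables (T T' : finType) (R : T -> T' -> bool) (D : dopa T').
Local Notation Q := (dstate D).

(* Subset construction: a state is the set of pairs (current state, state stored
   in the topmost stack entry). *)
Definition proj_dopa : dopa T := {|
  dstate := {set Q * Q};
  dini a := [set p | [exists b, R a b && (p == (dini D b, dini D b))]];
  dpush S a := [set p | [exists b, R a b && [exists d, ((p.2, d) \in S) && (p.1 == dpush p.2 b)]]];
  dshift S a := [set p | [exists b, R a b && [exists q, ((q, p.2) \in S) && (p.1 == dshift q b)]]];
  dpop S S' := [set p | [exists q, exists q', [&& (q, q') \in S, (q', p.2) \in S' & p.1 == dpop q q']]];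
  dfin S a := [exists b, R a b && [exists p in S, dfin p.1 b]]
|}.

(** A concrete stack threads a stack of sets: the second component of each pair is the state stored
    in the entry below. At the bottom nothing is stored, so any second component will do. *)
Fixpoint consistent (q : Q) (s : seq Q) (S : {set Q * Q}) (Ss : seq {set Q * Q}) : Prop :=
  match s, Ss with
  | [::], [::] => exists d, (q, d) \in S
  | p :: s', S' :: Ss' => (q, p) \in S /\ consistent p s' S' Ss'
  | _, _ => False
  end.

Definition sim (c : Q * seq Q) (C : {set Q * Q} * seq {set Q * Q}) : Prop :=
  consistent c.1 c.2 C.1 C.2.

Lemma consistent_mem q s S Ss : consistent q s S Ss -> exists d, (q, d) \in S.
Proof. by case: s Ss => [|p s] [|S' Ss] //= [h _]; exists p. Qed.

Lemma sim_step g g' c C e : (if read_of e is Some i then R (g i) (g' i) else true) ->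
  sim c C -> sim (dstep g' c e) (dstep (D := proj_dopa) g C e).
Proof.
case: c C e => q s [S Ss] [x i|x i|v x y] /= Ri; rewrite /sim /=.
- move=> h; split=> //; rewrite inE; apply/existsP; exists (g' i); rewrite Ri /=.
  by apply/existsP; case: (consistent_mem h) => d hd; exists d; rewrite hd eqxx.
- have mem d : (q, d) \in S -> (dshift q (g' i), d) \in dshift (d := proj_dopa) S (g i).
    move=> h; rewrite inE; apply/existsP; exists (g' i); rewrite Ri /=.
    by apply/existsP; exists q; rewrite h eqxx.
  by case: s Ss => [|p s] [|S' Ss] //= [h1 h2]; [exists h1; exact: mem|split=> //; exact: mem].
- case: s Ss => [|p s] [|S' Ss] //= [h1].
  have mem d : (p, d) \in S' -> (dpop q p, d) \in dpop (d := proj_dopa) S S'.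
    by move=> h; rewrite inE; apply/existsP; exists q; apply/existsP; exists p; rewrite h1 h eqxx.
  by case: s Ss => [|p' s] [|S'' Ss] //= [h2 h3]; [exists h2; exact: mem|split=> //; exact: mem].
Qed.

(** Going backwards, a move fixes only the label of the position it reads; g0 supplies all
    others. *)
Lemma sim_back g g0 c' C e : sim c' (dstep (D := proj_dopa) g C e) ->
  exists g' c, [/\ sim c C, c' = dstep g' c e,
    if read_of e is Some i then R (g i) (g' i) else true
  & forall j, read_of e <> Some j -> g' j = g0 j].
Proof.
case: c' C e => q s [S Ss] [x i|x i|v x y]; rewrite /sim /=.
- case: s => [//|p s] [] /=; rewrite inE => /existsP[b /andP[Rb /existsP[d /= /andP[hd /eqP ->]]]] h.
  exists [eta g0 with i |-> b], (p, s); rewrite /= eqxx; split=> // j ij.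
  by case: eqP => // ji; rewrite ji in ij.
- have mem d : (q, d) \in dshift (d := proj_dopa) S (g i) ->
      exists q' b, [/\ (q', d) \in S, R (g i) b & q = dshift q' b].
    by rewrite inE => /existsP[b /andP[Rb /existsP[q' /= /andP[h /eqP]]]]; exists q', b.
  have upd b j : Some i <> Some j -> [eta g0 with i |-> b] j = g0 j.
    by move=> /= ij; case: eqP => // ji; rewrite ji in ij.
  case: s Ss => [|p s] [|S' Ss] //= [].
    move=> d /mem[q' [b [h1 h2 ->]]]; exists [eta g0 with i |-> b], (q', [::]).
    by rewrite /= eqxx; split=> //; [exists d|exact: upd].
  move=> /mem[q' [b [h1 h2 ->]]] h; exists [eta g0 with i |-> b], (q', p :: s).
  by rewrite /= eqxx; split=> //; exact: upd.
- have mem S' d : (q, d) \in dpop (d := proj_dopa) S S' ->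
      exists q' p, [/\ (q', p) \in S, (p, d) \in S' & q = dpop q' p].
    by rewrite inE => /existsP[q' /existsP[p /= /and3P[h1 h2 /eqP]]]; exists q', p.
  case: Ss => [|S' Ss] /=.
    by case: s => [|//] h; exists g0, (q, [::]).
  case: s Ss => [|p s] [|S'' Ss] //= [].
    move=> d /mem[q' [p [h1 h2 ->]]]; exists g0, (q', [:: p]).
    by split=> //=; split=> //; exists d.
  by move=> /mem[q' [p' [h1 h2 ->]]] h; exists g0, (q', p' :: p :: s).
Qed.

Lemma sim_run g g' c C o : {in reads o, forall i, R (g i) (g' i)} -> sim c C ->
  sim (foldl (dstep g') c o) (foldl (dstep (D := proj_dopa) g) C o).
Proof.
elim: o c C => //= e o IH c C h sc; apply: IH.
  by move=> i hi; apply: h; case: e => //= *; rewrite inE hi orbT.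
by apply: sim_step sc; case: e h => //= x i; apply; rewrite inE eqxx.
Qed.

(** Every position is read at most once, so the labels chosen at different moves never conflict. *)
Lemma sim_run_back g g0 c' C o : uniq (reads o) ->
    sim c' (foldl (dstep (D := proj_dopa) g) C o) ->
  exists g' c, [/\ sim c C, c' = foldl (dstep g') c o,
    {in reads o, forall i, R (g i) (g' i)} & forall j, j \notin reads o -> g' j = g0 j].
Proof.
elim: o C => [|e o IH] C /= uo sc; first by exists g0, c'; split.
have uo' : uniq (reads o) by case: e uo {sc} => //= x i /andP[].
have [g1 [c1 [s1 -> R1 E1]]] := IH _ uo' sc.
have [g2 [c2 [s2 E R2 E2]]] := sim_back g1 s1.
exists g2, c2; split=> //.
- rewrite E /=; apply: dstep_ext => i hi; rewrite E2 //.
  by case: e uo {E s1 sc E2 R2} => //= x j /andP[+ _] [ij]; rewrite ij hi.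
- move=> i; rewrite /reads /=; case: e uo R2 E2 {E s1 sc} => /= [x j|x j|v x y] uo R2 E2 /=.
  + by rewrite inE => /predU1P[->//|hi]; rewrite E2 ?R1 // => -[ij]; move: uo; rewrite ij hi.
  + by rewrite inE => /predU1P[->//|hi]; rewrite E2 ?R1 // => -[ij]; move: uo; rewrite ij hi.
  + by move=> hi; rewrite E2 ?R1.
- move=> j hj; rewrite E2; last by case: e hj {E s1 sc E2 R2 uo} => //= x i hj [ij]; rewrite ij inE eqxx in hj.
  by apply: E1; case: e hj {E s1 sc E2 R2 uo} => //= x i; rewrite inE negb_or => /andP[].
Qed.

Lemma accept_proj g n o : uniq (reads o) -> {in reads o, forall i, 0 < i <= n} ->
    (foldl (dstep (D := proj_dopa) g) (dini proj_dopa (g 0), [::]) o).2 = [::] ->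
  accept proj_dopa g n o <->
  exists g', (forall i, i <= n.+1 -> i \in 0 :: n.+1 :: reads o -> R (g i) (g' i)) /\ accept D g' n o.
Proof.
move=> uo ro; set C := foldl _ _ _ => C2.
split.
  rewrite /accept -/C => /existsP[b /andP[Rb /existsP[[q d] /= /andP[hq fq]]]].
  have sc : sim (q, [::]) C by rewrite /sim C2; exists d.
  (* With default label b, the unread position n+1 receives the label that makes the last state
     final. *)
  have [g' [[q0 s0] [s1 E R1 E1]]] := sim_run_back (fun=> b) uo sc.
  move: s1; rewrite /sim; case: s0 E => [|//] E /= [d0]; rewrite inE.
  move=> /existsP[b0 /andP[Rb0 /eqP[q0E _]]].
  have n0 : 0 \notin reads o by apply/negP => /ro.
  have nn : n.+1 \notin reads o by apply/negP => /ro; lia.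
  (* Position 0 is not read either; its label b0 is the one behind the initial state. *)
  exists (fun i => if i == 0 then b0 else g' i); split.
    move=> i _; rewrite !inE => /or3P[/eqP->//|/eqP->|hi].
      by rewrite /= E1.
    by case: eqP => [i0|_]; [rewrite i0 (negPf n0) in hi|exact: R1].
  rewrite /accept /= E1 //.
  suff -> : foldl (dstep (fun i => if i == 0 then b0 else g' i)) (dini D b0, [::]) o = (q, [::]) by [].
  rewrite E -q0E; apply: dstep_ext => i hi.
  by case: eqP => // i0; rewrite i0 (negPf n0) in hi.
move=> [g' [Rg fg]]; apply/existsP; exists (g' n.+1); rewrite Rg ?inE ?eqxx ?orbT //=.
have : sim (foldl (dstep g') (dini D (g' 0), [::]) o) C.
  apply: sim_run; first by move=> i hi; apply: Rg; rewrite ?inE ?hi ?orbT //; have := ro _ hi; lia.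
  exists (dini D (g' 0)); rewrite inE; apply/existsP; exists (g' 0).
  by rewrite Rg ?inE ?eqxx.
rewrite /sim C2; move: fg; rewrite /accept; case: (foldl _ _ o) => q s /= fg.
by case: s => [|//] [d h]; apply/existsP; exists (q, d); rewrite h.
Qed.

End Projection.

(** * Closure properties of recognizable sets of labelled words *)

Section Recognizable.
Variables (Sigma : finType) (M : opm Sigma).

Lemma trace_reads (w : seq Sigma) P k o P' k' : trace M w P k o P' k' ->
  k <= k' /\ reads o = iota k.+1 (k' - k).
Proof.
elim=> {P k o P' k'} //=.
- by move=> P k; rewrite subnn.
- move=> t P k o P' k' _ _ _ [kk ->]; split; first lia.
  by have -> : k' - k = (k' - k.+1).+1 by lia.
- move=> t P k o P' k' _ _ _ [kk ->]; split; first lia.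
  by have -> : k' - k = (k' - k.+1).+1 by lia.
Qed.

Lemma complete_reads (w : seq Sigma) o : complete M w o -> reads o = iota 1 (size w).
Proof. by move=> [_ /trace_reads[_ ->]]; rewrite subn0. Qed.

Lemma trace_size (T : finType) (D : dopa T) g (w : seq Sigma) P k o P' k' c :
    trace M w P k o P' k' -> (size c.2).+1 = size P ->
  (size (foldl (dstep (D := D) g) c o).2).+1 = size P'.
Proof.
move=> tr; elim: tr c => {P k o P' k'} //=.
- by move=> t P k o P' k' _ _ _ IH c sc; apply: IH => /=; lia.
- by move=> t P k o P' k' _ _ _ IH c sc; apply: IH.
- move=> v x P k o P' k' _ _ IH [q s] /= sc; apply: IH.
  by case: s sc => //= p s; lia.
Qed.

Lemma complete_stack (T : finType) (D : dopa T) g (w : seq Sigma) o q : complete M w o ->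
  (foldl (dstep (D := D) g) (q, [::]) o).2 = [::].
Proof. by move=> [_ tr]; apply: size0nil; have [] := trace_size g (c := (q, [::])) tr erefl. Qed.

Definition lab (G : Type) (w : seq Sigma) (g : nat -> G) i := (letter w i, g i).

Definition recognizable (G : finType) (L : seq Sigma -> (nat -> G) -> Prop) : Prop :=
  exists D : dopa (option Sigma * G)%type, forall w o g, complete M w o ->
    accept D (lab w g) (size w) o <-> L w g.

Implicit Types (G : finType).

Lemma rec_ext G (L L' : seq Sigma -> (nat -> G) -> Prop) :
    (forall w o g, complete M w o -> L w g <-> L' w g) ->
  recognizable L -> recognizable L'.
Proof.
by move=> E [D h]; exists D => w o g co; rewrite (h _ _ _ co) (E _ _ _ co).
Qed.

Lemma rec_not G (L : seq Sigma -> (nat -> G) -> Prop) :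
  recognizable L -> recognizable (fun w g => ~ L w g).
Proof.
move=> [[S i p s o f] h]; exists (@Dopa _ S i p s o (fun q a => ~~ f q a)) => w ops g co.
by rewrite -(h _ _ _ co); split; [move/negP|move/negP].
Qed.

Lemma rec_relabel G G' (f : option Sigma -> G' -> G) (L : seq Sigma -> (nat -> G) -> Prop) :
  recognizable L -> recognizable (fun w g => L w (fun i => f (letter w i) (g i))).
Proof.
move=> [D h]; pose F (a : option Sigma * G') := (a.1, f a.1 a.2).
exists (@Dopa _ (dstate D) (dini D \o F) (fun q => dpush q \o F) (fun q => dshift q \o F)
  (dpop (d := D)) (fun q => dfin q \o F)) => w o g co.
rewrite -(h _ _ _ co) /accept.
set D' := Dopa _ _ _ _ _.
have := @dstep_hom _ _ D' D F id (lab w g) (dini D' (lab w g 0), [::]) o.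
by rewrite /= /comp /F /lab /= => ->.
Qed.

Lemma rec_and G (L L' : seq Sigma -> (nat -> G) -> Prop) :
  recognizable L -> recognizable L' -> recognizable (fun w g => L w g /\ L' w g).
Proof.
move=> [D h] [D' h'].
exists (@Dopa _ (dstate D * dstate D')%type (fun a => (dini D a, dini D' a))
  (fun q a => (dpush q.1 a, dpush q.2 a)) (fun q a => (dshift q.1 a, dshift q.2 a))
  (fun q p => (dpop q.1 p.1, dpop q.2 p.2)) (fun q a => dfin q.1 a && dfin q.2 a)) => w o g co.
rewrite -(h _ _ _ co) -(h' _ _ _ co) /accept.
set D2 := Dopa _ _ _ _ _.
have /= := @dstep_hom _ _ D2 D id fst (lab w g) (dini D2 (lab w g 0), [::]) o.
have /= := @dstep_hom _ _ D2 D' id snd (lab w g) (dini D2 (lab w g 0), [::]) o.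
rewrite /comp /= => -> // -> //=.
by split=> [/andP[]|[-> ->]].
Qed.

Lemma rec_or G (L L' : seq Sigma -> (nat -> G) -> Prop) :
  recognizable L -> recognizable L' -> recognizable (fun w g => L w g \/ L' w g).
Proof.
move=> h h'; apply: rec_ext (rec_not (rec_and (rec_not h) (rec_not h'))) => w o g _.
have [] := pselect (L w g); have [] := pselect (L' w g); tauto.
Qed.

Lemma rec_exists G G' (R : G -> G' -> bool) (L : seq Sigma -> (nat -> G') -> Prop) :
  recognizable L ->
  recognizable (fun w g => exists g', (forall i, i <= (size w).+1 -> R (g i) (g' i)) /\ L w g').
Proof.
move=> [D h].
exists (proj_dopa (fun a b => (a.1 == b.1) && R a.2 b.2) D) => w o g co.
have ro := complete_reads co.
rewrite accept_proj ?ro ?iota_uniq //; last exact: complete_stack co.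
- have mem i : i <= (size w).+1 -> i \in [:: 0, (size w).+1 & iota 1 (size w)].
    by rewrite !inE mem_iota; case: eqP; case: eqP => //=; lia.
  split=> -[g' [Rg a]].
    exists (fun i => (g' i).2); split.
      by move=> i hi; have /andP[] := Rg _ hi (mem i hi).
    apply/(h _ _ _ co); move: a; rewrite /accept.
    have E i : i <= (size w).+1 -> g' i = lab w (fun i => (g' i).2) i.
      by move=> hi; have /= /andP[/eqP] := Rg _ hi (mem i hi); rewrite /lab => ->; case: (g' i).
    rewrite -!E //; suff -> : foldl (dstep g') (dini D (g' 0), [::]) o =
      foldl (dstep (lab w (fun i => (g' i).2))) (dini D (g' 0), [::]) o by [].
    by apply: dstep_ext => i; rewrite ro mem_iota => hi; apply: E; lia.
  exists (lab w g'); split; last exact/(h _ _ _ co).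
  by move=> i hi _; rewrite /= eqxx Rg.
- by move=> i; rewrite mem_iota; lia.
Qed.

(** An ordinary finite automaton on the labelled word #w#: letters are read in order and pops keep
    the current state. The first symbol is consumed by [dini], the last one inside [dfin]. *)
Lemma rec_dfa G (S : finType) (s0 : S) (d : S -> option Sigma * G -> S) (F : pred S) :
  recognizable (fun w (g : nat -> G) => F (foldl d s0 [seq lab w g i | i <- iota 0 (size w).+2])).
Proof.
pose D := @Dopa (option Sigma * G)%type S (d s0) d d (fun q _ => q) (fun q a => F (d q a)).
have run g c o : (foldl (dstep (D := D) g) c o).1 = foldl d c.1 [seq g i | i <- reads o].
  by elim: o c => //= e o IH c; rewrite IH; case: e => //= *; case: c.2.
exists D => w o g co.
rewrite /accept run (complete_reads co).
have -> : iota 0 (size w).+2 = 0 :: rcons (iota 1 (size w)) (size w).+1.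
  by rewrite -[RHS]/(rcons (iota 0 (size w).+1) (size w).+1) -[(size w).+2]addn1 iotaD cats1.
by rewrite map_cons map_rcons -cats1 -cat_cons foldl_cat.
Qed.

Lemma rec_ex G (p : pred (option Sigma * G)) :
  recognizable (fun w g => exists i, i <= (size w).+1 /\ p (lab w g i)).
Proof.
apply: rec_ext (rec_dfa false (fun b a => b || p a) id) => w o g _.
have -> s b : foldl (fun b a => b || p a) b s = b || has p s.
  by elim: s b => [|a s IH] b /=; rewrite ?orbF // IH orbA.
rewrite /= -/(map _ (iota 0 (size w).+2)) -/(has p (map _ _)).
have -> : p (lab w g 0) || (p (lab w g 1) || has p [seq lab w g i | i <- iota 2 (size w)]) =
   has p [seq lab w g i | i <- iota 0 (size w).+2] by [].
rewrite has_map; split=> [/hasP[i]|[i [hi pi]]].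
  by rewrite mem_iota /= => hi pi; exists i; split; first lia.
by apply/hasP; exists i => //; rewrite mem_iota; lia.
Qed.

Lemma rec_ex_lt G (p r : pred (option Sigma * G)) :
  recognizable (fun w g => exists i j, [/\ i < j, j <= (size w).+1, p (lab w g i) & r (lab w g j)]).
Proof.
(* The second bit uses the first one before its update, which makes i < j strict. *)
pose d (b : bool * bool) a := (b.1 || p a, b.2 || b.1 && r a).
apply: rec_ext (rec_dfa (false, false) d snd) => w o g _.
have run m : let s := foldl d (false, false) [seq lab w g i | i <- iota 0 m] in
    (s.1 <-> exists i, i < m /\ p (lab w g i)) /\
    (s.2 <-> exists i j, [/\ i < j, j < m, p (lab w g i) & r (lab w g j)]).
  elim: m => [|m [IH1 IH2]]; first by split; split=> // -[i []] // j [].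
  have -> : iota 0 m.+1 = rcons (iota 0 m) m by rewrite -addn1 iotaD cats1.
  rewrite map_rcons -cats1 foldl_cat /=.
  set s := foldl _ _ _ in IH1 IH2 *; split; split.
  - move=> /orP[/IH1[i [im pi]]|pm]; first by exists i; split; first lia.
    by exists m; split; first lia.
  - move=> [i [im pi]]; have [e|ne] := eqVneq i m; first by rewrite -e pi orbT.
    by apply/orP; left; apply/IH1; exists i; split; first lia.
  - move=> /orP[/IH2[i [j [ij jm pi rj]]]|/andP[/IH1[i [im pi]] rm]].
      by exists i, j; split=> //; lia.
    by exists i, m; split=> //; lia.
  - move=> [i [j [ij jm pi rj]]]; have [e|ne] := eqVneq j m.
      by apply/orP; right; rewrite -e rj andbT; apply/IH1; exists i; split=> //; lia.
    by apply/orP; left; apply/IH2; exists i, j; split=> //; lia.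
by have [_ ->] := run (size w).+2.
Qed.

Lemma rec_ex_chain G (p r : pred (option Sigma * G)) :
  recognizable (fun w g => exists i j, [/\ chain M w i j, p (lab w g i) & r (lab w g j)]).
Proof.
(* [q.1.1]: the topmost position satisfies [p]; [q.1.2]: a pop at the current
   lookahead has exposed such a position; [q.2]: success at an earlier lookahead. *)
pose st := (bool * bool * bool)%type.
pose rd (q : st) a : st := (p a, false, q.2 || q.1.2 && r a).
pose D := @Dopa _ (bool * bool * bool)%type (fun a => (p a, false, false)) rd rd
  (fun q t => (t.1.1, q.1.2 || t.1.1, q.2)) (fun q a => q.2 || q.1.2 && r a).
exists D => w o g co.
pose good (e : op) := if e is Pop _ x y then p (lab w g x) && r (lab w g y) else false.
(* Verdict from any intermediate configuration: success already recorded, success pending at the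
   lookahead k+1, or a suitable pop still to come. The first bits along the stack record p at the
   stacked positions. *)
have run P k o' P' k' c : trace M w P k o' P' k' -> k' = size w ->
    map (fun q : st => q.1.1) (c.1 :: c.2) = [seq p (lab w g i) | i <- P] ->
    dfin (d := D) (foldl (dstep (D := D) (lab w g)) c o').1 (lab w g (size w).+1) =
    [|| c.1.2, c.1.1.2 && r (lab w g k.+1) | has good o'].
  move=> tr; elim: tr c => {P k o' P' k'} //=.
  - by move=> P k c -> _; rewrite orbF.
  - move=> t P k o' P' k' _ _ _ IH [q s] e [E1 E2]; rewrite IH //= ?E1 ?E2 //.
    by rewrite orbA.
  - move=> t P k o' P' k' _ _ _ IH [q s] e [E1 E2]; rewrite IH //= ?E2 //.
    by rewrite orbA.
  - move=> v x P k o' P' k' _ _ IH [q s] e /=; case: s => [|t s] // [E1 E2 E3].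
    rewrite IH //= ?E2 ?E3 // andb_orl -!orbA.
    by [].
rewrite /accept; have [_ tr] := co; rewrite (run _ _ _ _ _ _ tr) //=.
split=> [/hasP[[//|//|v x y] h /= /andP[px ry]]|[i [j [/(chainE co)[v h] pi rj]]]].
  by exists x, y; split=> //; apply/(chainE co); exists v.
by apply/hasP; exists (Pop v i j) => //=; rewrite pi rj.
Qed.

End Recognizable.

(** * Boolean formulas are recognizable *)

Section Assignments.
Variables (Sigma : finType) (M : opm Sigma).

Lemma rec_local (G : finType) (L : seq Sigma -> (nat -> G) -> Prop) w o g g' :
    recognizable M L -> complete M w o -> (forall i, i <= (size w).+1 -> g i = g' i) ->
  L w g <-> L w g'.
Proof.
move=> [D h] co e; rewrite -(h _ _ _ co) -(h _ _ _ co) /accept /lab !e //.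
suff -> : foldl (dstep (lab w g)) (dini D (letter w 0, g' 0), [::]) o =
  foldl (dstep (lab w g')) (dini D (letter w 0, g' 0), [::]) o by [].
apply: dstep_ext => i; rewrite (complete_reads co) mem_iota => hi.
by rewrite /lab e //; lia.
Qed.

Definition bits N := ({ffun 'I_N -> bool} * {ffun 'I_N -> bool})%type.

Local Notation pos w := 'I_(size w).+2.

Definition enc N (w : seq Sigma) (s1 : nat -> pos w) (s2 : nat -> {set pos w}) (i : nat) : bits N :=
  ([ffun x : 'I_N => s1 x == i :> nat], [ffun X : 'I_N => inord i \in s2 X]).

Definition asg_pred (C : Type) :=
  forall w : seq Sigma, (nat -> pos w) -> (nat -> {set pos w}) -> (nat -> C) -> Prop.

(** L is constrained only on bit patterns that encode an assignment; elsewhere it is free, so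
    complements need no validity check. *)
Definition rec_asg N (C : finType) (P : asg_pred C) : Prop :=
  exists2 L : seq Sigma -> (nat -> bits N * C) -> Prop, recognizable M L &
    forall w o s1 s2 u, complete M w o -> L w (fun i => (enc N s1 s2 i, u i)) <-> P w s1 s2 u.

Variable N : nat.
Implicit Types (C : finType).

Lemma rec_asg_ext C (P P' : asg_pred C) :
    (forall w o s1 s2 u, complete M w o -> P w s1 s2 u <-> P' w s1 s2 u) ->
  rec_asg N P -> rec_asg N P'.
Proof.
by move=> E [L rL h]; exists L => // w o s1 s2 u co; rewrite (h _ _ _ _ _ co) (E _ _ _ _ _ co).
Qed.

Lemma rec_asg_not C (P : asg_pred C) : rec_asg N P -> rec_asg N (fun w s1 s2 u => ~ P w s1 s2 u).
Proof.
move=> [L rL h]; exists (fun w g => ~ L w g); first exact: rec_not.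
by move=> w o s1 s2 u co; rewrite (h _ _ _ _ _ co).
Qed.

Lemma rec_asg_and C (P P' : asg_pred C) : rec_asg N P -> rec_asg N P' ->
  rec_asg N (fun w s1 s2 u => P w s1 s2 u /\ P' w s1 s2 u).
Proof.
move=> [L rL h] [L' rL' h']; exists (fun w g => L w g /\ L' w g); first exact: rec_and.
by move=> w o s1 s2 u co; rewrite (h _ _ _ _ _ co) (h' _ _ _ _ _ co).
Qed.

Lemma rec_asg_or C (P P' : asg_pred C) : rec_asg N P -> rec_asg N P' ->
  rec_asg N (fun w s1 s2 u => P w s1 s2 u \/ P' w s1 s2 u).
Proof.
move=> [L rL h] [L' rL' h']; exists (fun w g => L w g \/ L' w g); first exact: rec_or.
by move=> w o s1 s2 u co; rewrite (h _ _ _ _ _ co) (h' _ _ _ _ _ co).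
Qed.

Lemma rec_asg_relabel C C' (f : option Sigma -> C' -> C) (P : asg_pred C) : rec_asg N P ->
  rec_asg N (fun w s1 s2 u => P w s1 s2 (fun i => f (letter w i) (u i))).
Proof.
move=> [L rL h].
exists (fun w g => L w (fun i => ((g i).1, f (letter w i) (g i).2))).
  by apply: (rec_relabel (fun a (g : bits N * C') => (g.1, f a g.2))).
by move=> w o s1 s2 u co; rewrite /= (h _ _ _ _ _ co).
Qed.

Lemma rec_asg_ex C (p : pred (option Sigma * (bits N * C))) :
  rec_asg N (fun w s1 s2 u => exists i : pos w, p (letter w i, (enc N s1 s2 i, u i))).
Proof.
eexists; first exact: (rec_ex M p).
move=> w o s1 s2 u co /=; split=> [[i [hi pi]]|[i pi]].
  by exists (Ordinal (n := (size w).+2) (m := i) hi).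
by exists i; split; first by rewrite -ltnS.
Qed.

(** The projection guesses an arbitrary row of bits for x while R fixes all other bits; [L1] forces
    exactly one bit in that row, so the guess is the encoding of an updated assignment. *)
Lemma rec_asg_ex1 C (P : asg_pred C) (x : nat) : x < N -> rec_asg N P ->
  rec_asg N (fun w s1 s2 u => exists i : pos w, P w [eta s1 with x |-> i] s2 u).
Proof.
move=> xN [L rL h]; pose x' := Ordinal xN.
pose bit (a : option Sigma * (bits N * C)) := a.2.1.1 x'.
pose R (g g' : bits N * C) := [&& g.2 == g'.2, g.1.2 == g'.1.2 &
   [forall y, (y != x') ==> (g.1.1 y == g'.1.1 y)]].
pose L1 w (g : nat -> bits N * C) := L w g /\ (exists i, i <= (size w).+1 /\ bit (lab w g i)) /\
   ~ (exists i j, [/\ i < j, j <= (size w).+1, bit (lab w g i) & bit (lab w g j)]).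
exists (fun w g => exists g', (forall i, i <= (size w).+1 -> R (g i) (g' i)) /\ L1 w g').
  apply: rec_exists; apply: rec_and rL _; apply: rec_and (rec_ex _ _) _.
  exact: rec_not (rec_ex_lt _ _ _).
move=> w o s1 s2 u co; split=> [[g' [Rg [Lg [[i [hi bi]] uni]]]]|[i Pi]].
  pose i0 := Ordinal (n := (size w).+2) (m := i) hi; exists i0.
  rewrite -(h _ _ _ _ _ co); apply: (iffLR (rec_local rL co _) Lg) => j hj.
  have /and3P[/eqP /= e1 /eqP /= e2 /forallP e3] := Rg _ hj.
  case E : (g' j) => [[b1 b2] c]; rewrite E /= in e1 e2 e3; congr ((_, _), _); rewrite ?e1 ?e2 //.
  apply/ffunP => y; rewrite ffunE /=; have [->/=|yx] := eqVneq y x'.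
    rewrite eqxx; have -> : b1 x' = bit (lab w g' j) by rewrite /bit /lab E.
    apply/idP/eqP => [bj|<- //]; have [lt|lt|//] := ltngtP i j; case: uni.
      by exists i, j.
    by exists j, i.
  have /eqP/= := implyP (e3 y) yx; rewrite ffunE => <-.
  by rewrite -val_eqE /= in yx; rewrite (negPf yx).
exists (fun j => (enc N [eta s1 with x |-> i] s2 j, u j)); split.
  move=> j hj; rewrite /R /= !eqxx /=; apply/forallP => y; apply/implyP => yx.
  by rewrite -val_eqE /= in yx; rewrite !ffunE /= (negPf yx).
split; first exact/(h _ _ _ _ _ co).
have bE j : bit (lab w (fun j => (enc N [eta s1 with x |-> i] s2 j, u j)) j) = (i == j :> nat).
  by rewrite /bit /= ffunE /= eqxx.
split; first by exists i; rewrite bE -ltnS.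
by move=> [j [k [jk _]]]; rewrite !bE => /eqP ij /eqP ik; lia.
Qed.

Lemma rec_asg_ex2 C (P : asg_pred C) (X : nat) : X < N -> rec_asg N P ->
  rec_asg N (fun w s1 s2 u => exists I : {set pos w}, P w s1 [eta s2 with X |-> I] u).
Proof.
move=> xN [L rL h]; pose x' := Ordinal xN.
pose R (g g' : bits N * C) := [&& g.2 == g'.2, g.1.1 == g'.1.1 &
   [forall y, (y != x') ==> (g.1.2 y == g'.1.2 y)]].
exists (fun w g => exists g', (forall i, i <= (size w).+1 -> R (g i) (g' i)) /\ L w g').
  exact: rec_exists.
move=> w o s1 s2 u co; split=> [[g' [Rg Lg]]|[I PI]].
  pose I := finset (fun i : pos w => (g' i).1.2 x'); exists I.
  rewrite -(h _ _ _ _ _ co); apply: (iffLR (rec_local rL co _) Lg) => j hj.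
  have /and3P[/eqP /= e1 /eqP /= e2 /forallP e3] := Rg _ hj.
  case E : (g' j) => [[b1 b2] c]; rewrite E /= in e1 e2 e3; congr ((_, _), _); rewrite ?e1 ?e2 //.
  apply/ffunP => y; rewrite ffunE /=; have [->/=|yx] := eqVneq y x'.
    by rewrite eqxx finset.inE inordK // E.
  have /eqP/= := implyP (e3 y) yx; rewrite ffunE => <-.
  by rewrite -val_eqE /= in yx; rewrite (negPf yx).
exists (fun j => (enc N s1 [eta s2 with X |-> I] j, u j)); split; last exact/(h _ _ _ _ _ co).
move=> j hj; rewrite /R /= !eqxx /=; apply/forallP => y; apply/implyP => yx.
by rewrite -val_eqE /= in yx; rewrite !ffunE /= (negPf yx).
Qed.

(** Bound variables count too: a quantifier overwrites an existing row of bits, and the alphabet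
    stays the same throughout the induction. *)
Fixpoint bvars (b : bformula Sigma) : nat :=
  match b with
  | BLab _ x => x.+1
  | BLe x y | BChain x y | BIn x y => maxn x.+1 y.+1
  | BNot b => bvars b
  | BOr b c => maxn (bvars b) (bvars c)
  | BEx1 x b | BEx2 x b => maxn x.+1 (bvars b)
  end.

Lemma rec_asg_bsat C (b : bformula Sigma) : bvars b <= N ->
  rec_asg N (C := C) (fun w s1 s2 _ => bsat M s1 s2 b).
Proof.
elim: b => [a x|x y|x y|x X|b IHb|b IHb c IHc|x b IHb|X b IHb] /=; rewrite ?geq_max.
- move=> xN; pose x' := Ordinal xN.
  apply: rec_asg_ext (rec_asg_ex (fun t => (t.1 == a) && t.2.1.1 x')) => w o s1 s2 u co /=.
  split=> [[i /andP[/eqP <-]]|<-]; first by rewrite ffunE => /eqP/val_inj ->.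
  by exists (s1 x); rewrite ffunE !eqxx.
- move=> /andP[xN yN]; pose x' := Ordinal xN; pose y' := Ordinal yN.
  pose bx (t : option Sigma * (bits N * C)) := t.2.1.1 x'.
  pose b_y (t : option Sigma * (bits N * C)) := t.2.1.1 y'.
  eexists; first exact: rec_or (rec_ex_lt M bx b_y) (rec_ex M (predI bx b_y)).
  move=> w o s1 s2 u co; rewrite /bx /b_y /= leq_eqVlt; split.
    move=> [[i [j [ij _]]]|[i [_ /andP[]]]]; rewrite !ffunE => /eqP ei /eqP ej.
      by rewrite ei ej ij orbT.
    by rewrite ei ej eqxx.
  move=> /orP[/eqP e|lt]; [right; exists (s1 x)|left; exists (s1 x), (s1 y)].
    by rewrite !ffunE eqxx -e eqxx -ltnS ltn_ord.
  by rewrite !ffunE !eqxx lt -ltnS ltn_ord.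
- move=> /andP[xN yN]; pose x' := Ordinal xN; pose y' := Ordinal yN.
  pose bx (t : option Sigma * (bits N * C)) := t.2.1.1 x'.
  pose b_y (t : option Sigma * (bits N * C)) := t.2.1.1 y'.
  eexists; first exact: (rec_ex_chain M bx b_y).
  move=> w o s1 s2 u co; rewrite /bx /b_y /=; split.
    by move=> [i [j [ch]]]; rewrite !ffunE => /eqP -> /eqP ->.
  by move=> ch; exists (s1 x), (s1 y); rewrite !ffunE !eqxx.
- move=> /andP[xN yN]; pose x' := Ordinal xN; pose y' := Ordinal yN.
  apply: rec_asg_ext (rec_asg_ex (fun t => t.2.1.1 x' && t.2.1.2 y')) => w o s1 s2 u co /=.
  split=> [[i]|h]; first by rewrite !ffunE inord_val => /andP[/eqP/val_inj ->].
  by exists (s1 x); rewrite !ffunE eqxx inord_val.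
- by move=> /IHb; apply: rec_asg_not.
- by move=> /andP[/IHb hb /IHc hc]; apply: rec_asg_or.
- by move=> /andP[xN /IHb]; apply: rec_asg_ex1.
- by move=> /andP[xN /IHb]; apply: rec_asg_ex2.
Qed.

End Assignments.

(** * Restricted formulas have a Nivat form *)

Section Sums.
Local Open Scope ring_scope.
Variable K : pzSemiRingType.

Lemma sum_asbool1 (I : finType) (P : I -> Prop) (F : I -> K) i0 :
  (forall i, P i <-> i = i0) -> \sum_i (if `[< P i >] then F i else 0) = F i0.
Proof.
move=> h; rewrite -big_mkcond /= (big_pred1 i0) // => i.
by apply/asboolP/eqP => /h.
Qed.

Lemma sum_exists (I : finType) (A : {set I}) (P : I -> Prop) (X : K) :
    {in A &, forall i j, P i -> P j -> i = j} ->
  \sum_(i in A) (if `[< P i >] then X else 0) = if `[< exists2 i, i \in A & P i >] then X else 0.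
Proof.
move=> uni; case: asboolP => [[i iA Pi]|no].
  rewrite (bigD1 i) //= (asboolT Pi) big1 ?addr0 // => j /andP[jA ji].
  by case: asboolP => // Pj; case/eqP: ji; apply: uni.
by rewrite big1 // => i iA; case: asboolP => // Pi; case: no; exists i.
Qed.

Lemma sum_tuple_pair (C D : finType) n (F : n.-tuple C -> n.-tuple D -> K) :
  \sum_(u : n.-tuple (C * D)) F (map_tuple fst u) (map_tuple snd u) =
  \sum_(u : n.-tuple C) \sum_(v : n.-tuple D) F u v.
Proof.
rewrite pair_bigA /= (reindex (fun u : n.-tuple (C * D) => (map_tuple fst u, map_tuple snd u))) //=.
exists (fun p => zip_tuple p.1 p.2) => [u _|[u v] _].
  by apply: val_inj => /=; rewrite zip_map; elim: (tval u) => //= -[a b] s ->.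
by congr pair; apply: val_inj; [apply: unzip1_zip|apply: unzip2_zip]; rewrite !size_tuple.
Qed.

Lemma sum_tuple_embed (C D : finType) (h : D -> C) (h' : C -> D) n (F : n.-tuple C -> K) :
    cancel h h' ->
  \sum_(u : n.-tuple C | map_tuple h (map_tuple h' u) == u) F u = \sum_(u : n.-tuple D) F (map_tuple h u).
Proof.
move=> hK; rewrite (reindex_onto (map_tuple h) (map_tuple h')).
  apply: eq_bigl => u; have -> : map_tuple h' (map_tuple h u) = u.
    by apply: val_inj; rewrite /= mapK.
  by rewrite !eqxx.
by move=> u /eqP.
Qed.

Lemma prod_inner (T : finType) (w : seq T) (F : 'I_(size w).+2 -> K) :
  \prod_(i in inner_pos w) F i = \prod_(i < size w) F (inord i.+1).
Proof.
rewrite big_mkcond big_ord_recl big_ord_recr /= !inE /= ltnn mul1r mulr1.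
apply: eq_bigr => i _; rewrite inE /= /bump /= add1n ltn_ord; congr F; apply: val_inj.
by rewrite /= inordK /bump //= !ltnS ltnW.
Qed.

End Sums.

(** * Step functions and labelled normal forms of weighted formulas *)

Section NormalForm.
Local Open Scope ring_scope.
Variables (Sigma : finType) (M : opm Sigma) (K : pzSemiRingType) (N : nat).
Local Notation pos w := 'I_(size w).+2.
Implicit Types (C : finType).

Lemma rec_asg_true C : rec_asg M N (C := C) (fun w s1 s2 u => True).
Proof.
apply: rec_asg_ext (rec_asg_ex (C := C) (N := N) M (fun=> true)) => w o s1 s2 u _.
by split=> // _; exists ord0.
Qed.

Lemma rec_asg_big_or C (J : finType) (P : J -> asg_pred Sigma C) : (forall j, rec_asg M N (P j)) ->
  rec_asg M N (fun w s1 s2 u => exists j, P j w s1 s2 u).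
Proof.
move=> h; suff H (s : seq J) : rec_asg M N (fun w s1 s2 u => exists2 j, j \in s & P j w s1 s2 u).
  apply: rec_asg_ext (H (enum J)) => w o s1 s2 u _.
  by split=> [[j _ ?]|[j ?]]; exists j => //; rewrite mem_enum.
elim: s => [|j s IH].
  by apply: rec_asg_ext (rec_asg_not (rec_asg_true C)) => w o s1 s2 u _; split=> // -[].
apply: rec_asg_ext (rec_asg_or (h j) IH) => w o s1 s2 u _; split.
  by move=> [Pj|[i si Pi]]; [exists j; rewrite ?inE ?eqxx|exists i; rewrite ?inE ?si ?orbT].
by move=> [i /[!inE] /predU1P[->|si] Pi]; [left|right; exists i].
Qed.

Lemma rec_asg_ex_lt C (p r : pred (option Sigma * C)) :
  rec_asg M N (fun w s1 s2 u => exists i j : pos w, [/\ (i < j)%N, p (letter w i, u i) & r (letter w j, u j)]).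
Proof.
eexists.
  exact: (rec_ex_lt M (fun t : option Sigma * (bits N * C) => p (t.1, t.2.2)) (fun t => r (t.1, t.2.2))).
move=> w o s1 s2 u co /=; split=> [[i [j [ij jn pi rj]]]|[i [j [ij pi rj]]]].
  have iN : (i < (size w).+2)%N by lia.
  by exists (Ordinal iN), (Ordinal (n := (size w).+2) (m := j) jn).
by exists i, j; split; rewrite // -ltnS.
Qed.

Fixpoint wvars (phi : wformula Sigma K) : nat :=
  match phi with
  | WBool b => bvars b
  | WConst _ => 0
  | WAdd f g | WMul f g => maxn (wvars f) (wvars g)
  | WSum1 x f | WSum2 x f | WProd x f => maxn x.+1 (wvars f)
  end.

(** Values commuting with this whole set lie in the double commutant of the constants. That is
    stable under sums and products, and values from two formulas commute as soon as their constants
    do. *)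
Definition commutant (phi : wformula Sigma K) (z : K) := forall k, k \in const phi -> GRing.comm z k.

(** Recognizable step functions: finitely many values, each taken on a recognizable set of pairs of
    a word and an assignment. *)
Definition step_formula (phi : wformula Sigma K) := exists (J : finType) (v : J -> K)
    (cls : forall w : seq Sigma, (nat -> pos w) -> (nat -> {set pos w}) -> J),
  [/\ forall C j, rec_asg M N (C := C) (fun w s1 s2 _ => cls w s1 s2 = j),
      forall z, commutant phi z -> forall j, GRing.comm z (v j)
    & forall w s1 s2, wsem M s1 s2 phi = v (cls w s1 s2)].

Lemma almost_boolean_step phi : almost_boolean phi -> (wvars phi <= N)%N -> step_formula phi.
Proof.
elim: phi => //= [b _ bN|k _ _|f IHf g IHg|f IHf g IHg].
- exists bool, (fun j => if j then 1 else 0), (fun w s1 s2 => `[< bsat M s1 s2 b >]); split=> //.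
    move=> C [].
      by apply: rec_asg_ext (rec_asg_bsat M C bN) => w o s1 s2 u _; split=> [/asboolT|/asboolP].
    by apply: rec_asg_ext (rec_asg_not (rec_asg_bsat M C bN)) => w o s1 s2 u _; split=> [/asboolF|/asboolPn].
  by move=> z _ []; [apply: commr1|apply: commr0].
- exists unit, (fun=> k), (fun _ _ _ => tt); split=> //.
    by move=> C []; apply: rec_asg_ext (rec_asg_true C).
  by move=> z cz _; apply: cz; rewrite inE.
- move=> /andP[bf bg]; rewrite geq_max => /andP[fN gN].
  have [J1 [v1 [c1 [r1 m1 e1]]]] := IHf bf fN; have [J2 [v2 [c2 [r2 m2 e2]]]] := IHg bg gN.
  exists (J1 * J2)%type, (fun j => v1 j.1 + v2 j.2), (fun w s1 s2 => (c1 w s1 s2, c2 w s1 s2)); split.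
  + move=> C [j1 j2]; apply: rec_asg_ext (rec_asg_and (r1 C j1) (r2 C j2)) => w o s1 s2 u _.
    by split=> [[-> ->]|[-> ->]].
  + by move=> z cz j; apply: commrD; [apply: m1|apply: m2] => k hk; apply: cz; rewrite mem_cat hk ?orbT.
  + by move=> w s1 s2; rewrite /= e1 e2.
- move=> /andP[bf bg]; rewrite geq_max => /andP[fN gN].
  have [J1 [v1 [c1 [r1 m1 e1]]]] := IHf bf fN; have [J2 [v2 [c2 [r2 m2 e2]]]] := IHg bg gN.
  exists (J1 * J2)%type, (fun j => v1 j.1 * v2 j.2), (fun w s1 s2 => (c1 w s1 s2, c2 w s1 s2)); split.
  + move=> C [j1 j2]; apply: rec_asg_ext (rec_asg_and (r1 C j1) (r2 C j2)) => w o s1 s2 u _.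
    by split=> [[-> ->]|[-> ->]].
  + by move=> z cz j; apply: commrM; [apply: m1|apply: m2] => k hk; apply: cz; rewrite mem_cat hk ?orbT.
  + by move=> w s1 s2; rewrite /= e1 e2.
Qed.

(* Labels sit on the inner positions 1, ..., |w|; [c0] is junk for the two ends. *)
Definition lbl C (c0 : C) (u : seq C) (i : nat) : C := nth c0 (c0 :: u) i.

Lemma lbl_map C C' (h : C -> C') c0 u i : h (lbl c0 u i) = lbl (h c0) (map h u) i.
Proof.
rewrite /lbl -map_cons; case: (ltnP i (size (c0 :: u))) => hi; first by rewrite (nth_map c0).
by rewrite !nth_default ?size_map.
Qed.

(* [hd] requires the weight to be concentrated on the first label, so that it may
   be multiplied on the left without commutation. *)
Definition nfP (hd : bool) (phi : wformula Sigma K) C (c0 : C) (f : C -> K) (P : asg_pred Sigma C) :=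
  [/\ rec_asg M N P, forall z, commutant phi z -> forall c, GRing.comm z (f c),
    forall w o s1 s2, complete M w o -> wsem M s1 s2 phi =
      \sum_(u : (size w).-tuple C) (if `[< P w s1 s2 (lbl c0 u) >] then \prod_(c <- u) f c else 0)
  & hd -> forall w s1 s2 u, P w s1 s2 u -> forall i, (1 < i <= size w)%N -> f (u i) = 1].

Definition nf (hd : bool) (phi : wformula Sigma K) :=
  exists C (c0 : C) (f : C -> K) (P : asg_pred Sigma C), nfP hd phi c0 f P.

Lemma nfW hd phi : nf hd phi -> nf false phi.
Proof. by move=> [C [c0 [f [P [? ? ? _]]]]]; exists C, c0, f, P; split. Qed.

Lemma lbl_nth C (c0 : C) (u : seq C) i : lbl c0 u i.+1 = nth c0 u i. Proof. by []. Qed.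

Lemma lbl_out C (c0 : C) (u : seq C) i : i = 0%N \/ (size u < i)%N -> lbl c0 u i = c0.
Proof. by case=> [->//|hi]; apply: nth_default. Qed.

(** How predicates on labelled words tell the inner positions from the two ends. *)
Lemma letter_inner (w : seq Sigma) k : (letter w k != None) = (0 < k <= size w)%N.
Proof.
by case: k => //= k; case: (ltnP k (size w)) => [/letterS[a ->]|/letter_end ->].
Qed.

Lemma tuple_lbl_eq C (c0 : C) n (u v : n.-tuple C) :
  (forall i, (0 < i <= n)%N -> lbl c0 u i = lbl c0 v i) -> u = v.
Proof.
move=> h; apply: val_inj; apply: (@eq_from_nth _ c0); rewrite ?size_tuple // => i hi.
by rewrite -!lbl_nth h.
Qed.

(** Exactly one labelling is accepted: [Some j] at position 1, carrying the whole value of the class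
    j, and [None], of weight 1, at all later ones. *)
Lemma nf_step phi : step_formula phi -> nf true phi.
Proof.
move=> [J [v [cls [rc cm e]]]].
(* The negated clause says that every position preceded by an inner one is labelled [None], so the
   [Some j] of the clause before can only be at position 1. *)
pose P : asg_pred Sigma (option J) := fun w s1 s2 u => exists j, (cls w s1 s2 = j /\
   exists i : pos w, (letter w i != None) && (u i == Some j)) /\
   ~ (exists i j : pos w, [/\ (i < j)%N, letter w i != None & u j != None]).
have PE w s1 s2 u : (0 < size w)%N -> P w s1 s2 u ->
    u 1%N = Some (cls w s1 s2) /\ forall i, (1 < i <= size w)%N -> u i = None.
  move=> w0 [j [[-> [i /andP[li /eqP ui]]] no]].
  have uN k : (1 < k <= size w)%N -> u k = None.
    move=> kw; apply/eqP/negPn/negP => uk; apply: no.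
    have h1 : (1 < (size w).+2)%N by []. have hk : (k < (size w).+2)%N by lia.
    by exists (Ordinal h1), (Ordinal hk); rewrite letter_inner /=; split=> //; lia.
  split=> //; rewrite letter_inner in li.
  have [<-//|i1] := eqVneq (i : nat) 1%N.
  by move: ui; rewrite uN //; lia.
exists (option J), None, (oapp v 1), P; split.
- apply: rec_asg_big_or => j; apply: rec_asg_and; last first.
    by apply/rec_asg_not/(rec_asg_ex_lt (fun t => t.1 != None) (fun t => t.2 != None)).
  apply: rec_asg_and => //.
  exact: (rec_asg_ex M (fun t => (t.1 != None) && (t.2.2 == Some j))).
- by move=> z cz [j|] /=; [apply: cm|apply: commr1].
- move=> w o s1 s2 [w0 _].
  pose u0 := [tuple if i == 0%N :> nat then Some (cls w s1 s2) else None | i < size w].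
  have u0E i : (i < size w)%N -> nth None u0 i = if i == 0%N then Some (cls w s1 s2) else None.
    by move=> hi; rewrite -[i]/(nat_of_ord (Ordinal hi)) -tnth_nth tnth_mktuple.
  clearbody u0; rewrite (@sum_asbool1 _ _ _ _ u0); last first.
    move=> u; split=> [/(PE _ _ _ _ w0)[h1 h2]|->].
      apply: (@tuple_lbl_eq _ None) => -[//|i] hi; rewrite [RHS]lbl_nth u0E //.
      by case: i hi => // i hi; rewrite h2.
    exists (cls w s1 s2); split; first split=> //.
      have h1 : (1 < (size w).+2)%N by [].
      exists (Ordinal h1); apply/andP; split; first by rewrite letter_inner.
      by rewrite [nat_of_ord _]/= lbl_nth u0E.
    move=> [i [[[|j] hj] []]] //=; rewrite letter_inner ltnS lbl_nth => ij li.
    case: (ltnP j (size w)) => jw; last by rewrite nth_default ?size_tuple ?eqxx.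
    by rewrite u0E //; case: j ij {hj jw} => [|j] ij; [exfalso; lia|rewrite eqxx].
  rewrite e; have -> : tval u0 = Some (cls w s1 s2) :: nseq (size w).-1 None.
    apply: (@eq_from_nth _ None); rewrite ?size_tuple /= ?size_nseq ?prednK // => i hi.
    by rewrite u0E //; case: i hi => //= i hi; rewrite nth_nseq if_same.
  rewrite big_cons /= big1_seq ?mulr1 // => c /andP[_].
  by rewrite mem_nseq => /andP[_ /eqP ->].
- move=> _ w s1 s2 u Pu i hi; have w0 : (0 < size w)%N by lia.
  by have [_ ->] := PE _ _ _ _ w0 Pu.
Qed.

(** The product of two sums over labellings is a sum over pairs of labels. To merge the two products
    of weights, either all of them commute, or f1 is 1 after the first label and there is nothing to
    move. *)
Lemma nf_mul hd f g : nf hd f -> nf false g ->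
    hd \/ {in const f & const g, forall k l, GRing.comm k l} -> nf false (WMul f g).
Proof.
move=> [C1 [c1 [f1 [P1 [r1 m1 e1 h1]]]]] [C2 [c2 [f2 [P2 [r2 m2 e2 h2]]]]] hc.
exists (C1 * C2)%type, (c1, c2), (fun c => f1 c.1 * f2 c.2),
  (fun w s1 s2 u => P1 w s1 s2 (fun i => (u i).1) /\ P2 w s1 s2 (fun i => (u i).2)); split=> //.
- apply: rec_asg_and.
    exact: (rec_asg_relabel (fun _ (c : C1 * C2) => c.1) r1).
  exact: (rec_asg_relabel (fun _ (c : C1 * C2) => c.2) r2).
- by move=> z cz c; apply: commrM; [apply: m1|apply: m2] => k hk; apply: cz; rewrite mem_cat hk ?orbT.
move=> w o s1 s2 co /=; rewrite (e1 _ _ _ _ co) (e2 _ _ _ _ co) big_distrlr /= -sum_tuple_pair.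
apply: eq_bigr => u _.
have E1 : lbl c1 (map_tuple fst u) = fun i => (lbl (c1, c2) u i).1.
  by apply/funext => i; rewrite (lbl_map fst).
have E2 : lbl c2 (map_tuple snd u) = fun i => (lbl (c1, c2) u i).2.
  by apply/funext => i; rewrite (lbl_map snd).
rewrite E1 E2 asbool_and.
case: asboolP => [p1|_] /=; last by rewrite mul0r.
case: asboolP => [p2|_] /=; last by rewrite mulr0.
rewrite !big_map; case: hc => [hdT|cm].
  have [w0 _] := co; have := size_tuple u; have := h1 hdT _ _ _ _ p1.
  case: (tval u) => [|c s] /= H su; first by rewrite -su in w0.
  rewrite !big_cons /=.
  have f1s : {in s, forall d, f1 d.1 = 1}.
    move=> d /(nthP (c1, c2))[i hi <-]; by apply: (H i.+2); rewrite -su.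
  have -> : \prod_(d <- s) f1 d.1 = 1 by apply: big1_seq => d /andP[_ /f1s].
  rewrite mulr1 mulrA; congr (_ * _); rewrite big_seq_cond [RHS]big_seq_cond.
  by apply: eq_bigr => d /andP[/f1s -> _]; rewrite mul1r.
have cm12 a b : GRing.comm (f1 a) (f2 b).
  apply: m2 => l hl; apply: commr_sym; apply: m1 => k hk; apply: commr_sym.
  exact: cm.
elim: (tval u) => [|c s IH]; first by rewrite !big_nil mulr1.
rewrite !big_cons -IH; rewrite !mulrA; congr (_ * _); rewrite -!mulrA; congr (_ * _).
have -> // : GRing.comm (\prod_(d <- s) f1 d.1) (f2 c.2).
by apply/commr_sym/commr_prod => d _; apply: commr_sym.
Qed.

(** Transport of P along an embedding h of label sets: every inner label must lie in the image of
    h. *)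
Definition supported C C1 (h : C1 -> C) (h' : C -> C1) (P : asg_pred Sigma C1) : asg_pred Sigma C :=
  fun w s1 s2 u => P w s1 s2 (h' \o u) /\
    ~ exists i : pos w, (letter w i != None) && (h (h' (u i)) != u i).

Lemma rec_asg_supported C C1 (h : C1 -> C) (h' : C -> C1) (P : asg_pred Sigma C1) :
  rec_asg M N P -> rec_asg M N (supported h h' P).
Proof.
move=> rP; apply: rec_asg_and; first exact: (rec_asg_relabel (fun _ => h') rP).
exact/rec_asg_not/(rec_asg_ex M (fun t => (t.1 != None) && (h (h' t.2.2) != t.2.2))).
Qed.

Lemma sum_supported C C1 (h : C1 -> C) (h' : C -> C1) c0 (f : C -> K) (P : asg_pred Sigma C1) w s1 s2 :
    cancel h h' ->
  \sum_(u : (size w).-tuple C)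
    (if `[< supported h h' P s1 s2 (lbl c0 u) >] then \prod_(c <- u) f c else 0) =
  \sum_(u : (size w).-tuple C1)
    (if `[< P w s1 s2 (lbl (h' c0) u) >] then \prod_(c <- u) f (h c) else 0).
Proof.
move=> hK.
have E (u : (size w).-tuple C) : `[< supported h h' P s1 s2 (lbl c0 u) >] =
    (map_tuple h (map_tuple h' u) == u) && `[< P w s1 s2 (lbl (h' c0) (map_tuple h' u)) >].
  have -> : lbl (h' c0) (map_tuple h' u) = h' \o lbl c0 u.
    by apply/funext => i; rewrite /= lbl_map.
  apply/asboolP/andP => [[Pu no]|[/eqP Eu /asboolP Pu]]; split=> //.
  - apply/eqP/(@tuple_lbl_eq _ c0) => -[//|i] hi; rewrite !lbl_nth /=.
    rewrite (nth_map (h' c0)) ?size_map ?size_tuple // (nth_map c0) ?size_tuple //.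
    have hi' : (i.+1 < (size w).+2)%N by lia.
    apply/eqP/negPn/negP => ne; apply: no; exists (Ordinal hi').
    by rewrite letter_inner /= lbl_nth ne andbT.
  - exact/asboolP.
  - move=> [[[|i] hi]] //=; rewrite letter_inner /= lbl_nth => /andP[iw].
    rewrite -[X in nth c0 (tval X) i]Eu /= (nth_map (h' c0)) ?size_map ?size_tuple //.
    by rewrite (nth_map c0) ?size_tuple // hK eqxx.
under eq_bigr => u _ do rewrite E.
rewrite -big_mkcond big_mkcondr /= (sum_tuple_embed _ hK).
by apply: eq_bigr => u _; rewrite /= (mapK hK) big_map.
Qed.

(** Labels come from the disjoint union. As w is nonempty, the label at position 1 shows which
    summand is meant, so no labelling is counted twice. *)
Lemma nf_add f g : nf false f -> nf false g -> nf false (WAdd f g).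
Proof.
move=> [C1 [c1 [f1 [P1 [r1 m1 e1 _]]]]] [C2 [c2 [f2 [P2 [r2 m2 e2 _]]]]].
pose C := (C1 + C2)%type.
pose pl (c : C) := if c is inl a then a else c1.
pose pr (c : C) := if c is inr a then a else c2.
pose F (c : C) := match c with inl a => f1 a | inr b => f2 b end.
pose Q1 := supported inl pl P1; pose Q2 := supported inr pr P2.
exists C, (inl c1 : C), F, (fun w s1 s2 u => Q1 w s1 s2 u \/ Q2 w s1 s2 u); split=> //.
- by apply: rec_asg_or; apply: rec_asg_supported.
- by move=> z cz [a|b]; [apply: m1|apply: m2] => k hk; apply: cz; rewrite mem_cat hk ?orbT.
move=> w o s1 s2 co /=; rewrite (e1 _ _ _ _ co) (e2 _ _ _ _ co).
rewrite -(@sum_supported C C1 inl pl (inl c1) F) // -(@sum_supported C C2 inr pr (inl c1) F) //.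
rewrite -big_split /=; apply: eq_bigr => u _; rewrite asbool_or -/Q1 -/Q2.
case: asboolP => [[_ q1]|_] /=; last by rewrite add0r.
case: asboolP => [[_ q2]|_] /=; last by rewrite addr0.
exfalso; case: co => w0 _; have h1 : (1 < (size w).+2)%N by [].
have l1 : letter w (Ordinal h1) != None by rewrite letter_inner.
case E : (lbl (inl c1 : C) u 1%N) => [a|b].
  by apply: q2; exists (Ordinal h1); rewrite l1 E.
by apply: q1; exists (Ordinal h1); rewrite l1 E.
Qed.

(* The index of an outer sum becomes an extra bit [code t] in the label. *)
Lemma sum_coded (T : finType) (A : {set T}) (w : seq Sigma) (code : T -> (size w).-tuple bool)
    C (f : C -> K) (P : T -> (size w).-tuple C -> Prop) :
    {in A &, injective code} ->
  \sum_(t in A) \sum_(u : (size w).-tuple C) (if `[< P t u >] then \prod_(c <- u) f c else 0) =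
  \sum_(u : (size w).-tuple (C * bool))
    (if `[< exists2 t, t \in A & map_tuple snd u = code t /\ P t (map_tuple fst u) >]
     then \prod_(c <- u) f c.1 else 0).
Proof.
move=> inj; pose G (u : (size w).-tuple C) (v : (size w).-tuple bool) : K :=
  if `[< exists2 t, t \in A & v = code t /\ P t u >] then \prod_(c <- u) f c else 0.
transitivity (\sum_(u : (size w).-tuple (C * bool)) G (map_tuple fst u) (map_tuple snd u));
  last by apply: eq_bigr => u _; rewrite /G big_map.
rewrite (sum_tuple_pair G) exchange_big; apply: eq_bigr => u _; rewrite /G /=.
under [RHS]eq_bigr => v _.
  rewrite -sum_exists; first over.
  by move=> t t' tA tA' [-> _] [/inj-> //].
rewrite exchange_big; apply: eq_bigr => t tA /=.
case: asboolP => Pt.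
  rewrite (@sum_asbool1 _ _ _ (fun=> \prod_(c <- u) f c) (code t)) // => v.
  by split=> [[]|].
by rewrite big1 // => v _; case: asboolP => // -[].
Qed.

Lemma lbl_bits (w : seq Sigma) (p : pred (pos w)) C c0 (u : (size w).-tuple (C * bool)) :
  map_tuple snd u = [tuple p (inord i.+1) | i < size w] <->
  ~ exists i : pos w, (letter w i != None) && ((lbl (c0, false) u i).2 != p i).
Proof.
split=> [E [[[|i] hi] /andP[li]]|no]; [by rewrite letter_inner in li| |].
  move: li; rewrite letter_inner => iw.
  rewrite lbl_nth -(nth_map _ false snd) ?size_tuple //.
  have -> : map snd u = map_tuple snd u by [].
  rewrite E -[i]/(nat_of_ord (Ordinal iw)) -tnth_nth tnth_mktuple /=.
  by rewrite (_ : inord _ = Ordinal hi) ?eqxx //; apply: val_inj; rewrite /= inordK.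
apply: eq_from_tnth => i; rewrite tnth_mktuple tnth_map (tnth_nth (c0, false)).
have hi : (i.+1 < (size w).+2)%N by rewrite !ltnS ltnW.
apply/eqP/negPn/negP => ne; apply: no; exists (Ordinal hi).
rewrite letter_inner /= ltn_ord lbl_nth; apply: contra ne => /eqP ->.
by rewrite (_ : inord _ = Ordinal hi) //; apply: val_inj; rewrite /= inordK.
Qed.

(** Merely quantifying i would merge equal summands. The extra bit records i, so the witness of the
    new existential predicate is unique. *)
Lemma nf_sum1 x f : (x < N)%N -> nf false f -> nf false (WSum1 x f).
Proof.
move=> xN [C [c0 [f1 [P [rP m e _]]]]]; pose x' := Ordinal xN.
pose Q : asg_pred Sigma (C * bool) := fun w s1 s2 u =>
  (exists i : pos w, (letter w i != None) && (s1 x == i)) /\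
  (~ exists i : pos w, (letter w i != None) && ((u i).2 != (s1 x == i))) /\
  P w s1 s2 (fst \o u).
exists (C * bool)%type, (c0, false), (fun c => f1 c.1),
  (fun w s1 s2 u => exists i : pos w, Q w [eta s1 with x |-> i] s2 u); split=> //.
- apply: rec_asg_ex1 => //; apply: rec_asg_and.
    apply: rec_asg_ext (rec_asg_ex (C := (C * bool)%type) M (fun t => (t.1 != None) && (t.2.1.1 x'))) => w o s1 s2 u _ /=.
    by split=> -[i h]; exists i; move: h; rewrite ffunE.
  apply: rec_asg_and; last exact: (rec_asg_relabel (fun _ => fst) rP).
  apply: rec_asg_not.
  apply: rec_asg_ext (rec_asg_ex (C := (C * bool)%type) M (fun t => (t.1 != None) && (t.2.2.2 != t.2.1.1 x'))) => w o s1 s2 u _ /=.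
  by split=> -[i h]; exists i; move: h; rewrite ffunE.
- by move=> z cz c; apply: m.
move=> w o s1 s2 co /=; under eq_bigr => i _ do rewrite (e _ _ _ _ co).
pose code (i : pos w) := [tuple i == inord j.+1 :> pos w | j < size w].
rewrite (@sum_coded _ _ w code C f1 (fun i u => P w [eta s1 with x |-> i] s2 (lbl c0 u))).
  apply: eq_bigr => u _; congr (if _ then _ else _); apply: asbool_equiv_eq.
  have fstE : lbl c0 (map_tuple fst u) = fst \o lbl (c0, false) u.
    by apply/funext => i; rewrite /= (lbl_map fst).
  split=> [[i iA [/(lbl_bits _ _) cu Pu]]|[i [[j /andP[lj /eqP ij]] [cu Pu]]]]; exists i.
  - split; first by exists i; rewrite /= eqxx letter_inner; rewrite inE in iA; rewrite iA eqxx.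
    by split; [rewrite /= eqxx|rewrite -fstE].
  - by move: lj ij; rewrite /= eqxx letter_inner inE => + ->.
  - by split; [apply/(lbl_bits _ c0); move: cu; rewrite /= eqxx|rewrite fstE].
move=> i j; rewrite !inE => iw jw /(congr1 (fun t => tval t)) /= /(congr1 (fun s => nth false s i.-1)).
have hi : (i.-1 < size w)%N by lia.
rewrite -[i.-1]/(nat_of_ord (Ordinal hi)) -[LHS](tnth_nth _ (code i)) -[RHS](tnth_nth _ (code j)) !tnth_mktuple /=.
have -> : inord i.-1.+1 = i by apply: val_inj; rewrite /= inordK prednK //; lia.
by rewrite eqxx => /esym/eqP.
Qed.

Lemma nf_sum2 X f : (X < N)%N -> nf false f -> nf false (WSum2 X f).
Proof.
move=> xN [C [c0 [f1 [P [rP m e _]]]]]; pose x' := Ordinal xN.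
(* The first clause keeps the set inside the inner positions, because [rec_asg_ex2] quantifies over
   sets that may contain the two ends. *)
pose Q : asg_pred Sigma (C * bool) := fun w s1 s2 u =>
  (~ exists i : pos w, (letter w i == None) && (i \in s2 X)) /\
  (~ exists i : pos w, (letter w i != None) && ((u i).2 != (i \in s2 X))) /\
  P w s1 s2 (fst \o u).
exists (C * bool)%type, (c0, false), (fun c => f1 c.1),
  (fun w s1 s2 u => exists I : {set pos w}, Q w s1 [eta s2 with X |-> I] u); split=> //.
- apply: rec_asg_ex2 => //; apply: rec_asg_and.
    apply: rec_asg_not.
    apply: rec_asg_ext (rec_asg_ex (C := (C * bool)%type) M (fun t => (t.1 == None) && (t.2.1.2 x'))) => w o s1 s2 u _ /=.
    by split=> -[i h]; exists i; move: h; rewrite ffunE inord_val.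
  apply: rec_asg_and; last exact: (rec_asg_relabel (fun _ => fst) rP).
  apply: rec_asg_not.
  apply: rec_asg_ext (rec_asg_ex (C := (C * bool)%type) M (fun t => (t.1 != None) && (t.2.2.2 != t.2.1.2 x'))) => w o s1 s2 u _ /=.
  by split=> -[i h]; exists i; move: h; rewrite ffunE inord_val.
- by move=> z cz c; apply: m.
move=> w o s1 s2 co /=; under eq_bigr => i _ do rewrite (e _ _ _ _ co).
pose code (I : {set pos w}) := [tuple inord j.+1 \in I | j < size w].
have inner (I : {set pos w}) : I \in powerset (inner_pos w) <->
    ~ exists i : pos w, (letter w i == None) && (i \in I).
  rewrite inE; split=> [/subsetP h [i /andP[li /h]]|no].
    by rewrite inE -letter_inner li.
  apply/subsetP => i iI; rewrite inE -letter_inner; apply/negP => li.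
  by apply: no; exists i; rewrite li.
rewrite (@sum_coded _ _ w code C f1 (fun I u => P w s1 [eta s2 with X |-> I] (lbl c0 u))).
  apply: eq_bigr => u _; congr (if _ then _ else _); apply: asbool_equiv_eq.
  have fstE : lbl c0 (map_tuple fst u) = fst \o lbl (c0, false) u.
    by apply/funext => i; rewrite /= (lbl_map fst).
  split=> [[I IA [/(lbl_bits (fun i => i \in I) c0) cu Pu]]|[I [IA [cu Pu]]]]; exists I.
  - by split; [apply/inner; rewrite /= eqxx|split; rewrite /= ?eqxx // -?fstE].
  - by apply/inner; move: IA; rewrite /= eqxx.
  - by split; [apply/(lbl_bits (fun i => i \in I) c0); move: cu; rewrite /= eqxx|rewrite fstE].
move=> I J; rewrite !inE => /subsetP IA /subsetP JA E; apply/setP => i.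
have [iw|iw] := boolP (0 < i <= size w)%N; last first.
  have h (B : {set pos w}) : {subset B <= inner_pos w} -> i \in B = false.
    by move=> BA; apply/negP => /BA; rewrite inE (negPf iw).
  by rewrite !h.
have hi : (i.-1 < size w)%N by lia.
move: E => /(congr1 (fun t => tnth t (Ordinal hi))); rewrite !tnth_mktuple /=.
by have -> : inord i.-1.+1 = i by apply: val_inj; rewrite /= inordK prednK //; lia.
Qed.

(** The only accepted labelling writes at each inner position i the class of f under x -> i; the
    product of the values of these labels is the required product. *)
Lemma nf_prod x f : (x < N)%N -> step_formula f -> nf false (WProd x f).
Proof.
move=> xN [J [v [cls [rc m e]]]]; pose x' := Ordinal xN.
(* A universal statement over inner i, phrased with existential quantifiers and negation to fit the
   closure lemmas. *)
pose P : asg_pred Sigma J := fun w s1 s2 u => ~ exists i : pos w,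
  (exists j : pos w, (letter w j != None) && ([eta s1 with x |-> i] x == j)) /\
  exists j, cls w [eta s1 with x |-> i] s2 = j /\ ~ exists k : pos w, (u k == j) && ([eta s1 with x |-> i] x == k).
(* The label for the two ends is just some element of J, and the class of any assignment provides
   one. *)
exists J, (cls [::] (fun=> ord0) (fun=> finset.set0)), v, P; split=> //.
- apply: rec_asg_not; apply: (rec_asg_ex1 (P := fun w s1 s2 u =>
    (exists j : pos w, (letter w j != None) && (s1 x == j)) /\
    exists j, cls w s1 s2 = j /\ ~ exists k : pos w, (u k == j) && (s1 x == k))) => //.
  apply: rec_asg_and.
    apply: rec_asg_ext (rec_asg_ex (C := J) M (fun t => (t.1 != None) && (t.2.1.1 x'))) => w o s1 s2 u _ /=.
    by split=> -[i h]; exists i; move: h; rewrite ffunE.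
  apply: rec_asg_big_or => j; apply: rec_asg_and => //; apply: rec_asg_not.
  apply: rec_asg_ext (rec_asg_ex (C := J) M (fun t => (t.2.2 == j) && (t.2.1.1 x'))) => w o s1 s2 u _ /=.
  by split=> -[i h]; exists i; move: h; rewrite ffunE.
move=> w o s1 s2 co /=; rewrite prod_inner.
set c0 := cls [::] _ _.
pose u0 := [tuple cls w [eta s1 with x |-> inord i.+1] s2 | i < size w].
have u0E i : (0 < i <= size w)%N -> lbl c0 u0 i = cls w [eta s1 with x |-> inord i] s2.
  case: i => [//|i] hi; rewrite lbl_nth -[i]/(nat_of_ord (Ordinal hi)) -tnth_nth.
  by rewrite tnth_mktuple.
rewrite (@sum_asbool1 _ _ _ _ u0).
  by rewrite big_tuple; apply: eq_bigr => i _; rewrite tnth_mktuple e.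
move=> u; rewrite /P /= eqxx; split=> [no|->].
  apply: (@tuple_lbl_eq _ c0) => i iw; rewrite u0E //.
  have hi : (i < (size w).+2)%N by lia.
  apply/eqP/negPn/negP => ne; apply: no; exists (inord i); split.
    by exists (inord i); rewrite letter_inner inordK // iw eqxx.
  eexists; split; first by [].
  by move=> [k /andP[uk /eqP ik]]; case/negP: ne; rewrite -ik inordK // in uk.
move=> [i [[j /andP[lj /eqP ij]]] [_ [<- no]]]; apply: no; exists i.
subst j; rewrite letter_inner in lj; rewrite u0E // eqxx andbT.
by rewrite inord_val.
Qed.

Lemma restricted_sub (f g : wformula Sigma K) : (forall h, subformula h f -> subformula h g) -> restricted g -> restricted f.
Proof. by move=> sub [r1 r2]; split=> [p t /sub/r1|x p /sub/r2]. Qed.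

Lemma restricted_nf phi : (wvars phi <= N)%N -> restricted phi -> nf false phi.
Proof.
have Wbool g : almost_boolean g -> (wvars g <= N)%N -> nf true g.
  by move=> bg gN; apply/nf_step/almost_boolean_step.
have refl (g : wformula Sigma K) : subformula g g by case: g => * /=; left.
elim: phi => [b bN _|k _ _|f IHf g IHg|f IHf g IHg|x f IHf|X f IHf|x f IHf] /=;
  rewrite ?geq_max; try move=> /andP[fN gN] rs.
- exact: nfW (Wbool (WBool _ b) _ _).
- exact: nfW (Wbool (WConst _ k) _ _).
- apply: nf_add; [apply: IHf|apply: IHg] => //; apply: restricted_sub rs => h hs; right; tauto.
- have [[rt rp] nfg] : restricted (WMul f g) /\ nf false g.
    by split=> //; apply: IHg => //; apply: restricted_sub rs => h hs; right; tauto.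
  case: (rt f g (refl _)) => [bf|cm].
    by apply: (@nf_mul true); [apply: Wbool| |left].
  apply: (@nf_mul false) => //; last by right.
  by apply: IHf => //; apply: restricted_sub rs => h hs; right; tauto.
- by apply: nf_sum1 => //; apply: IHf => //; apply: restricted_sub rs => h hs; right; tauto.
- by apply: nf_sum2 => //; apply: IHf => //; apply: restricted_sub rs => h hs; right; tauto.
- apply: nf_prod => //; apply: almost_boolean_step => //.
  by have [_ rp] := rs; apply: (rp x); left.
Qed.

End NormalForm.

(** * The behavior as a recursion over the sequence of moves *)

Section Behavior.
Local Open Scope ring_scope.
Variables (Sigma : finType) (M : opm Sigma) (K : pzSemiRingType) (A : wopa Sigma K).
Local Notation Q := (wopa_state A).
Local Notation config := (config A).
Local Notation step := (fun c1 c2 : config => `[< move M c1 c2 >]).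

(** The moves being fixed, a run is a choice of successor states, so the sum over runs becomes
    nested sums. Weights are multiplied in the order of the run. *)
Fixpoint run_value (w : seq Sigma) (o : seq op) (q : Q) (s : seq Q) : K :=
  match o with
  | [::] => if nilp s && (q \in wopa_final A) then 1 else 0
  | Push _ i :: o' => if letter w i is Some a
      then \sum_(r | (q, a, r) \in wopa_push A) wt_push (q, a, r) * run_value w o' r (q :: s) else 0
  | Shift _ i :: o' => if letter w i is Some a
      then \sum_(r | (q, a, r) \in wopa_shift A) wt_shift (q, a, r) * run_value w o' r s else 0
  | Pop _ _ _ :: o' => if s is p :: s'
      then \sum_(r | (q, p, r) \in wopa_pop A) wt_pop (q, p, r) * run_value w o' r s' else run_value w o' q s
  end.

Definition run_tail (c : config) (s : seq config) : Prop :=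
  path step c s /\ exists2 qF, qF \in wopa_final A & exists k, last c s = ([::], qF, [::], k).

(** An explicit duplicate-free list of the remaining runs lets a recursion on the moves assemble the
    sum over a classical set in [behavior]. *)
Definition enumerates (c : config) (v : K) (l : seq (seq config)) : Prop :=
  [/\ uniq l, forall s, s \in l <-> run_tail c s & \sum_(s <- l) (last c s).2 = c.2 * v].

Definition enumerated (c : config) (v : K) : Prop := exists l, enumerates c v l.

Lemma enumerated_step (c : config) (D : pred Q) (nxt : Q -> config) (wt v : Q -> K) :
    injective nxt -> ~ run_tail c [::] ->
    (forall c', move M c c' <-> exists2 r, D r & c' = nxt r) ->
    (forall r, D r -> (nxt r).2 = c.2 * wt r) ->
    (forall r, D r -> enumerated (nxt r) (v r)) ->
  enumerated c (\sum_(r | D r) wt r * v r).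
Proof.
move=> inj nf mv wtE en.
have [r|L HL] := @boolp.choice _ _ (fun r l => D r -> enumerates (nxt r) (v r) l).
  by have [/en[l h]|] := boolP (D r); [exists l|exists [::]].
exists [seq nxt r :: s | r <- enum D, s <- L r]; split.
- apply: allpairs_uniq_dep; first exact: enum_uniq.
    by move=> r; rewrite mem_enum => /HL[].
  by move=> [r s] [r' s'] _ _ /= [/inj rr' ss']; subst.
- move=> s; split=> [/allpairsPdep[r [s' [rD s'L ->]]]|[]].
    rewrite mem_enum in rD; have [_ /(_ s')[/(_ s'L)[ps es] _] _] := HL _ rD.
    by split=> //=; rewrite ps andbT; apply/asboolT/mv; exists r.
  case: s => [_ e|c' s /=]; first by case: nf.
  move=> /andP[/asboolP/mv[r rD ->] ps] es; apply/allpairsPdep; exists r, s.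
  by rewrite mem_enum; split=> //; have [_ -> _] := HL _ rD.
- rewrite big_allpairs_dep big_distrr /= big_enum /=.
  by apply: eq_bigr => r rD; have [_ _ ->] := HL _ rD; rewrite wtE // mulrA.
Qed.

Lemma move_inv S q x k c' : move M (S, q, x, k) c' ->
  [\/ exists b x' r, [/\ x = b :: x', M (top S) (Some b) = Some Lessdot,
        (q, b, r) \in wopa_push A & c' = ((b, q) :: S, r, x', k * wt_push (q, b, r))],
      exists a p S' b x' r, [/\ S = (a, p) :: S', x = b :: x', M (Some a) (Some b) = Some Doteq,
        (q, b, r) \in wopa_shift A & c' = ((b, p) :: S', r, x', k * wt_shift (q, b, r))]
    | exists a p S' r, [/\ S = (a, p) :: S', M (Some a) (ohead x) = Some Gtrdot,
        (q, p, r) \in wopa_pop A & c' = (S', r, x, k * wt_pop (q, p, r))]].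
Proof.
move=> mv; inversion mv; subst; [constructor 1|constructor 2|constructor 3].
- by exists b, x0, r.
- by exists a, p, P, b, x0, r.
- by exists a, p, P, r.
Qed.

(** The condition on S says that its symbols, with # at the bottom, are the letters of the positions
    in P; hence the automaton can only perform the move that the trace names. *)
Lemma trace_enumerated w P k o P' k' : trace M w P k o P' k' ->
    P' = [:: 0%N] -> k' = size w -> (k <= size w)%N ->
  forall (S : seq (Sigma * Q)) q x, rcons [seq Some e.1 | e <- S] None = map (letter w) P ->
    enumerated (S, q, drop k w, x) (run_value w o q (map snd S)).
Proof.
have topE (S : seq (Sigma * Q)) t P0 : rcons [seq Some e.1 | e <- S] None = letter w t :: P0 -> top S = letter w t.
  by case: S => [|[a p] S] [].
elim=> {P k o P' k'}
  [P k|t P k o P' k' kn m _ IH|t P k o P' k' kn m _ IH|v y P k o P' k' m _ IH] eP ek lk S q x.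
- rewrite eP /=; case: S => [|? []] // _; rewrite ek drop_size /=.
  have no s : path step ([::], q, [::], x) s -> s = [::].
    by case: s => //= c s /andP[/asboolP mv _]; inversion mv.
  case: ifP => qF.
    exists [:: [::]]; split=> [//|s|]; last by rewrite big_seq1 /= mulr1.
    rewrite inE; split=> [/eqP->|[/no -> _] //].
    by split=> //; exists q => //; exists x.
  exists [::]; split=> [//|s|]; last by rewrite big_nil mulr0.
  split=> [//|[/no ->]] /= [q' q'F [k0 [qq' _]]].
  by rewrite -qq' qF in q'F.
- move=> hS /=; have [a la dk] := letterS kn; rewrite la dk.
  have hm : M (top S) (Some a) = Some Lessdot by rewrite (topE _ _ _ hS) -la.
  apply: (enumerated_step (nxt := fun r => ((a, q) :: S, r, drop k.+1 w, x * wt_push (q, a, r)))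
    (v := fun r => run_value w o r (map snd ((a, q) :: S)))) => //=.
  + by move=> r r' [].
  + by move=> [_ [qF _ [k0]]].
  + move=> c'; split=> [mv|[r rD ->]]; last exact: MovePush.
    case: (move_inv mv) => [[b [x' [r [[<- <-] _ rD ->]]]]|[b [p [S' [b' [x' [r [eS [eb _] mm _ _]]]]]]]
        |[b [p [S' [r [eS mm _ _]]]]]]; first by exists r.
      by rewrite eS /= eb mm in hm.
    by rewrite eS /= in hm mm; rewrite mm in hm.
  + by move=> r _; apply: IH => //=; rewrite hS -la.
- move=> hS /=; have [a la dk] := letterS kn; rewrite la dk.
  case: S hS => [|[b p] S] hS.
    by move: m; case: hS => <- _; rewrite la opm_hashl.
  case: hS => lt hS; rewrite -lt la in m.
  apply: (enumerated_step (nxt := fun r => ((a, p) :: S, r, drop k.+1 w, x * wt_shift (q, a, r)))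
    (v := fun r => run_value w o r (map snd ((a, p) :: S)))) => //=.
  + by move=> r r' [].
  + by move=> [_ [qF _ [k0]]].
  + move=> c'; split=> [mv|[r rD ->]]; last exact: MoveShift.
    case: (move_inv mv) => [[c [x' [r [[<- _] mm _ _]]]]|[c [p' [S' [c1 [x' [r [[_ <- <-] [<- <-] _ rD ->]]]]]]]
        |[c [p' [S' [r [[<- _ _] mm _ _]]]]]]; [|by exists r|].
      by rewrite /= m in mm.
    by rewrite /= m in mm.
  + by move=> r _; apply: IH => //=; rewrite hS -la.
- move=> hS /=; case: S hS => [//|[b p] S] [lv hS].
  have hm : M (Some b) (ohead (drop k w)) = Some Gtrdot.
    rewrite lv -m; congr (M _ _); have [kn|kn] := ltnP k (size w).
      by have [a -> ->] := letterS kn.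
    by rewrite letter_end // drop_oversize.
  apply: (enumerated_step (nxt := fun r => (S, r, drop k w, x * wt_pop (q, p, r)))
    (v := fun r => run_value w o r (map snd S))) => //=.
  + by move=> r r' [].
  + by move=> [_ [qF _ [k0]]].
  + move=> c'; split=> [mv|[r rD ->]]; last exact: MovePop.
    case: (move_inv mv) => [[c [x' [r [ex mm _ _]]]]|[c [p' [S' [c1 [x' [r [[<- _ _] ex mm _ _]]]]]]]
        |[c [p' [S' [r [[_ <- <-] _ rD ->]]]]]]; last by exists r.
      by rewrite ex /= in hm; rewrite /= hm in mm.
    by rewrite ex /= mm in hm.
  + by move=> r _; apply: IH.
Qed.

Lemma behaviorE (w : op_word M) o : complete M (sval w) o ->
  behavior A w = \sum_(q in wopa_init A) run_value (sval w) o q [::].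
Proof.
move=> [w0 tr]; pose ini (q : Q) : config := ([::], q, sval w, 1).
have [q|L HL] := @boolp.choice _ _ (fun q l => enumerates (ini q) (run_value (sval w) o q [::]) l).
  have := trace_enumerated tr erefl erefl (leq0n _) (S := [::]) q 1 erefl.
  by rewrite drop0.
rewrite /behavior.
have -> : [set rho | accepting_run M (A := A) (sval w) rho]%classic =
    [set` [seq ini q :: s | q <- enum (wopa_init A), s <- L q]]%classic.
  apply/seteqP; split=> rho /=.
    move=> [c [s [-> [q qI cE] ps es]]]; apply/allpairsPdep; exists q, s.
    rewrite mem_enum; split=> //; last by rewrite cE.
    by have [_ -> _] := HL q; rewrite /ini -cE; split.
  move=> /allpairsPdep[q [s [qI sL ->]]]; rewrite mem_enum in qI.
  have [_ /(_ s)[/(_ sL)[ps es] _] _] := HL q.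
  by exists (ini q), s; split=> //; exists q.
rewrite -fsbig_seq; last first.
  apply: allpairs_uniq_dep; first exact: enum_uniq.
    by move=> q _; have [] := HL q.
  by move=> [q s] [q' s'] _ _ /= [qq' ss']; subst.
rewrite big_allpairs_dep big_enum /=; apply: eq_bigr => q _.
by have [_ _ ->] := HL q; rewrite mul1r.
Qed.

End Behavior.

(** * Nivat forms and automata *)

Section SumLemmas.
Local Open Scope ring_scope.
Variable K : pzSemiRingType.

Lemma sum_tuple_cons (C : finType) m (F : m.+1.-tuple C -> K) :
  \sum_u F u = \sum_c \sum_(u : m.-tuple C) F (cons_tuple c u).
Proof.
rewrite pair_bigA /= (reindex (fun p : C * m.-tuple C => cons_tuple p.1 p.2)) //=.
exists (fun u : m.+1.-tuple C => (thead u, [tuple of behead u])) => [[c u] _|u _] /=.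
  by rewrite theadE; congr pair; apply: val_inj.
by rewrite [u in RHS]tuple_eta; apply: val_inj.
Qed.

Lemma sum_graph (T C : finType) (h : C -> T) (F : T * C -> K) :
  \sum_(p : T * C | p.1 == h p.2) F p = \sum_c F (h c, c).
Proof.
rewrite (reindex_onto (fun c => (h c, c)) snd) /=.
  by apply: eq_bigl => c; rewrite !eqxx.
by move=> [t c] /= /eqP ->.
Qed.

Lemma sum_image (T C : finType) (h : T -> C) (F : C -> K) : injective h ->
  (forall c, (forall t, c <> h t) -> F c = 0) -> \sum_c F c = \sum_t F (h t).
Proof.
move=> inj F0; rewrite (bigID (mem [set h t | t in T])) /= [X in _ + X]big1 ?addr0.
  by rewrite big_imset //= => x y _ _; apply: inj.
by move=> c hc; apply: F0 => t ct; case/negP: hc; rewrite ct imset_f.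
Qed.

End SumLemmas.

(** * Weighted sums over the labellings of a word *)

Section LabelledRuns.
Local Open Scope ring_scope.
Variables (Sigma : finType) (M : opm Sigma) (K : pzSemiRingType) (C : finType) (c0 : C) (f : C -> K).
Variable D : dopa (option Sigma * C)%type.
Local Notation dcfg := (dstate D * seq (dstate D))%type.

Definition junk : nat -> option Sigma * C := fun=> (None, c0).

Fixpoint wrun (w : seq Sigma) (o : seq op) (c : dcfg) : K :=
  match o with
  | [::] => if dfin c.1 (None, c0) then 1 else 0
  | e :: o' => match read_of e with
    | Some i => \sum_b f b * wrun w o' (dstep (fun=> (letter w i, b)) c e)
    | None => wrun w o' (dstep junk c e)
    end
  end.

(** The tuple u labels the positions from k+1 on, hence the index [i - k.+1]; its first entry
    belongs to the next read. *)
Lemma wrunE w o c k m : reads o = iota k.+1 m ->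
  \sum_(u : m.-tuple C) (if dfin (foldl (dstep (lab w (fun i => nth c0 u (i - k.+1)))) c o).1 (None, c0)
     then \prod_(b <- u) f b else 0) = wrun w o c.
Proof.
elim: o c k m => [|e o IH] c k m.
  case: m => // _ /=; rewrite (big_pred1 [tuple]) => [|u]; first by rewrite big_nil.
  by apply/esym/eqP/val_inj; case: u => -[].
case er : (read_of e) => [i|]; rewrite /reads /= er /=; last first.
  move=> ro; rewrite -(IH _ k m ro); apply: eq_bigr => u _.
  by congr (if dfin (foldl _ _ o).1 _ then _ else _); case: e er.
case: m => //= m [ik]; rewrite -/(reads o) => ro; rewrite sum_tuple_cons; apply: eq_bigr => b _.
rewrite -(IH _ _ _ ro) big_distrr; apply: eq_bigr => u _ /=; rewrite big_cons.
set g1 := lab w _; set g2 := lab w _.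
have -> : dstep g1 c e = dstep (fun=> (letter w i, b)) c e.
  have g1i : g1 i = (letter w i, b) by rewrite /g1 /lab ik subnn.
  by case: e er => //= x j [->]; rewrite g1i.
have -> : foldl (dstep g1) (dstep (fun=> (letter w i, b)) c e) o =
          foldl (dstep g2) (dstep (fun=> (letter w i, b)) c e) o.
  apply: dstep_ext => j; rewrite ro mem_iota => hj; rewrite /g1 /g2 /lab.
  have -> : (j - k.+1 = (j - k.+2).+1)%N by lia.
  by [].
by case: ifP; rewrite ?mulr0.
Qed.

Lemma wrun_accept w o : complete M w o ->
  \sum_(u : (size w).-tuple C)
    (if accept D (lab w (lbl c0 u)) (size w) o then \prod_(b <- u) f b else 0) =
  wrun w o (dini D (None, c0), [::]).
Proof.
move=> co; rewrite -(wrunE _ _ (complete_reads co)); apply: eq_bigr => u _.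
have e0 : lbl c0 u 0 = c0 by [].
have e1 : lbl c0 u (size w).+1 = c0 by apply: lbl_out; right; rewrite size_tuple.
rewrite /accept /lab letter_end // e0 e1 letter0.
congr (if dfin _.1 _ then _ else _); apply: dstep_ext => i.
by rewrite (complete_reads co) mem_iota /lab /lbl; case: i => //= i; rewrite subn1.
Qed.

End LabelledRuns.

Arguments wrun {Sigma K C} c0 f D w o c.
Arguments wrun_accept {Sigma M K C} c0 f D {w o}.

Section Nivat.
Local Open Scope ring_scope.
Variables (Sigma : finType) (M : opm Sigma) (K : pzSemiRingType).

(* Nivat form: a deterministic automaton over labelled words, relabelled and
   weighted letter by letter. *)
Definition nivat (S : op_word M -> K) := exists (C : finType) (c0 : C) (f : C -> K)
    (D : dopa (option Sigma * C)%type),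
  forall w o, complete M (sval w) o -> S w = wrun c0 f D (sval w) o (dini D (None, c0), [::]).

Lemma op_word_complete (w : op_word M) : exists o, complete M (sval w) o.
Proof. by case: w => w [w0 cw]; apply: complete_exists. Qed.

Lemma restricted_nivat (S : op_word M -> K) phi :
  sentence phi -> restricted phi -> S =1 sem phi -> nivat S.
Proof.
move=> sen res SE; pose N := wvars phi.
have [C [c0 [f [P [[L [D hD] hL] _ e _]]]]] := restricted_nf M (leqnn N) res.
(* A sentence ignores the assignment. With all first-order variables at position 0 and all sets
   empty, the bits are b0 at 0 and b1 elsewhere, so they can be built into the automaton. *)
pose b0 : bits N := ([ffun=> true], [ffun=> false]).
pose b1 : bits N := ([ffun=> false], [ffun=> false]).
pose F (b : bits N) (a : option Sigma * C) := (a.1, (b, a.2)).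
pose D' : dopa (option Sigma * C)%type := @Dopa _ (dstate D) (fun a => dini D (F b0 a))
  (fun q a => dpush q (F b1 a)) (fun q a => dshift q (F b1 a)) (dpop (d := D))
  (fun q a => dfin q (F b1 a)).
exists C, c0, f, D'; move=> w o co; rewrite SE /sem.
rewrite (@wsem_free _ M K (sval w) phi _ _ (fun=> ord0) (fun=> finset.set0)); try by move=> x; rewrite sen.
rewrite (e _ _ _ _ co) -(wrun_accept c0 f D' co); apply: eq_bigr => u _.
set w' := sval w in co u *; set g := lbl c0 u.
have encE i : enc N (fun=> ord0 : 'I_(size w').+2) (fun=> finset.set0) i = if i is 0%N then b0 else b1.
  by rewrite /enc; case: i => [|i]; congr pair; apply/ffunP => x; rewrite !ffunE ?finset.in_set0.
have -> : accept D' (lab w' g) (size w') o =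
  accept D (lab w' (fun i => (enc N (fun=> ord0 : 'I_(size w').+2) (fun=> finset.set0) i, g i))) (size w') o.
  rewrite /accept /=.
  have /= E := @dstep_hom _ _ D' D (F b1) id (lab w' g) (dini D' (lab w' g 0), [::]) o.
  have := E (fun _ _ => erefl) (fun _ _ => erefl) (fun _ _ => erefl).
  move=> /(congr1 fst) /= <-; rewrite /lab !encE.
  suff -> : foldl (dstep (D := D) (F b1 \o lab w' g)) (dini D (letter w' 0, (b0, g 0%N)), [::]) o =
    foldl (dstep (D := D) (fun i => (letter w' i, (enc N (fun=> ord0 : 'I_(size w').+2) (fun=> finset.set0) i, g i))))
      (dini D (letter w' 0, (b0, g 0%N)), [::]) o by [].
  apply: dstep_ext => i; rewrite (complete_reads co) mem_iota encE.
  by case: i.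
congr (if _ then _ else _); apply/asboolP/idP => h.
  by apply/(hD _ _ _ co)/(hL _ _ _ _ _ co).
by apply/(hL _ _ _ _ _ co)/(hD _ _ _ co).
Qed.

(* The states remember the last label, so that transitions determine labels. *)
Lemma nivat_rwopa (S : op_word M -> K) : nivat S ->
  exists A : wopa Sigma K, restricted_wopa A /\ S =1 behavior A.
Proof.
move=> [C [c0 [f [D SE]]]]; pose Q := (dstate D * C)%type.
pose A : wopa Sigma K := {|
  wopa_state := Q;
  wopa_init := [set (dini D (None, c0), c0)];
  wopa_final := [set q : Q | dfin q.1 (None, c0)];
  wopa_shift := [set t : Q * Sigma * Q | t.2.1 == dshift t.1.1.1 (Some t.1.2, t.2.2)];
  wopa_push := [set t : Q * Sigma * Q | t.2.1 == dpush t.1.1.1 (Some t.1.2, t.2.2)];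
  (* A pop reads no label; resetting the remembered label to [c0] leaves one pop transition for each
     pair of states. *)
  wopa_pop := [set t : Q * Q * Q | t.2 == (dpop t.1.1.1 t.1.2.1, c0)];
  wt_shift := fun t => f t.2.2;
  wt_push := fun t => f t.2.2;
  wt_pop := fun=> 1 |}.
exists A; split=> // w; have [o co] := op_word_complete w.
rewrite (SE _ _ co) (behaviorE A co) big_set1.
set w' := sval w in co *.
have main P k o' P' k' : trace M w' P k o' P' k' -> forall (q : Q) (s : seq Q),
    size P' = 1%N -> size P = (size s).+1 ->
  run_value (A := A) w' o' q s = wrun c0 f D w' o' (q.1, map fst s).
  elim=> {P k o' P' k'} /=
    [P k|t P k o' P' k' kn m _ IH|t P k o' P' k' kn m _ IH|v x P k o' P' k' m _ IH] q s e1 e2.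
  - by case: s e2 => [|p s] e2; [rewrite /= inE|rewrite e1 in e2].
  - have [a la _] := letterS kn; rewrite la.
    under eq_bigl => r do rewrite inE /=.
    rewrite (sum_graph (fun c => dpush q.1 (Some a, c)) (fun r => f r.2 * run_value (A := A) w' o' r (q :: s))).
    by apply: eq_bigr => c _ /=; rewrite IH //= e2.
  - have [a la _] := letterS kn; rewrite la.
    under eq_bigl => r do rewrite inE /=.
    rewrite (sum_graph (fun c => dshift q.1 (Some a, c)) (fun r => f r.2 * run_value (A := A) w' o' r s)).
    by apply: eq_bigr => c _ /=; rewrite IH.
  - case: s e2 => [//|p s] e2 /=; rewrite (big_pred1 (dpop q.1 p.1, c0)) => [|r]; last by rewrite inE.
    by rewrite mul1r IH //=; case: e2 => ->.
by have [_ tr] := co; rewrite (main _ _ _ _ _ tr).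
Qed.

(** * Paying pop weights in advance *)

Section Guess.
Variable A : wopa Sigma K.
Local Notation Q := (wopa_state A).
Local Notation guess := (Q * Q)%type.
Hypothesis central : forall t, t \in wopa_pop A -> forall k : K, GRing.comm k (wt_pop t).

(* A label [(a, q, r, g)] names the transition from q to r reading a.  A push also
   guesses the states g = (s, e) before and after the pop of the pushed entry, so
   that the weight of this pop can be paid in advance. *)
Definition glabel := option (Sigma * Q * Q * option guess).

Definition gweight (c : glabel) : K :=
  match c with
  | Some (a, q, r, Some g) => wt_push (q, a, r) * wt_pop (g.1, q, g.2)
  | Some (a, q, r, None) => wt_shift (q, a, r)
  | None => 0
  end.

(* [None] is a sink; in [Some (q, g)], q is the current state ([None] at the start)
   and g the guess for the topmost entry ([None] at the bottom). *)
Definition gstate := option (option Q * option guess).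

(** A deterministic automaton has one initial state, so the initial state of A is taken from the
    first label; every later label must start in the current state. *)
Definition gpush (d : gstate) (b : option Sigma * glabel) : gstate :=
  match d, b.2 with
  | Some (q0, _), Some (a, q, r, Some g) =>
      if [&& b.1 == Some a, (if q0 is Some q1 then q1 == q else q \in wopa_init A),
             (q, a, r) \in wopa_push A & (g.1, q, g.2) \in wopa_pop A]
      then Some (Some r, Some g) else None
  | _, _ => None
  end.

Definition gshift (d : gstate) (b : option Sigma * glabel) : gstate :=
  match d, b.2 with
  | Some (Some q1, g), Some (a, q, r, None) =>
      if [&& b.1 == Some a, q1 == q & (q, a, r) \in wopa_shift A]
      then Some (Some r, g) else None
  | _, _ => None
  end.

Definition gpop (d p : gstate) : gstate :=
  match d, p with
  | Some (Some q, Some g), Some (_, g') => if q == g.1 then Some (Some g.2, g') else None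
  | _, _ => None
  end.

Definition gfin (d : gstate) : bool := if d is Some (Some q, None) then q \in wopa_final A else false.

Definition gdopa : dopa (option Sigma * glabel)%type :=
  @Dopa _ gstate (fun=> Some (None, None)) gpush gshift gpop (fun d _ => gfin d).

Local Notation gdrun := (wrun None gweight gdopa).

Lemma gdrun_dead w o ds : gdrun w o (None, ds) = 0.
Proof.
elim: o ds => //= e o IH ds; case: e => [x i|x i|v x y] /=.
- by rewrite big1 // => c _; rewrite IH mulr0.
- by rewrite big1 // => c _; rewrite IH mulr0.
- by case: ds.
Qed.

(** A pop consults only the guess in a stored state, so [gcfg] may replace the other component by
    [None]. *)
Lemma gdrun_stack w o (d : gstate) (ds ds' : seq gstate) :
  map (omap snd) ds = map (omap snd) ds' -> gdrun w o (d, ds) = gdrun w o (d, ds').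
Proof.
elim: o d ds ds' => //= e o IH d ds ds' h; case: e => [x i|x i|v x y] /=.
- by apply: eq_bigr => c _; congr (_ * _); apply: IH; rewrite /= h.
- by apply: eq_bigr => c _; congr (_ * _); apply: IH.
- case: ds ds' h => [|p ds] [|p' ds'] //= [h1 h2].
  have -> : gpop d p = gpop d p' by case: p p' h1 {h2} => [[? ?]|] [[? ?]|] //= [->].
  exact: IH.
Qed.

Definition gstack (gs : seq guess) : seq (option guess) := rcons (map Some gs) None.

(** The guess for the topmost entry is in the current state; each stack entry stores the guess for
    the entry below it. *)
Definition gcfg (q : Q) (gs : seq guess) : gstate * seq gstate :=
  (Some (Some q, head None (gstack gs)), [seq Some (None, g) | g <- behead (gstack gs)]).

Lemma gdrun_push w o x i a q gs : letter w i = Some a ->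
  gdrun w (Push x i :: o) (gcfg q gs) =
  \sum_(r | (q, a, r) \in wopa_push A) wt_push (q, a, r) *
    \sum_(g | (g.1, q, g.2) \in wopa_pop A) wt_pop (g.1, q, g.2) * gdrun w o (gcfg r (g :: gs)).
Proof.
move=> la /=; rewrite la.
rewrite (@sum_image _ (Q * guess)%type glabel (fun t => Some (a, q, t.1, Some t.2))); first last.
- move=> [[[[a' q'] r] [g|]]|] /= ne; rewrite ?gdrun_dead ?mulr0 //.
  rewrite /gpush /=; case: ifP; rewrite ?gdrun_dead ?mulr0 // => /and4P[/eqP[ea] /eqP eq _ _].
  by case: (ne (r, g)); rewrite ea eq.
- by move=> [r g] [r' g'] [-> ->].
rewrite -(pair_bigA _ (fun r g => gweight (Some (a, q, r, Some g)) *
  gdrun w o (gpush (gcfg q gs).1 (Some a, Some (a, q, r, Some g)), (gcfg q gs).1 :: (gcfg q gs).2))) /=.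
rewrite [RHS]big_mkcond; apply: eq_bigr => r _.
have [pr|npr] := boolP ((q, a, r) \in wopa_push A); last first.
  by apply: big1 => g _; rewrite /gpush /= !eqxx /= gdrun_dead mulr0.
rewrite big_distrr /= [RHS]big_mkcond; apply: eq_bigr => g _.
rewrite /gpush /= !eqxx /=; case: ifP => pg; last by rewrite gdrun_dead mulr0.
rewrite mulrA; congr (_ * _); apply: gdrun_stack => /=.
by case: gs => [|g' gs] //=; congr (_ :: _); rewrite -!map_comp.
Qed.

Lemma gdrun_shift w o x i a q gs : letter w i = Some a ->
  gdrun w (Shift x i :: o) (gcfg q gs) =
  \sum_(r | (q, a, r) \in wopa_shift A) wt_shift (q, a, r) * gdrun w o (gcfg r gs).
Proof.
move=> la /=; rewrite la.
rewrite (@sum_image _ Q glabel (fun r => Some (a, q, r, None))); first last.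
- move=> [[[[a' q'] r] [g|]]|] /= ne; rewrite ?gdrun_dead ?mulr0 //.
  rewrite /gshift /=; case: ifP; rewrite ?gdrun_dead ?mulr0 // => /and3P[/eqP[ea] /eqP eq _].
  by case: (ne r); rewrite ea eq.
- by move=> r r' [->].
rewrite [RHS]big_mkcond; apply: eq_bigr => r _.
by rewrite /gshift /= !eqxx /=; case: ifP; rewrite ?gdrun_dead ?mulr0.
Qed.

Lemma gdrun_pop w o v x y q g gs :
  gdrun w (Pop v x y :: o) (gcfg q (g :: gs)) = if q == g.1 then gdrun w o (gcfg g.2 gs) else 0.
Proof.
rewrite /=; case: gs => [|g' gs] /=; by case: ifP => _; rewrite ?gdrun_dead.
Qed.

Definition gpopw (g : guess) (p : Q) : K :=
  if (g.1, p, g.2) \in wopa_pop A then wt_pop (g.1, p, g.2) else 0.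

Lemma gpopwC g p k : GRing.comm k (gpopw g p).
Proof. by rewrite /gpopw; case: ifP => [/central//|_]; apply: commr0. Qed.

(** Sums over guesses for all entries on the stack, each paying its pop: exactly the factors already
    paid by the guessing automaton and still due in A. *)
Fixpoint gsum (ps : seq Q) (F : seq guess -> K) : K :=
  if ps is p :: ps' then \sum_g gpopw g p * gsum ps' (fun gs => F (g :: gs)) else F [::].

Lemma gsum_cons p ps F :
  gsum (p :: ps) F = \sum_g gpopw g p * gsum ps (fun gs => F (g :: gs)).
Proof. by []. Qed.

Lemma gsum_ext ps F G : (forall gs, size gs = size ps -> F gs = G gs) -> gsum ps F = gsum ps G.
Proof.
elim: ps F G => [|p ps IH] F G h /=; first exact: h.
by apply: eq_bigr => g _; congr (_ * _); apply: IH => gs sz; apply: h; rewrite /= sz.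
Qed.

(** Here centrality enters: the weight of the next letter moves left past the pop weights of the
    stacked entries. *)
Lemma gsum_sum (I : finType) (D : pred I) ps (k : I -> K) (F : I -> seq guess -> K) :
  gsum ps (fun gs => \sum_(i | D i) k i * F i gs) = \sum_(i | D i) k i * gsum ps (F i).
Proof.
elim: ps F => //= p ps IH F; under eq_bigr do rewrite IH big_distrr /=.
rewrite exchange_big; apply: eq_bigr => i _; rewrite big_distrr /=.
by apply: eq_bigr => g _; rewrite mulrA -gpopwC mulrA.
Qed.

Lemma gsum0 ps F : (forall gs, size gs = size ps -> F gs = 0) -> gsum ps F = 0.
Proof.
elim: ps F => [|p ps IH] F h /=; first exact: h.
by rewrite big1 // => g _; rewrite IH ?mulr0 // => gs sz; apply: h; rewrite /= sz.
Qed.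

(** A push adds a guess to the sum. At a pop the guessed state before it must be q, which collapses
    the sum over guesses to the pop transitions from q. *)
Lemma run_value_gsum w P k o P' k' : trace M w P k o P' k' -> forall q (ps : seq Q),
    size P' = 1%N -> size P = (size ps).+1 ->
  run_value (A := A) w o q ps = gsum ps (fun gs => gdrun w o (gcfg q gs)).
Proof.
elim=> {P k o P' k'}
  [P k|t P k o P' k' kn m _ IH|t P k o P' k' kn m _ IH|v x P k o P' k' m _ IH] q ps e1 e2.
- by case: ps e2 => [|p ps] e2; [|rewrite e1 in e2].
- have [a la _] := letterS kn; rewrite [LHS]/= la.
  transitivity (gsum ps (fun gs => \sum_(r | (q, a, r) \in wopa_push A) wt_push (q, a, r) *
     \sum_(g | (g.1, q, g.2) \in wopa_pop A) wt_pop (g.1, q, g.2) * gdrun w o (gcfg r (g :: gs)))).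
    rewrite gsum_sum; apply: eq_bigr => r _; congr (_ * _); rewrite IH //=; last by case: e2 => ->.
    rewrite gsum_sum [RHS]big_mkcond; apply: eq_bigr => g _.
    by rewrite /gpopw; case: ifP => // _; rewrite mul0r.
  by apply: gsum_ext => gs _; rewrite (gdrun_push _ _ _ _ la).
- have [a la _] := letterS kn; rewrite [LHS]/= la.
  transitivity (gsum ps (fun gs => \sum_(r | (q, a, r) \in wopa_shift A) wt_shift (q, a, r) *
     gdrun w o (gcfg r gs))).
    by rewrite gsum_sum; apply: eq_bigr => r _; congr (_ * _); rewrite IH.
  by apply: gsum_ext => gs _; rewrite (gdrun_shift _ _ _ _ la).
- case: ps e2 => [//|p ps] e2; rewrite [LHS]/= gsum_cons.
  transitivity (\sum_(g : guess) gpopw g p * (if q == g.1 then run_value (A := A) w o g.2 ps else 0)).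
    rewrite -(pair_bigA _ (fun s e => gpopw (s, e) p * (if q == s then run_value (A := A) w o e ps else 0))) /=.
    rewrite [RHS](bigD1 q) //= [X in _ + X]big1 ?addr0; last first.
      by move=> s sq; rewrite big1 // => e _; rewrite eq_sym (negPf sq) mulr0.
    rewrite [LHS]big_mkcond; apply: eq_bigr => e _; rewrite eqxx /gpopw /=.
    by case: ifP => // _; rewrite mul0r.
  apply: eq_bigr => g _; congr (_ * _); case: (eqVneq q g.1) => qg.
    rewrite IH //; last by case: e2 => e2; rewrite /= e2.
    by apply: gsum_ext => gs _; rewrite gdrun_pop qg eqxx.
  by apply/esym/gsum0 => gs _; rewrite gdrun_pop (negPf qg).
Qed.

Lemma wopa_nivat (S : op_word M -> K) : S =1 behavior A -> nivat S.
Proof.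
move=> SE; exists glabel, None, gweight, gdopa; move=> w o co.
rewrite SE (behaviorE A co); set w' := sval w in co *.
have [w0 tr] := co.
under eq_bigr => q _ do rewrite (run_value_gsum tr q (ps := [::]) erefl erefl) /=.
case: o tr {co} => [|e o] tr; first by inversion tr; subst; move: w0; rewrite -H1.
(* Since # yields precedence to every letter, the first move is a push; its label names the initial
   state and absorbs the outer sum over initial states. *)
have [x [i ->]] : exists x i, e = Push x i.
  inversion tr as [|t P k o' P' k' kn m tr'|t P k o' P' k' kn m tr'|]; subst; first by exists 0%N, 1%N.
  by have [a la _] := letterS kn; move: m; rewrite la letter0 opm_hashl.
rewrite /= exchange_big /=; apply: eq_bigr => c _; rewrite -big_distrr /=; congr (_ * _).
case: c => [[[[a q] r] [g|]]|]; rewrite /gpush /=; try by rewrite ?big1 ?gdrun_dead // => q' _; rewrite gdrun_dead.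
have [aE|aE] := eqVneq (letter w' i) (Some a); last first.
  by rewrite gdrun_dead big1 // => q' _; rewrite gdrun_dead.
have [pr|pr] := boolP ((q, a, r) \in wopa_push A); last first.
  by rewrite /= andbF gdrun_dead big1 // => q' _; rewrite andbF gdrun_dead.
have [pp|pp] := boolP ((g.1, q, g.2) \in wopa_pop A); last first.
  by rewrite /= andbF gdrun_dead big1 // => q' _; rewrite andbF gdrun_dead.
rewrite /= !andbT; case: ifP => qI.
  rewrite (bigD1 q) //= eqxx [X in _ + X]big1 ?addr0; first exact: gdrun_stack.
  by move=> q' /andP[_ /negPf ->]; rewrite gdrun_dead.
rewrite gdrun_dead big1 // => q' q'I; case: eqP => [e'|]; last by rewrite gdrun_dead.
by rewrite -e' q'I in qI.
Qed.

End Guess.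

End Nivat.

(** * Acceptance in terms of labels of positions *)

Section RunLabels.
Variables (Sigma : finType) (M : opm Sigma) (T : finType) (D : dopa T).
Variables (w : seq Sigma) (g : nat -> T).
Local Notation Q := (dstate D).
Local Notation n := (size w).

(** The bottom of the stack is never popped, even if M sets # above #; hence the test that a is a
    letter. *)
Definition popping (a b : option Sigma) : bool :=
  match a, M a b with Some _, Some Gtrdot => true | _, _ => false end.

(* Labels of a position i: the states before (lA) and after (lB) reading i, the
   state stored in the stack entry of i (lP), and the state before popping i (lG). *)
Record labels := Labels { lA : nat -> Q; lP : nat -> Q; lB : nat -> Q; lG : nat -> Q }.

(* The state when x is topmost and y is the lookahead. *)
Definition lstate (l : labels) (x y : nat) : Q :=
  if popping (letter w x) (letter w y) then lG l x else lA l y.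

Definition op_cond (l : labels) (e : op) : Prop :=
  match e with
  | Push x i => lP l i = lA l i /\ lB l i = dpush (lA l i) (g i)
  | Shift x i => lP l i = lP l x /\ lB l i = dshift (lA l i) (g i)
  | Pop v x y => lstate l x y = dpop (lG l v) (lP l v)
  end.

Lemma opens_le P k : opens M w P -> head 0 P <= k -> forall i, i \in P -> i <= k.
Proof.
elim: P k => // t [|x P] IH k.
  by move=> _ /= tk i; rewrite inE => /eqP ->.
move=> [xt _ op] /= tk i; rewrite inE => /predU1P[->//|iP].
by apply: (IH k op) iP => /=; lia.
Qed.

Lemma popping_top v x P k : stack_inv M w (v :: x :: P) k ->
  M (letter w v) (letter w k.+1) = Some Gtrdot -> popping (letter w v) (letter w k.+1).
Proof.
move=> [[xv _ _] _ /= vk kn] m; have := letter_inner w v; case E : (letter w v) m => [a|] m; first by rewrite /popping m.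
by rewrite /= => /esym/negbT; lia.
Qed.

Lemma lstate_read l x y p : M (letter w x) (letter w y) = Some p -> p <> Gtrdot ->
  lstate l x y = lA l y.
Proof. by rewrite /lstate /popping; case: (letter w x) => // a ->; case: p. Qed.

Lemma trace_step_inv P k e P1 k1 : trace M w P k [:: e] P1 k1 -> stack_inv M w P k -> stack_inv M w P1 k1.
Proof. by move=> tr iv; case: (trace_inv tr iv). Qed.

Lemma labels_sound l P k o P' k' : trace M w P k o P' k' -> P' = [:: 0] -> k' = n ->
    stack_inv M w P k -> forall q s,
    (forall e, e \in o -> op_cond l e) ->
    (forall i, k < i <= n -> lstate l i i.+1 = lB l i) ->
    lstate l (head 0 P) k.+1 = q -> map (lP l) P = rcons s (lP l 0) ->
  (foldl (dstep (D := D) g) (q, s) o).1 = lA l n.+1.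
Proof.
elim=> {P k o P' k'}
  [P k|t P k o P' k' kn m _ IH|t P k o P' k' kn m _ IH|v x P k o P' k' m _ IH] eP ek iv q s ho hl hq hs.
- by rewrite -hq eP ek /= /lstate /popping letter0.
- have [e1 e2] := ho _ (mem_head _ _).
  rewrite /= (lstate_read _ m) // in hq.
  apply: IH => //=.
  + exact: trace_step_inv (TracePush kn m (TraceNil _ _ _ _)) iv.
  + by move=> e he; apply: ho; rewrite inE he orbT.
  + by move=> i hi; apply: hl; lia.
  + by rewrite hl ?e2 ?hq //; lia.
  + by rewrite e1 hq -hs.
- have [e1 e2] := ho _ (mem_head _ _).
  rewrite /= (lstate_read _ m) // in hq.
  apply: IH => //=.
  + exact: trace_step_inv (TraceShift kn m (TraceNil _ _ _ _)) iv.
  + by move=> e he; apply: ho; rewrite inE he orbT.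
  + by move=> i hi; apply: hl; lia.
  + by rewrite hl ?e2 ?hq //; lia.
  + by rewrite e1 -hs.
- have /= e1 := ho _ (mem_head _ _).
  rewrite /= /lstate (popping_top iv m) in hq.
  case: s hs => [//|p s] /= [hp hs].
  apply: IH => //=.
  + exact: trace_step_inv (TracePop m (TraceNil _ _ _ _)) iv.
  + by move=> e he; apply: ho; rewrite inE he orbT.
  + by rewrite e1 hq hp.
Qed.

(** Labels are filled in along the trace: those of k+1 when it is read, [lG] of v when v is popped.
    The first clause says that later moves leave settled labels alone; only [lG] of stacked
    positions is still open. *)
Lemma labels_exist P k o P' k' : trace M w P k o P' k' -> P' = [:: 0] -> k' = n ->
    stack_inv M w P k -> forall l q s z, map (lP l) P = rcons s z ->
  exists l' : labels, [/\
    (forall i, i <= k -> [/\ lA l' i = lA l i, lP l' i = lP l i & lB l' i = lB l i]) /\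
      (forall i, i <= k -> i \notin P -> lG l' i = lG l i),
    lstate l' (head 0 P) k.+1 = q,
    (forall e, e \in o -> op_cond l' e),
    (forall i, k < i <= n -> lstate l' i i.+1 = lB l' i)
  & lA l' n.+1 = (foldl (dstep (D := D) g) (q, s) o).1].
Proof.
have upd (f : nat -> Q) k0 (q : Q) i : i <= k0 -> [eta f with k0.+1 |-> q] i = f i.
  by move=> ik /=; case: eqP => // e; lia.
have ltF i k0 : i <= k0 -> (i == k0.+1) = false by lia.
elim=> {P k o P' k'}
  [P k|t P k o P' k' kn m _ IH|t P k o P' k' kn m _ IH|v x P k o P' k' m _ IH] eP ek iv l q s z hs.
- exists (Labels [eta lA l with k.+1 |-> q] (lP l) (lB l) (lG l)); split=> //.
  + by split=> // i ik; split=> //; rewrite /= ltF.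
  + by rewrite eP /lstate /popping letter0 /= eqxx.
  + by move=> i; rewrite ek; lia.
  + by rewrite ek /= eqxx.
- have iv' := trace_step_inv (TracePush kn m (TraceNil _ _ _ _)) iv.
  have le i : i \in t :: P -> i <= k by case: iv => op _ hk _; apply: opens_le op hk i.
  case: (IH eP ek iv' (Labels [eta lA l with k.+1 |-> q] [eta lP l with k.+1 |-> q]
    [eta lB l with k.+1 |-> dpush q (g k.+1)] (lG l)) (dpush q (g k.+1)) (q :: s) z).
    rewrite map_cons /= eqxx -/(map _ (t :: P)); congr (_ :: _).
    by rewrite -hs; apply/eq_in_map => i /le; exact: upd.
  move=> l' [[fr frG] h1 h2 h3 h4]; exists l'.
  have [/= fA fP fB] := fr _ (leqnn _); rewrite eqxx in fA fP fB.
  split=> //.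
  + split=> i ik; first by have [|/= -> -> ->] := fr i; [lia|rewrite ltF].
    by move=> iP; rewrite frG //=; [lia|rewrite inE negb_or iP andbT; apply/eqP; lia].
  + by rewrite /= (lstate_read _ m) // fA.
  + by move=> e; rewrite inE => /predU1P[->|/h2//] /=; rewrite fP fA fB.
  + move=> i ik; have [->|ne] := eqVneq i k.+1; last by apply: h3; lia.
    by rewrite fB -h1.
- have iv' := trace_step_inv (TraceShift kn m (TraceNil _ _ _ _)) iv.
  have le i : i \in t :: P -> i <= k by case: iv => op _ hk _; apply: opens_le op hk i.
  case: (IH eP ek iv' (Labels [eta lA l with k.+1 |-> q] [eta lP l with k.+1 |-> lP l t]
    [eta lB l with k.+1 |-> dshift q (g k.+1)] (lG l)) (dshift q (g k.+1)) s z).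
    rewrite map_cons /= eqxx -hs /=; congr (_ :: _).
    by apply/eq_in_map => i iP; apply: upd; apply: le; rewrite inE iP orbT.
  move=> l' [[fr frG] h1 h2 h3 h4]; exists l'.
  have [/= fA fP fB] := fr _ (leqnn _); rewrite eqxx in fA fP fB.
  have tk := le t (mem_head _ _).
  split=> //.
  + split=> i ik; first by have [|/= -> -> ->] := fr i; [lia|rewrite ltF].
    move=> iP; rewrite frG //=; first lia.
    by move: iP; rewrite !inE !negb_or => /andP[_ ->]; rewrite andbT; apply/eqP; lia.
  + by rewrite /= (lstate_read _ m) // fA.
  + move=> e; rewrite inE => /predU1P[->|/h2//] /=; rewrite fP fA fB; split=> //.
    by have [|_ -> _] := fr t; [lia|rewrite /= ltF].
  + move=> i ik; have [->|ne] := eqVneq i k.+1; last by apply: h3; lia.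
    by rewrite fB -h1.
- have iv' := trace_step_inv (TracePop m (TraceNil _ _ _ _)) iv.
  have [[xv _ op] _ /= vk kn] := iv.
  have vP : v \notin x :: P.
    have op' : opens M w (x :: P) by case: iv'.
    by apply/negP => vP; have /= := opens_le op' (leqnn _) vP; lia.
  case: s hs => [|p s] /=; first by case: (P).
  move=> [hp hs].
  case: (IH eP ek iv' (Labels (lA l) (lP l) (lB l) [eta lG l with v |-> q]) (dpop q p) s z) => //.
  move=> l' [[fr frG] h1 h2 h3 h4]; exists l'.
  have Gv : lG l' v = q by rewrite frG //= eqxx.
  split=> //.
  + split=> // i ik; rewrite inE negb_or => /andP[iv0 iP].
    by rewrite frG //= (negPf iv0).
  + by rewrite /lstate (popping_top iv m).
  + move=> e; rewrite inE => /predU1P[->|/h2//] /=.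
    by have [_ -> _] := fr v vk; rewrite Gv hp.
Qed.

(** [lB l 0] is the initial state of the run and [lA l n.+1] its last; the second clause hands the
    state from a position to its successor. *)
Definition labels_ok (o : seq op) (l : labels) : Prop :=
  [/\ forall e, e \in o -> op_cond l e, forall i, i <= n -> lstate l i i.+1 = lB l i,
      lB l 0 = dini D (g 0) & dfin (lA l n.+1) (g n.+1)].

Lemma accept_labels o : complete M w o ->
  accept D g n o <-> exists l, labels_ok o l.
Proof.
move=> [w0 tr]; rewrite /accept; split.
  pose q0 := dini D (g 0) => fq.
  pose l0 := Labels (fun=> q0) (fun=> q0) (fun=> q0) (fun=> q0).
  case: (labels_exist tr erefl erefl (stack_inv0 M w) (l := l0) (dini D (g 0)) (s := [::]) (z := q0)) => //.
  move=> l [[fr _] h1 h2 h3 h4]; exists l; have [_ _ l0B] := fr 0 (leqnn _); split=> //.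
  - by case=> [_|i hi]; [rewrite h1 l0B|apply: h3].
  - by rewrite h4.
move=> [l [h1 h2 h3 h4]].
rewrite (labels_sound tr erefl erefl (stack_inv0 M w) (l := l)) //.
- by move=> i hi; apply: h2; lia.
- by rewrite /= h2.
Qed.

End RunLabels.

(** * MSO definability of acceptance *)

Section Definability.
Variables (Sigma : finType) (M : opm Sigma).
Local Notation pos w := 'I_(size w).+2.

Definition mso_pred := forall w : seq Sigma, (nat -> pos w) -> (nat -> {set pos w}) -> Prop.
Implicit Types P : mso_pred.

Definition mso P := exists b, forall w s1 s2, bsat M s1 s2 b <-> P w s1 s2.

Lemma mso_ext P P' : (forall w s1 s2, P w s1 s2 <-> P' w s1 s2) -> mso P -> mso P'.
Proof. by move=> e [b h]; exists b => w s1 s2; rewrite h e. Qed.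

Lemma mso_not P : mso P -> mso (fun w s1 s2 => ~ P w s1 s2).
Proof. by move=> [b h]; exists (BNot b) => w s1 s2; rewrite /= h. Qed.

Lemma mso_or P P' : mso P -> mso P' -> mso (fun w s1 s2 => P w s1 s2 \/ P' w s1 s2).
Proof. by move=> [b h] [b' h']; exists (BOr b b') => w s1 s2; rewrite /= h h'. Qed.

Lemma mso_and P P' : mso P -> mso P' -> mso (fun w s1 s2 => P w s1 s2 /\ P' w s1 s2).
Proof.
move=> h h'; apply: mso_ext (mso_not (mso_or (mso_not h) (mso_not h'))) => w s1 s2.
by have [] := pselect (P w s1 s2); have [] := pselect (P' w s1 s2); tauto.
Qed.

Lemma mso_imp P P' : mso P -> mso P' -> mso (fun w s1 s2 => P w s1 s2 -> P' w s1 s2).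
Proof.
move=> h h'; apply: mso_ext (mso_or (mso_not h) h') => w s1 s2.
by have [] := pselect (P w s1 s2); tauto.
Qed.

Lemma mso_bool (b : bool) : mso (fun w s1 s2 => b).
Proof.
have t : mso (fun w s1 s2 => True) by exists (BLe _ 0 0) => w s1 s2; split=> //= _.
case: b; first by apply: mso_ext t.
by apply: mso_ext (mso_not t) => w s1 s2; split=> // -[].
Qed.

Lemma mso_ex1 x P : mso P -> mso (fun w s1 s2 => exists i : pos w, P w [eta s1 with x |-> i] s2).
Proof. by move=> [b h]; exists (BEx1 x b) => w s1 s2 /=; split=> -[i /h]; exists i. Qed.

Lemma mso_all1 x P : mso P -> mso (fun w s1 s2 => forall i : pos w, P w [eta s1 with x |-> i] s2).
Proof.
move=> h; apply: mso_ext (mso_not (mso_ex1 x (mso_not h))) => w s1 s2; split.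
  by move=> no i; apply: contrapT => nP; apply: no; exists i.
by move=> al [i]; apply.
Qed.

Lemma mso_ex2 X P : mso P -> mso (fun w s1 s2 => exists I : {set pos w}, P w s1 [eta s2 with X |-> I]).
Proof. by move=> [b h]; exists (BEx2 X b) => w s1 s2 /=; split=> -[i /h]; exists i. Qed.

Lemma mso_all_fin (J : finType) (P : J -> mso_pred) : (forall j, mso (P j)) ->
  mso (fun w s1 s2 => forall j, P j w s1 s2).
Proof.
move=> h; suff H (s : seq J) : mso (fun w s1 s2 => forall j, j \in s -> P j w s1 s2).
  by apply: mso_ext (H (enum J)) => w s1 s2; split=> al j; [apply: al; rewrite mem_enum|].
elim: s => [|j s IH]; first by apply: mso_ext (mso_bool true).
apply: mso_ext (mso_and (h j) IH) => w s1 s2; split.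
  by move=> [Pj al] i /[!inE] /predU1P[->|/al].
by move=> al; split=> [|i si]; apply: al; rewrite inE ?eqxx ?si ?orbT.
Qed.

Lemma mso_ex_fin (J : finType) (P : J -> mso_pred) : (forall j, mso (P j)) ->
  mso (fun w s1 s2 => exists j, P j w s1 s2).
Proof.
move=> h; apply: mso_ext (mso_not (mso_all_fin (fun j => mso_not (h j)))) => w s1 s2; split.
  by move=> /existsNP[j /contrapT]; exists j.
by move=> [j Pj] /(_ j).
Qed.

Lemma mso_lab a x : mso (fun w s1 s2 => letter w (s1 x) = a).
Proof. by exists (BLab a x). Qed.

Lemma mso_in x X : mso (fun w s1 s2 => s1 x \in s2 X).
Proof. by exists (BIn _ x X). Qed.

Lemma mso_lt x y : mso (fun w s1 s2 => s1 x < s1 y).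
Proof.
exists (BNot (BLe _ y x)) => w s1 s2 /=; rewrite ltnNge.
by split=> /negP.
Qed.

Lemma mso_chain x y : mso (fun w s1 s2 => chain M w (s1 x) (s1 y)).
Proof. by exists (BChain _ x y). Qed.

Lemma mso_succ x y z : z != x -> z != y -> mso (fun w s1 s2 => (s1 x).+1 = s1 y).
Proof.
move=> zx zy; rewrite eq_sym in zx; rewrite eq_sym in zy.
apply: mso_ext (mso_and (mso_lt x y) (mso_not (mso_ex1 z (mso_and (mso_lt x z) (mso_lt z y))))).
move=> w s1 s2; rewrite /= eqxx (negPf zx) (negPf zy); split.
  move=> [xy no]; apply/eqP; rewrite eqn_leq xy /= leqNgt; apply/negP => lt.
  have hz : (s1 x).+1 < (size w).+2 by apply: ltn_trans lt _.
  by apply: no; exists (Ordinal hz).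
by move=> <-; split=> // -[i []] /=; lia.
Qed.

Lemma mso_link x y z : z != x -> z != y -> mso (fun w s1 s2 => link M w (s1 x) (s1 y)).
Proof. by move=> zx zy; apply: mso_or (mso_succ zx zy) (mso_chain x y). Qed.

Definition override (w : seq Sigma) a l (h s : nat -> {set pos w}) X :=
  if a <= X < a + l then h X else s X.

Lemma mso_ex_family a l P : mso P ->
  mso (fun w s1 s2 => exists h : nat -> {set pos w}, P w s1 (override a l h s2)).
Proof.
move=> mP; elim: l => [|l IH].
  apply: mso_ext mP => w s1 s2; have E h : override a 0 h s2 = s2.
    by apply/funext => X; rewrite /override; case: ifP => //; lia.
  by split=> [|[h]]; [exists s2|]; rewrite E.
apply: mso_ext (mso_ex2 (a + l) IH) => w s1 s2.
have E (h : nat -> {set pos w}) I : override a l h [eta s2 with a + l |-> I] =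
    override a l.+1 [eta h with a + l |-> I] s2.
  apply/funext => X; rewrite /override /=; have [->|ne] := eqVneq X (a + l).
    by rewrite ltnn andbF leq_addr addnS ltnSn.
  by rewrite addnS ltnS [X <= a + l]leq_eqVlt (negPf ne).
split=> [[I [h]]|[h Ph]]; first by rewrite E; exists [eta h with a + l |-> I].
exists (h (a + l)), h; rewrite E; move: Ph; congr (P w s1 (override _ _ _ _)).
by apply/funext => X /=; case: eqP => [->|].
Qed.

(** The closure lemmas do not control free variables. Every unwanted one is bound by an existential
    quantifier, which changes nothing because P does not depend on it. *)
Lemma mso_close m P :
    (forall w s1 t1 s2 t2, (forall X, X < m -> s2 X = t2 X) -> P w s1 s2 -> P w t1 t2) -> mso P ->
  exists b, (forall v, v \in bfree b -> exists2 X, X < m & v = inr X) /\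
    forall w s1 s2, bsat M s1 s2 b <-> P w s1 s2.
Proof.
move=> inv [b h].
pose bind (v : nat + nat) (c : bformula Sigma) : bformula Sigma := match v with
  | inl x => BEx1 x c | inr X => if X < m then c else BEx2 X c end.
exists (foldr bind b (bfree b)); split.
  have sub l v : v \in bfree (foldr bind b l) ->
      v \in bfree b /\ (v \in l -> exists2 X, X < m & v = inr X).
    elim: l => //= -[x|X] l IH /=.
      rewrite mem_filter => /andP[vx /IH[vb vl]]; split=> //.
      by rewrite inE (negPf vx).
    case: ifP => Xm.
      by move=> /IH[vb vl]; split=> //; rewrite inE => /predU1P[->|//]; exists X.
    rewrite /= mem_filter => /andP[vx /IH[vb vl]]; split=> //.
    by rewrite inE (negPf vx).
  by move=> v /sub[vb]; apply.
elim: (bfree b) => [|[x|X] l IH] w s1 s2 /=; first exact: h.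
  split=> [[i /IH]|Pw]; first by apply: inv.
  by exists ord0; apply/IH; apply: inv Pw.
case: ifP => Xm; first exact: IH.
split=> [[I /IH]|Pw].
  by apply: inv => Y Ym /=; case: eqP => // e; rewrite e Xm in Ym.
by exists (s2 X); apply/IH; apply: inv Pw => Y Ym /=; case: eqP => // ->.
Qed.

Section Acceptance.
Variables (C : finType) (c0 : C) (D : dopa (option Sigma * C)%type).
Local Notation Q := (dstate D).

(* letter and label of a position, then its run labels lA, lP, lB, lG *)
Definition mark := (option Sigma * C * (Q * Q * Q * Q))%type.

Definition mA (k : mark) : Q := k.2.1.1.1.
Definition mP (k : mark) : Q := k.2.1.1.2.
Definition mB (k : mark) : Q := k.2.1.2.
Definition mG (k : mark) : Q := k.2.2.

Definition mstate (kx ky : mark) : Q := if popping M kx.1.1 ky.1.1 then mG kx else mA ky.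

(** Among successive positions the first carries # only at 0 and the second only at |w|+1, so the
    conditions on initial and final state are attached here. *)
Definition succ_ok (kx ky : mark) : bool :=
  [&& mstate kx ky == mB kx, (kx.1.1 == None) ==> (mB kx == dini D (None, c0))
    & (ky.1.1 == None) ==> dfin (mA ky) (None, c0)].

Definition link_ok (kx ki : mark) : bool :=
  match ki.1.1, M kx.1.1 ki.1.1 with
  | Some _, Some Lessdot => (mP ki == mA ki) && (mB ki == dpush (mA ki) ki.1)
  | Some _, Some Doteq => (mP ki == mP kx) && (mB ki == dshift (mA ki) ki.1)
  | _, _ => true
  end.

Definition pop_ok (kv kx ky : mark) : bool :=
  (kv.1.1 != None) ==> (mstate kx ky == dpop (mG kv) (mP kv)).

(** The sets Y need not be disjoint: the conditions bind all marks of the positions involved, so any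
    choice of one mark per position describes an accepting run. The last clause is the description
    of pops in [popE]. *)
Definition good_marks (w : seq Sigma) (X : C -> {set pos w}) (Y : mark -> {set pos w}) : Prop :=
  [/\ forall i, exists k, i \in Y k,
      forall i k, i \in Y k -> letter w i = k.1.1 /\ (k.1.1 != None -> i \in X k.1.2),
      forall x y : pos w, x.+1 = y -> forall kx ky, x \in Y kx -> y \in Y ky -> succ_ok kx ky,
      forall x y : pos w, link M w x y -> forall kx ky, x \in Y kx -> y \in Y ky -> link_ok kx ky
    & forall v x y : pos w, [/\ x < v, link M w v y, chain M w x y
          & forall t : pos w, x < t < v -> ~ link M w t y] ->
        forall kv kx ky, v \in Y kv -> x \in Y kx -> y \in Y ky -> pop_ok kv kx ky].

Definition partitioned (w : seq Sigma) (X : C -> {set pos w}) (u : nat -> C) : Prop :=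
  forall (i : pos w) c, letter w i != None -> i \in X c <-> c = u i.

Lemma good_marks_accept w o (X : C -> {set pos w}) u : complete M w o -> partitioned X u ->
    u 0 = c0 -> u (size w).+1 = c0 ->
  (exists Y, good_marks X Y) <-> accept D (lab w u) (size w) o.
Proof.
move=> co part u0 un; rewrite (accept_labels D (lab w u) co).
have posP i : i <= (size w).+1 -> exists j : pos w, j = i :> nat.
  by move=> hi; exists (Ordinal (n := (size w).+2) (m := i) hi).
split.
  move=> [Y [y1 y2 y3 y4 y5]].
  have [f fY] := boolp.choice y1.
  pose F i := f (inord i : pos w).
  have FY (i : pos w) : i \in Y (F i) by rewrite /F inord_val.
  have F1 (i : pos w) : (F i).1.1 = letter w i by have [-> _] := y2 _ _ (FY i).
  have F2 (i : pos w) : letter w i != None -> (F i).1.2 = u i.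
    by move=> li; have [e /(_ _)h] := y2 _ _ (FY i); apply/(part i _ li)/h; rewrite -e.
  have F12 (i : pos w) : letter w i != None -> (F i).1 = lab w u i.
    by move=> li; rewrite /lab -F1 -F2 //; case: (F i) => -[].
  pose l := Labels (fun i => mA (F i)) (fun i => mP (F i)) (fun i => mB (F i)) (fun i => mG (F i)).
  have lst (x y : pos w) : lstate M w l x y = mstate (F x) (F y).
    by rewrite /lstate /mstate !F1.
  exists l; split.
  - move=> e eo; have ok := op_okP co eo; case: e eo ok => [x i|x i|v x y].
    + move=> /(pushE co)[lk li m] [/andP[i0 iN] xi _ _].
      have [i' ei] : exists j : pos w, j = i :> nat by apply: posP; lia.
      have [x' ex] : exists j : pos w, j = x :> nat by apply: posP; lia.
      move: lk li m; rewrite -ei -ex => lk /eqP li m.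
      have := y4 _ _ lk _ _ (FY x') (FY i'); rewrite /link_ok !F1 m.
      by case E : (letter w i') li => [a|//] li; rewrite F12 ?E // => /andP[/eqP ? /eqP ?].
    + move=> /(shiftE co)[lk li m] [/andP[i0 iN] xi _ _].
      have [i' ei] : exists j : pos w, j = i :> nat by apply: posP; lia.
      have [x' ex] : exists j : pos w, j = x :> nat by apply: posP; lia.
      move: lk li m; rewrite -ei -ex => lk /eqP li m.
      have := y4 _ _ lk _ _ (FY x') (FY i'); rewrite /link_ok !F1 m.
      by case E : (letter w i') li => [a|//] li; rewrite F12 ?E // => /andP[/eqP ? /eqP ?].
    + move=> /(popE co)[xv lk lv ch nb] [/andP[_ vy] yn _ _ _].
      have [v' ev] : exists j : pos w, j = v :> nat by apply: posP; lia.
      have [x' ex] : exists j : pos w, j = x :> nat by apply: posP; lia.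
      have [y' ey] : exists j : pos w, j = y :> nat by apply: posP; lia.
      move: xv lk lv ch nb; rewrite -ev -ex -ey => xv lk /eqP lv ch nb.
      have := y5 v' x' y' (And4 xv lk ch (fun t : pos w => nb t)) _ _ _ (FY v') (FY x') (FY y').
      by rewrite /pop_ok F1 lv /= -lst => /eqP.
  - move=> i iN; have [i' ei] : exists j : pos w, j = i :> nat by apply: posP; lia.
    have [j' ej] : exists j : pos w, j = i.+1 :> nat by apply: posP; lia.
    have ij : i'.+1 = j' by rewrite ei ej.
    have /and3P[/eqP + _ _] := y3 _ _ ij _ _ (FY i') (FY j').
    by rewrite -lst -ej -ei.
  - have [x ex] : exists j : pos w, j = 0%N :> nat by apply: posP.
    have [y ey] : exists j : pos w, j = 1%N :> nat by apply: posP.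
    have xy : x.+1 = y by rewrite ex ey.
    have /and3P[_ + _] := y3 _ _ xy _ _ (FY x) (FY y).
    by rewrite F1 ex letter0 eqxx /= => /eqP ->; rewrite /lab u0.
  - have [x ex] : exists j : pos w, j = size w :> nat by apply: posP; lia.
    have [y ey] : exists j : pos w, j = (size w).+1 :> nat by apply: posP.
    have xy : x.+1 = y by rewrite ex ey.
    have /and3P[_ _] := y3 _ _ xy _ _ (FY x) (FY y).
    by rewrite F1 ey letter_end // eqxx /= /lab un letter_end.
move=> [l [l1 l2 l3 l4]].
pose mk i : mark := (lab w u i, (lA l i, lP l i, lB l i, lG l i)).
exists (fun k => [set i : pos w | mk i == k]).
have mst x y : mstate (mk x) (mk y) = lstate M w l x y by [].
split.
- by move=> i; exists (mk i); rewrite inE.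
- by move=> i k; rewrite inE => /eqP <-; split=> // li; apply/(part _ _ li).
- move=> x y xy kx ky; rewrite !inE => /eqP <- /eqP <-; rewrite /succ_ok mst -xy l2 ?eqxx /=; last first.
    by have := ltn_ord y; rewrite -xy.
  have xn : x < (size w).+1 by have := ltn_ord y; rewrite -xy.
  apply/andP; split; apply/implyP => /eqP /=.
    have := letter_inner w x; case: (letter w x) => // + _; rewrite eqxx /= => /esym/negbT h.
    have -> : (x : nat) = 0%N by lia.
    by rewrite /mB /= l3 /lab u0.
  have := letter_inner w x.+1; case: (letter w x.+1) => // + _; rewrite eqxx /= => /esym/negbT h.
  have e : x.+1 = (size w).+1 by lia.
  by rewrite e /mA /=; move: l4; rewrite /lab un letter_end.
- move=> x y lk kx ky; rewrite !inE => /eqP <- /eqP <-; rewrite /link_ok /=.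
  case ly : (letter w y) => [a|//].
  case m : (M (letter w x) (Some a)) => [[]|] //.
    have : Push x y \in o by apply/(pushE co); rewrite ly; split.
    by move=> /l1 /= [e1 e2]; rewrite /mP /mA /mB /= e1 e2 /lab ?ly !eqxx.
  have : Shift x y \in o by apply/(shiftE co); rewrite ly; split.
  by move=> /l1 /= [e1 e2]; rewrite /mP /mA /mB /= e1 e2 /lab ?ly !eqxx.
- move=> v x y [xv lk ch nb] kv kx ky; rewrite !inE => /eqP <- /eqP <- /eqP <-.
  rewrite /pop_ok mst; apply/implyP => /= /eqP lv.
  have /l1 /= -> // : Pop v x y \in o.
  apply/(popE co); split=> // t xtv.
  have [t' et] : exists j : pos w, j = t :> nat by apply: posP; have := ltn_ord v; lia.
  by rewrite -et; apply: nb; rewrite et.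
Qed.

End Acceptance.

End Definability.

(** * From Nivat forms to sentences *)

Section Definable.
Variables (Sigma : finType) (M : opm Sigma).
Variables (C : finType) (c0 : C) (D : dopa (option Sigma * C)%type).
Local Notation pos w := 'I_(size w).+2.
Local Notation m := #|C|.
Local Notation mark := (mark D).

(** Set variables below #|C| encode the labelling and stay free for the weighted sums; those from
    #|C| on encode the marks and get bound. *)
Definition label_var (c : C) : nat := enum_rank c.
Definition mark_var (k : mark) : nat := m + enum_rank k.

Lemma mso_good_marks : mso M (fun w s1 s2 =>
  @good_marks Sigma M C c0 D w (fun c => s2 (label_var c)) (fun k => s2 (mark_var k))).
Proof.
have pair x y (B : mark -> mark -> bool) : mso M (fun w s1 s2 => forall kx ky : mark,
    s1 x \in s2 (mark_var kx) -> s1 y \in s2 (mark_var ky) -> B kx ky).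
  apply: mso_all_fin => kx; apply: mso_all_fin => ky.
  by apply: mso_imp; [apply: mso_in|apply: mso_imp; [apply: mso_in|apply: mso_bool]].
have g1 : mso M (fun w s1 s2 => forall i : pos w, exists k, i \in s2 (mark_var k)).
  exact: (mso_all1 0 (mso_ex_fin (fun k => mso_in M 0 (mark_var k)))).
have g2 : mso M (fun w s1 s2 => forall i : pos w, forall k, i \in s2 (mark_var k) ->
    letter w i = k.1.1 /\ (k.1.1 != None -> i \in s2 (label_var k.1.2))).
  apply: (mso_all1 0 (P := fun w s1 s2 => forall k, s1 0 \in s2 (mark_var k) ->
    letter w (s1 0) = k.1.1 /\ (k.1.1 != None -> s1 0 \in s2 (label_var k.1.2)))).
  apply: mso_all_fin => k; apply: mso_imp (mso_in _ _ _) _; apply: mso_and (mso_lab _ _ _) _.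
  exact: mso_imp (mso_bool _ _) (mso_in _ _ _).
have g3 : mso M (fun w s1 s2 => forall x y : pos w, x.+1 = y -> forall kx ky,
    x \in s2 (mark_var kx) -> y \in s2 (mark_var ky) -> succ_ok M c0 kx ky).
  exact: (mso_all1 0 (mso_all1 1 (mso_imp (mso_succ M (x := 0) (y := 1) (z := 2) isT isT) (pair 0 1 _)))).
have g4 : mso M (fun w s1 s2 => forall x y : pos w, link M w x y -> forall kx ky,
    x \in s2 (mark_var kx) -> y \in s2 (mark_var ky) -> link_ok M kx ky).
  exact: (mso_all1 0 (mso_all1 1 (mso_imp (mso_link M (x := 0) (y := 1) (z := 2) isT isT) (pair 0 1 _)))).
have g5 : mso M (fun w s1 s2 => forall v x y : pos w,
    x < v /\ link M w v y /\ chain M w x y /\ (forall t : pos w, x < t /\ t < v -> ~ link M w t y) ->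
    forall kv kx ky, v \in s2 (mark_var kv) -> x \in s2 (mark_var kx) -> y \in s2 (mark_var ky) ->
    pop_ok M kv kx ky).
  (* Variables 0, 1, 2, 3 stand for v, x, y, t, and 4 is the auxiliary variable of [mso_link]. *)
  apply: (mso_all1 0 (mso_all1 1 (mso_all1 2 (mso_imp (mso_and (mso_lt M 1 0)
    (mso_and (mso_link M (x := 0) (y := 2) (z := 4) isT isT) (mso_and (mso_chain M 1 2)
    (mso_all1 3 (mso_imp (mso_and (mso_lt M 1 3) (mso_lt M 3 0))
      (mso_not (mso_link M (x := 3) (y := 2) (z := 4) isT isT))))))) (P' := fun w s1 s2 => forall kv kx ky,
    s1 0 \in s2 (mark_var kv) -> s1 1 \in s2 (mark_var kx) -> s1 2 \in s2 (mark_var ky) ->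
    pop_ok M kv kx ky) _)))).
  apply: mso_all_fin => kv; apply: mso_all_fin => kx; apply: mso_all_fin => ky.
  apply: mso_imp (mso_in _ _ _) _; apply: mso_imp (mso_in _ _ _) _.
  exact: mso_imp (mso_in _ _ _) (mso_bool _ _).
apply: mso_ext (mso_and g1 (mso_and g2 (mso_and g3 (mso_and g4 g5)))) => w s1 s2.
split=> [[h1 [h2 [h3 [h4 h5]]]]|[h1 h2 h3 h4 h5]].
  split=> // v x y [xv lk ch nb]; apply: h5; split=> //; split=> //; split=> // t [xt tv].
  by apply: nb; rewrite xt.
do 4 (split=> //); move=> v x y [xv [lk [ch nb]]]; apply: h5; split=> // t /andP[xt tv].
exact: nb.
Qed.

Definition acceptance : mso_pred Sigma := fun w s1 s2 =>
  (forall i : pos w, letter w i <> None -> (exists c, i \in s2 (label_var c)) /\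
     forall c c', i \in s2 (label_var c) -> i \in s2 (label_var c') -> c == c') /\
  exists Y, @good_marks Sigma M C c0 D w (fun c => s2 (label_var c)) Y.

Lemma mso_acceptance : mso M acceptance.
Proof.
apply: mso_and.
  apply: (mso_all1 0 (P := fun w s1 s2 => letter w (s1 0) <> None ->
    (exists c, s1 0 \in s2 (label_var c)) /\
    forall c c', s1 0 \in s2 (label_var c) -> s1 0 \in s2 (label_var c') -> c == c')).
  apply: mso_imp; first exact: mso_not (mso_lab _ _ _).
  apply: mso_and; first by apply: mso_ex_fin => c; apply: mso_in.
  apply: mso_all_fin => c; apply: mso_all_fin => c'.
  by apply: mso_imp; [apply: mso_in|apply: mso_imp; [apply: mso_in|apply: mso_bool]].
apply: mso_ext (mso_ex_family m #|{: mark}| mso_good_marks) => w s1 s2.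
have eX h : (fun c => override m #|{: mark}| h s2 (label_var c)) = fun c => s2 (label_var c).
  by apply/funext => c; rewrite /override leqNgt ltn_ord.
have eY h : (fun k => override m #|{: mark}| h s2 (mark_var k)) = fun k => h (mark_var k).
  by apply/funext => k; rewrite /override /mark_var leq_addr ltn_add2l ltn_ord.
split=> [[h]|[Y gY]]; first by rewrite eX eY; exists (fun k => h (mark_var k)).
exists (fun X => if [pick k | mark_var k == X] is Some k then Y k else finset.set0); rewrite eX eY.
suff -> : (fun k => if [pick k' | mark_var k' == mark_var k] is Some k then Y k else finset.set0) = Y by [].
apply/funext => k; case: pickP => [k' /eqP/addnI/val_inj/enum_rank_inj -> //|/(_ k)].
by rewrite eqxx.
Qed.

Lemma acceptance_formula : exists b,
  (forall v, v \in bfree b -> exists2 X, X < m & v = inr X) /\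
  forall (w : seq Sigma) (s1 : nat -> pos w) (s2 : nat -> {set pos w}), bsat M s1 s2 b <-> acceptance s1 s2.
Proof.
apply: mso_close mso_acceptance => w s1 t1 s2 t2 e.
rewrite /acceptance; have -> : (fun c => s2 (label_var c)) = fun c => t2 (label_var c).
  by apply/funext => c; apply/e/ltn_ord.
suff -> : (forall i : pos w, letter w i <> None -> (exists c, i \in s2 (label_var c)) /\
     forall c c', i \in s2 (label_var c) -> i \in s2 (label_var c') -> c == c') =
   (forall i : pos w, letter w i <> None -> (exists c, i \in t2 (label_var c)) /\
     forall c c', i \in t2 (label_var c) -> i \in t2 (label_var c') -> c == c') by [].
have e' c : s2 (label_var c) = t2 (label_var c) by apply/e/ltn_ord.
by apply/propext; split=> h i /h[[c ic] un]; (split; first by exists c; move: ic; rewrite e');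
  move=> c1 c2 h1 h2; apply: un; move: h1 h2; rewrite !e'.
Qed.

End Definable.

(** * The restricted sentence of a Nivat form *)

Section Formula.
Local Open Scope ring_scope.
Variables (Sigma : finType) (M : opm Sigma) (K : pzSemiRingType).
Local Notation pos w := 'I_(size w).+2.

Definition sums (l : seq nat) (body : wformula Sigma K) := foldr (@WSum2 Sigma K) body l.

Lemma wsem_sums (w : seq Sigma) body a l s1 s2 :
  wsem (w := w) M s1 s2 (sums (iota a l) body) =
  \sum_(T : l.-tuple {set pos w}) (if all (fun I => I \in powerset (inner_pos w)) T then
     wsem M s1 (override a l (fun X => nth finset.set0 T (X - a)) s2) body else 0).
Proof.
elim: l a s2 => [|l IH] a s2 /=.
  rewrite (big_pred1 [tuple]) /=; last by move=> u; apply/esym/eqP/val_inj; case: u => -[].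
  congr (wsem _ _ _ _); apply/funext => X; rewrite /override; case: ifP => //; lia.
rewrite sum_tuple_cons big_mkcond; apply: eq_bigr => I _ /=.
case: ifP => hI; last by rewrite big1.
rewrite IH; apply: eq_bigr => T _; case: ifP => // _.
congr (wsem _ _ _ _); apply/funext => X; rewrite /override /=.
have [->|ne] := eqVneq X a; first by rewrite ltnn leqnn addnS ltnS leq_addr subnn.
have -> : (a <= X < a + l.+1)%N = (a < X < a.+1 + l)%N by lia.
by case: ifP => // h; rewrite (_ : (X - a = (X - a.+1).+1)%N) //; lia.
Qed.

Variables (C : finType) (f : C -> K).

Definition weight_formula : wformula Sigma K :=
  foldr (fun c acc => WAdd (WMul (WBool K (BIn Sigma 0 (label_var c))) (WConst Sigma (f c))) acc)
    (WConst Sigma 0) (enum C).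

Lemma weight_formula_almost_boolean : almost_boolean weight_formula.
Proof. by rewrite /weight_formula; elim: (enum C). Qed.

Lemma weight_formula_free v : v \in wfree weight_formula ->
  v = inl 0%N \/ exists2 X, (X < #|C|)%N & v = inr X.
Proof.
rewrite /weight_formula; elim: (enum C) => //= c s IH; rewrite !inE.
case/or3P => [/eqP->|/eqP->|/IH //]; [by left|right].
by exists (label_var c) => //; apply: ltn_ord.
Qed.

Lemma wsem_weight_formula w (s1 : nat -> pos w) (s2 : nat -> {set pos w}) c : (forall d, (s1 0%N \in s2 (label_var d)) = (d == c)) ->
  wsem M s1 s2 weight_formula = f c.
Proof.
move=> h; rewrite /weight_formula.
have -> : wsem M s1 s2 (foldr (fun c acc => WAdd (WMul (WBool K (BIn Sigma 0 (label_var c)))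
    (WConst Sigma (f c))) acc) (WConst Sigma 0) (enum C)) =
    \sum_(d <- enum C) (if d == c then f d else 0).
  elim: (enum C) => [|d s IH]; first by rewrite big_nil.
  rewrite big_cons -IH /= h; case: eqP => _; first by rewrite asboolT // mul1r.
  by rewrite asboolF // mul0r.
by rewrite -big_mkcond big_enum_cond /= (big_pred1 c).
Qed.

Lemma almost_boolean_sub (g h : wformula Sigma K) : subformula g h -> almost_boolean h -> almost_boolean g.
Proof.
elim: h => /= [b|k|h1 IH1 h2 IH2|h1 IH1 h2 IH2|x h IH|X h IH|x h IH]; try by case=> [->|] //.
- by case=> [-> //|[/IH1|/IH2] h' /andP[? ?]]; apply: h'.
- by case=> [-> //|[/IH1|/IH2] h' /andP[? ?]]; apply: h'.
Qed.

Lemma sub_sums (g body : wformula Sigma K) l : (forall X h, g <> WSum2 X h) ->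
  subformula g (sums l body) -> subformula g body.
Proof. by move=> ne; elim: l => //= X l IH [/ne|]. Qed.

Lemma free_sums v l (body : wformula Sigma K) : v \in wfree (sums l body) ->
  v \in wfree body /\ forall X, X \in l -> v <> inr X.
Proof.
elim: l => //= X l IH; rewrite mem_filter => /andP[vX /IH[vb vl]]; split=> // Y.
by rewrite inE => /predU1P[->|/vl //]; apply/eqP.
Qed.

Variables (c0 : C) (D : dopa (option Sigma * C)%type).

Lemma acceptance_partition w o (s1 : nat -> pos w) (s2 : nat -> {set pos w}) u : complete M w o ->
    partitioned (fun c => s2 (label_var c)) u -> u 0%N = c0 -> u (size w).+1 = c0 ->
  acceptance M c0 D s1 s2 <-> accept D (lab w u) (size w) o.
Proof.
move=> co part u0 un; rewrite -(good_marks_accept D co part u0 un); split=> [[]//|h]; split=> //.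
move=> i /eqP li; split=> [|c c' /(part _ _ li) -> /(part _ _ li) ->] //.
by exists (u i); apply/part.
Qed.

(** The outer sums range over families of sets indexed by the labels; the boolean factor kills all
    families but the codes of accepted labellings, and the product collects the weights. The left
    factor is boolean and the body of the product almost boolean, so the sentence is restricted. *)
Lemma nivat_formula : exists phi : wformula Sigma K, [/\ sentence phi, restricted phi
  & forall (w : op_word M) o, complete M (sval w) o ->
      sem phi w = wrun c0 f D (sval w) o (dini D (None, c0), [::])].
Proof.
have [b [bfr bE]] := acceptance_formula M c0 D.
pose body := WMul (WBool K b) (WProd 0%N weight_formula).
exists (sums (iota 0 #|C|) body); split.
- have no v : v \notin wfree (sums (iota 0 #|C|) body).
    apply/negP => /free_sums[] /=; rewrite mem_cat => /orP[/bfr[X XC ->]|].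
      by move=> /(_ X); rewrite mem_iota add0n XC => /(_ isT).
    rewrite mem_filter => /andP[v0 /weight_formula_free[v0'|[X XC ->]]].
      by rewrite v0' eqxx in v0.
    by move=> /(_ X); rewrite mem_iota add0n XC => /(_ isT).
  by rewrite /sentence; case: (wfree _) no => // v s /(_ v); rewrite inE eqxx.
- split=> [p t|x p] /sub_sums /=.
    case=> // [[-> _]|[[]//|[//|h]]]; first by left.
    by left; have /andP[] := almost_boolean_sub h weight_formula_almost_boolean.
  case=> // -[[]//|[[_ ->]|h]]; first exact: weight_formula_almost_boolean.
  by have := almost_boolean_sub h weight_formula_almost_boolean.
move=> w o co; rewrite -(wrun_accept c0 f D co) /sem wsem_sums; set w' := sval w in co *.
pose code (u : (size w').-tuple C) : #|C|.-tuple {set pos w'} :=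
  [tuple [set i : pos w' | (letter w' i != None) && (lbl c0 u i == enum_val j)] | j < #|C|].
have codeE u c : nth finset.set0 (code u) (label_var c) =
    [set i : pos w' | (letter w' i != None) && (lbl c0 u i == c)].
  by rewrite /label_var -tnth_nth tnth_mktuple enum_rankK.
have ovE (T : #|C|.-tuple {set pos w'}) s2 (c : C) :
    override 0 #|C| (fun X => nth finset.set0 T (X - 0)) s2 (label_var c) = nth finset.set0 T (label_var c).
  by rewrite /override subn0 add0n leq0n /=; case: ifP => // /negP[]; apply: ltn_ord.
rewrite (@sum_image _ _ _ code).
- apply: eq_bigr => u _; case: ifP => [al|/negP nal]; last first.
    case: nal; apply/allP => I /mapP[j _ ->]; rewrite !inE; apply/subsetP => i.
    by rewrite !inE letter_inner => /andP[].
  set s2 := override _ _ _ _.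
  have part : partitioned (fun c => s2 (label_var c)) (lbl c0 u).
    move=> i c li; rewrite -[i \in _]/(i \in s2 (label_var c)) /s2 ovE codeE inE li /=.
    by split=> [/eqP->|->].
  have acc := acceptance_partition (fun=> inord 1) co part erefl (lbl_out _ _).
  rewrite /= (asbool_equiv_eq (bE _ _ _)).
  have -> : `[< acceptance M c0 D (fun=> inord 1 : pos w') s2 >] = accept D (lab w' (lbl c0 u)) (size w') o.
    by apply/asboolP/idP => /acc; apply; right; rewrite size_tuple.
  case: ifP => _; last by rewrite mul0r.
  rewrite mul1r prod_inner big_tuple; apply: eq_bigr => i _.
  apply: wsem_weight_formula => d; rewrite /= /s2 ovE codeE inE letter_inner.
  rewrite inordK; last by rewrite !ltnS ltnW.
  by rewrite ltn_ord /lbl /= (tnth_nth c0) eq_sym.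
- move=> u v /(congr1 (fun T : #|C|.-tuple _ => tval T)) uv; apply: (@tuple_lbl_eq _ c0) => i iw.
  have hi : (i < (size w').+2)%N by lia.
  have := codeE u (lbl c0 u i); rewrite uv codeE => /setP/(_ (Ordinal hi)).
  by rewrite !inE letter_inner iw eqxx /= => /eqP.
- move=> T ne; case: ifP => // /allP al; rewrite /= (asbool_equiv_eq (bE _ _ _)).
  case: asboolP => [[part _]|_]; last by rewrite mul0r.
  (* A family satisfying the partition clause is the code of the labelling read off from it,
     contrary to [ne]. *)
  pose u := [tuple odflt c0 [pick c | inord i.+1 \in nth finset.set0 T (label_var c)] | i < size w'].
  have uN i : (i < size w')%N ->
      nth c0 u i = odflt c0 [pick c | inord i.+1 \in nth finset.set0 T (label_var c)].
    by move=> hi; rewrite -[i in LHS]/(nat_of_ord (Ordinal hi)) -tnth_nth tnth_mktuple.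
  clearbody u; case: (ne u); apply: eq_from_tnth => j; rewrite tnth_mktuple; apply/setP => i; rewrite inE.
  have jE : tnth T j = nth finset.set0 T (label_var (enum_val j)) by rewrite /label_var enum_valK -tnth_nth.
  have [li|li] /= := boolP (letter w' i != None); last first.
    apply/negbTE/negP => iT; case/negP: li; rewrite letter_inner.
    by have := al _ (mem_tnth j T); rewrite inE => /subsetP/(_ _ iT); rewrite inE.
  have [[c ic] un] := part i (elimN eqP li).
  rewrite ovE in ic.
  have uE : lbl c0 u i = c.
    move: li; rewrite letter_inner; case: i ic un => -[//|i] hi ic un /= iw.
    rewrite lbl_nth uN //.
    have -> : inord i.+1 = Ordinal hi by apply: val_inj; rewrite /= inordK.
    case: pickP => [c' ic'|/(_ c)]; last by rewrite ic.
    by apply/eqP/un; rewrite ovE.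
  rewrite uE jE; apply/idP/eqP => [iT|<- //].
  by apply/eqP/un; rewrite ovE.
Qed.

End Formula.

Unset Implicit Arguments.

Theorem theorem32 (K : pzSemiRingType) (Sigma : finType) (M : opm Sigma)
    (S : op_word M -> K) :
  ((exists A : wopa Sigma K, restricted_wopa A /\ S =1 behavior A) <->
   (exists phi : wformula Sigma K,
      [/\ sentence phi, restricted phi & S =1 sem phi]))
  /\
  (commutative (@GRing.mul K) ->
   ((exists A : wopa Sigma K, S =1 behavior A) <->
    (exists phi : wformula Sigma K,
       [/\ sentence phi, restricted phi & S =1 sem phi]))).
Proof.
have to_logic : nivat S -> exists phi : wformula Sigma K, [/\ sentence phi, restricted phi & S =1 sem phi].
  move=> [C [c0 [f [D SE]]]]; have [phi [sen res phiE]] := nivat_formula M f c0 D.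
  by exists phi; split=> // w; have [o co] := op_word_complete w; rewrite (SE _ _ co) (phiE _ _ co).
have of_logic : (exists phi : wformula Sigma K, [/\ sentence phi, restricted phi & S =1 sem phi]) ->
    exists A : wopa Sigma K, restricted_wopa A /\ S =1 behavior A.
  by move=> [phi [sen res SE]]; apply/nivat_rwopa/(restricted_nivat sen res SE).
split; first split=> // [[A [rA SE]]].
  apply: to_logic; apply: (wopa_nivat _ SE) => t /rA -> k; exact: commr1.
move=> comm; split=> [[A SE]|/of_logic[A [_ SE]]]; last by exists A.
by apply: to_logic; apply: (wopa_nivat _ SE) => t _ k; apply: comm.
Qed.
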